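(* Let $F$ be a field of characteristic not $2$, let $\Gamma$ be an additive abelian group with a skew-symmetric bicharacter $\epsilon:\Gamma\times\Gamma\to F^*$, let $A$ be a $\Gamma$-graded $(\epsilon,\Gamma)$-color-commutative associative $F$-algebra with an identity element, let $D\subset\mathrm{Der}^\epsilon(A)$ be a nonzero $\Gamma$-graded color-commutative subspace, and suppose that $A$ is $\Gamma$-graded $D$-simple. Let $W=[A[D],A[D]]$. (i) If $|\mathcal J|=\infty$, then $W=A[D]$. (ii) If $|\mathcal J|<\infty$, let $\gamma\in\mathcal J$ be the maximal element of $\mathcal J$, i.e. the element with $|\gamma|=\max\{|\alpha| : \alpha\in\mathcal J\}$. Then $$W=\bigoplus_{\alpha\in\mathcal J\setminus\{\gamma\}}A\,d^\alpha\ \oplus\ \mathcal D(A)\,d^\gamma .$$ (iii) The Lie color algebra $\overline{A[D]}=W/F_1$ is simple except when $A=F_1[t]/(t^2)$ and $D=F\frac{d}{dt}$ and both $t$ and $\frac{d}{dt}$ have colors in $\Gamma_-$.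
   Context: A skew-symmetric bicharacter is a map $\epsilon:\Gamma\times\Gamma\to F^*$ with $\epsilon(\lambda,\mu)=\epsilon(\mu,\lambda)^{-1}$ and $\epsilon(\lambda,\mu+\nu)=\epsilon(\lambda,\mu)\epsilon(\lambda,\nu)$. For a nonzero homogeneous element $x$ of a $\Gamma$-graded space, $\bar x\in\Gamma$ denotes its degree (color), and $\epsilon(x,y):=\epsilon(\bar x,\bar y)$. $H(B)$ is the set of homogeneous elements of a graded space $B$. Put $\Gamma_\pm=\{\lambda\in\Gamma\mid\epsilon(\lambda,\lambda)=\pm1\}$; then $\Gamma=\Gamma_+\cup\Gamma_-$. $A=\bigoplus_{\lambda\in\Gamma}A_\lambda$ is $(\epsilon,\Gamma)$-color-commutative if $xy=\epsilon(x,y)yx$ for all $x,y\in H(A)$. A homogeneous color-derivation of degree $\bar\partial\in\Gamma$ is an $F$-linear map $\partial:A\to A$ with $\partial(a)\in A_{\bar\partial+\bar a}$ and $\partial(ab)=\partial(a)b+\epsilon(\partial,a)a\partial(b)$ for all $a,b\in H(A)$. $\mathrm{Der}^\epsilon_\lambda(A)$ is the space of homogeneous color-derivations of degree $\lambda$, and $\mathrm{Der}^\epsilon(A)=\bigoplus_{\lambda}\mathrm{Der}^\epsilon_\lambda(A)$. A graded subspace $D\subset\mathrm{Der}^\epsilon(A)$ is color-commutative if $\partial\partial'=\epsilon(\partial,\partial')\partial'\partial$ for all $\partial,\partial'\in H(D)$. $A$ is graded $D$-simple if it has no $\Gamma$-graded $D$-stable ideals other than $0$ and $A$. $A[D]$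 is the associative subalgebra of $\mathrm{End}_F(A)$ generated by $A$ (acting by left multiplication) and $D$; it is $\Gamma$-graded. On a $\Gamma$-graded associative algebra the Lie color bracket is the bilinear map with $[x,y]=xy-\epsilon(x,y)yx$ for homogeneous $x,y$; $[A[D],A[D]]$ is the $F$-span of all brackets. A Lie color ideal of a Lie color algebra $L$ is a $\Gamma$-graded subspace $U$ with $[L,U]\subset U$; a Lie color algebra is simple if it is not abelian (its bracket is not identically zero) and has no Lie color ideals other than $0$ and itself. $F_1=A^D=\{u\in A\mid\partial(u)=0\ \forall\,\partial\in D\}$; when $A$ is graded $D$-simple every nonzero homogeneous element of $F_1$ is invertible, so $F_1$ is a graded field. $F_1$ is the $\epsilon$-center $\{x\in A[D]\mid[x,A[D]]=0\}$ of $A[D]$ and is contained in $W$. $F_1[D]$ is the subalgebra of $\mathrm{End}_F(A)$ generated by $F_1$ and $D$, and $\mathcal D=\mathrm{Der}^\epsilon(A)\cap F_1[D]$, which contains $D$; $\mathcal D(A)$ is the $F$-span of all $\partial(a)$, $\partial\in\mathcal D$, $a\in A$. Fix a homogeneous $F_1$-basis $\{d_i\mid i\in\mathcal I\}$ of $\mathcal D$ and a total ordering on $\mathcal I$. $\mathcal J$ is the set of all families $\alpha=(\alpha_i)_{i\in\mathcal I}$ of nonnegative integers, all but finitely many equal to $0$, with $\alpha_i\le p-1$ for all $i$ if $\mathrm{char}\,F=p>0$, and with $\alpha_i\in\{0,1\}$ whenever $\bar d_i\in\Gamma_-$. Write $|\alpha|=\sum_i\alpha_i$ and $d^\alpha=\prod_{i\in\mathcal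 I}d_i^{\alpha_i}\in A[D]$, the product being taken in the fixed order of $\mathcal I$; $d^0=1$. In (iii), $F_1[t]/(t^2)$ means $F_1\oplus F_1t$ with $t$ homogeneous and $t^2=0$, and $\frac{d}{dt}$ is the color-derivation that vanishes on $F_1$ and sends $t$ to $1$.
   Formalization: In (iii) the exception asks D = F d/dt only up to F_1-scalars (the F_1-span of D is F_1 d/dt); taken literally (iii) fails for A = F[u,1/u]⊗Λ(t), D = F d/dt + F u d/dt, where W/F_1 is abelian. *)

(* Defs.v *)
(* Libraries: MathComp and the classical layer of MathComp-Analysis. *)
From HB Require Import structures.
From mathcomp Require Import all_boot all_order all_algebra finmap.
From mathcomp Require Import boolp classical_sets functions cardinality fsbigop.
Set Implicit Arguments.
Unset Strict Implicit.
Unset Printing Implicit Defensive.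
Import Order.TTheory GRing.Theory.
Local Open Scope classical_set_scope.
Local Open Scope ring_scope.

Section Subspaces.
Variables (F : fieldType) (V : lmodType F).

Definition span (S : set V) : set V :=
  [set v | forall U : set V, submod_closed (mem U) -> S `<=` U -> U v].

(* U is the internal direct sum of the subspaces G i, i in J. *)
Definition direct_sum (T : choiceType) (J : set T) (G : T -> set V)
    (U : set V) : Prop :=
  [/\ forall i, J i -> submod_closed (mem (G i)),
      U = span (\bigcup_(i in J) G i) &
      forall (s : seq T) (v : T -> V), uniq s ->
        (forall i, i \in s -> J i /\ G i (v i)) ->
        \sum_(i <- s) v i = 0 -> forall i, i \in s -> v i = 0].

Definition graded_subspace (Gamma : zmodType) (gr : Gamma -> set V)
    (U : set V) : Prop :=
  direct_sum setT (fun l => U `&` gr l) U.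

(* The component of degree l of v : the w in gr l such that v - w is a sum of
   elements of the other gr m (0 if there is none). *)
Definition hcomp (Gamma : zmodType) (gr : Gamma -> set V) (l : Gamma)
    (v : V) : V :=
  xget 0 [set w | gr l w /\ span (\bigcup_(m in [set m | m <> l]) gr m) (v - w)].

End Subspaces.

Definition subalg_gen (F : fieldType) (B : algType F) (S : set B) : set B :=
  [set x | forall U : set B, subalg_closed (mem U) -> S `<=` U -> U x].

Section Colors.
Variables (F : fieldType) (Gamma : zmodType) (eps : Gamma -> Gamma -> F).

Definition skew_bicharacter : Prop :=
  [/\ forall l m, eps l m != 0,
      forall l m, eps l m = (eps m l)^-1 &
      forall l m n, eps l (m + n) = eps l m * eps l n].

Definition Gamma_minus : set Gamma := [set l | eps l l = -1].

(* The bilinear map such that [x, y] = x y - eps(l, m) y x for x, y homogeneous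
   of degrees l, m. The sums have finitely many nonzero terms when x and y are
   finite sums of homogeneous elements. *)
Definition color_bracket (B : algType F) (gr : Gamma -> set B) (x y : B) : B :=
  \sum_(l \in [set: Gamma]) \sum_(m \in [set: Gamma])
    (hcomp gr l x * hcomp gr m y - eps l m *: (hcomp gr m y * hcomp gr l x)).

Section LieColor.
Variables (V : lmodType F).
Implicit Types (gr : Gamma -> set V) (br : V -> V -> V) (L U : set V).

(* A Lie color algebra, given as a subspace L of V graded by the L `&` gr l. *)
Definition lie_color_algebra L gr br : Prop :=
  [/\ graded_subspace gr L,
      forall a x y z, L x -> L y -> L z ->
        br (a *: x + y) z = a *: br x z + br y z /\
        br z (a *: x + y) = a *: br z x + br z y,
      forall l m x y, (L `&` gr l) x -> (L `&` gr m) y ->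
        (L `&` gr (l + m)) (br x y),
      forall l m x y, (L `&` gr l) x -> (L `&` gr m) y ->
        br x y = - (eps l m *: br y x) &
      forall l m x y z, (L `&` gr l) x -> (L `&` gr m) y -> L z ->
        br x (br y z) = br (br x y) z + eps l m *: br y (br x z)].

Definition lie_color_ideal L gr br U : Prop :=
  [/\ graded_subspace gr U, U `<=` L &
      forall x u, L x -> U u -> U (br x u)].

Definition lie_color_simple L gr br : Prop :=
  (exists x y, [/\ L x, L y & br x y != 0]) /\
  (forall U, lie_color_ideal L gr br U -> U = [set 0] \/ U = L).

End LieColor.
End Colors.

Section LinearEndomorphisms.
Variables (F : fieldType) (A : algType F).

Definition is_endo (f : A -> A) : bool := `[< linear f >].

Record endo := Endo { endo_fun :> A -> A; endo_funP : is_endo endo_fun }.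

HB.instance Definition _ := [isSub for endo_fun].
HB.instance Definition _ := [Choice of endo by <:].

Lemma endoP (f g : endo) : f =1 g -> f = g.
Proof. by move=> fg; apply/val_inj/funext. Qed.

Lemma endo_is_linear (f : endo) : linear f.
Proof. exact/asboolP/(endo_funP f). Qed.

HB.instance Definition _ (f : endo) :=
  GRing.isLinear.Build F A A *:%R f (endo_is_linear f).

Fact endo_submod_closed : submod_closed is_endo.
Proof.
split=> [|a f g]; rewrite -?topredE /=.
  by apply/asboolP => b x y; rewrite /= scaler0 addr0.
move=> /asboolP fl /asboolP gl; apply/asboolP => b x y.
have E (z : A) : (a *: f + g) z = a *: f z + g z by [].
by rewrite !E fl gl !scalerDr !scalerA mulrC addrACA.
Qed.

HB.instance Definition _ := GRing.isSubmodClosed.Build F (A -> A) is_endo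
  endo_submod_closed.
HB.instance Definition _ := [SubChoice_isSubLmodule of endo by <:].

Fact endo1_subproof : is_endo id.
Proof. exact/asboolP. Qed.
Definition endo1 := Endo endo1_subproof.

Fact endoM_subproof (f g : endo) : is_endo (f \o g).
Proof. by apply/asboolP => a x y /=; rewrite !linearP. Qed.
Definition endoM f g := Endo (endoM_subproof f g).

Fact endoMA : associative endoM. Proof. by move=> *; exact: endoP. Qed.
Fact endo1M : left_id endo1 endoM. Proof. by move=> *; exact: endoP. Qed.
Fact endoM1 : right_id endo1 endoM. Proof. by move=> *; exact: endoP. Qed.
Fact endoMDl : left_distributive endoM +%R.
Proof. by move=> *; exact: endoP. Qed.
Fact endoMDr : right_distributive endoM +%R.
Proof. by move=> f g h; apply: endoP => x; rewrite /= raddfD. Qed.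
Fact endo1_neq0 : endo1 != 0.
Proof. by apply/eqP => /(congr1 (fun f : endo => f 1)) /eqP; rewrite oner_eq0. Qed.

HB.instance Definition _ := GRing.Zmodule_isNzRing.Build endo
  endoMA endo1M endoM1 endoMDl endoMDr endo1_neq0.

Fact endo_scaleAl a (f g : endo) : a *: (f * g) = (a *: f) * g.
Proof. exact: endoP. Qed.
HB.instance Definition _ := GRing.Lmodule_isLalgebra.Build F endo endo_scaleAl.
Fact endo_scaleAr a (f g : endo) : a *: (f * g) = f * (a *: g).
Proof. by apply: endoP => x; exact/esym/linearZ. Qed.
HB.instance Definition _ := GRing.Lalgebra_isAlgebra.Build F endo endo_scaleAr.

Fact lmul_subproof (a : A) : is_endo ( *%R a).
Proof. by apply/asboolP => b x y; rewrite mulrDr scalerAr. Qed.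
Definition lmul (a : A) : endo := Endo (lmul_subproof a).

End LinearEndomorphisms.

(* The quotient of V by the subspace spanned by K. *)
Section Quotient.
Variables (F : fieldType) (V : lmodType F) (K : set V).

Definition in_span : {pred V} := fun v => `[< span K v >].

Fact in_span_submod_closed : submod_closed in_span.
Proof.
split=> [|a x y]; rewrite -!topredE.
  by apply/asboolP => U [/set_mem U0 _] _.
move=> /asboolP xK /asboolP yK; apply/asboolP => U Umod KU.
by apply/set_mem; case: (Umod) => _; apply; apply/mem_set; [apply: xK|apply: yK].
Qed.
HB.instance Definition _ := GRing.isSubmodClosed.Build F V in_span
  in_span_submod_closed.

Definition lmod_quot : Type := @Quotient.quot V in_span.
HB.instance Definition _ := GRing.Zmodule.on lmod_quot.

Definition lmod_pi (x : V) : lmod_quot := (\pi_(@Quotient.quot V in_span) x)%qT.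
Definition lmod_repr (X : lmod_quot) : V := repr (X : @Quotient.quot V in_span).

Lemma lmod_piE x y : lmod_pi x = lmod_pi y <-> span K (x - y).
Proof.
split=> [/eqP|xy]; first by rewrite /lmod_pi -Quotient.idealrBE => /asboolP.
by apply/eqP; rewrite /lmod_pi -Quotient.idealrBE; apply/asboolP.
Qed.

Lemma lmod_reprK X : lmod_pi (lmod_repr X) = X.
Proof. exact: reprK. Qed.

Fact lmod_piD x y : lmod_pi (x + y) = lmod_pi x + lmod_pi y.
Proof. by rewrite /lmod_pi; rewrite piE. Qed.

Definition quot_scale (a : F) (X : lmod_quot) : lmod_quot :=
  lmod_pi (a *: lmod_repr X).

Fact quot_scaleE a x : quot_scale a (lmod_pi x) = lmod_pi (a *: x).
Proof.
apply/lmod_piE/asboolP; rewrite -scalerBr.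
suff: a *: (lmod_repr (lmod_pi x) - x) \in in_span by [].
by apply: rpredZ; apply/asboolP/lmod_piE/lmod_reprK.
Qed.

Fact quot_scaleA a b X : quot_scale a (quot_scale b X) = quot_scale (a * b) X.
Proof. by rewrite -[X]lmod_reprK !quot_scaleE scalerA. Qed.
Fact quot_scale1 : left_id 1 quot_scale.
Proof. by move=> X; rewrite -[X]lmod_reprK quot_scaleE scale1r. Qed.
Fact quot_scaleDr : right_distributive quot_scale +%R.
Proof.
move=> a X Y; rewrite -[X]lmod_reprK -[Y]lmod_reprK -lmod_piD !quot_scaleE.
by rewrite scalerDr lmod_piD.
Qed.
Fact quot_scaleDl X : {morph quot_scale^~ X : a b / a + b}.
Proof.
by move=> a b; rewrite -[X]lmod_reprK !quot_scaleE scalerDl lmod_piD.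
Qed.
HB.instance Definition _ := GRing.Zmodule_isLmodule.Build F lmod_quot
  quot_scaleA quot_scale1 quot_scaleDr quot_scaleDl.

Fact lmod_pi_is_linear : linear lmod_pi.
Proof. by move=> a x y; rewrite lmod_piD -quot_scaleE. Qed.
HB.instance Definition _ := GRing.isLinear.Build F V lmod_quot *:%R lmod_pi
  lmod_pi_is_linear.

(* The operation induced by br on the classes of those elements on which br is
   well defined modulo span K. *)
Definition quot_op (br : V -> V -> V) (X Y : lmod_quot) : lmod_quot :=
  lmod_pi (br (lmod_repr X) (lmod_repr Y)).

End Quotient.

Section ColorDerivations.
Variables (F : fieldType) (Gamma : zmodType) (eps : Gamma -> Gamma -> F).
Variables (A : algType F) (gr : Gamma -> set A).

Definition graded_algebra : Prop :=
  direct_sum setT gr setT /\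
  forall l m a b, gr l a -> gr m b -> gr (l + m) (a * b).

Definition color_commutative_algebra : Prop :=
  forall l m a b, gr l a -> gr m b -> a * b = eps l m *: (b * a).

Definition endo_gr (l : Gamma) : set (endo A) :=
  [set f | forall m a, gr m a -> gr (l + m) (f a)].

Definition Der_gr (l : Gamma) : set (endo A) :=
  [set d | endo_gr l d /\ forall m n a b, gr m a -> gr n b ->
             d (a * b) = d a * b + eps l m *: (a * d b)].

Definition Der : set (endo A) := span (\bigcup_(l in setT) Der_gr l).

Section WithD.
Variable D : set (endo A).

Definition color_commutative_subspace : Prop :=
  forall l m d d', (D `&` Der_gr l) d -> (D `&` Der_gr m) d' ->
    d * d' = eps l m *: (d' * d).

Definition graded_ideal (U : set A) : Prop :=
  graded_subspace gr U /\ forall a x, U x -> U (a * x) /\ U (x * a).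

Definition graded_D_simple : Prop :=
  forall U, graded_ideal U -> (forall d x, D d -> U x -> U (d x)) ->
    U = [set 0] \/ U = setT.

(* A[D] *)
Definition AD : set (endo A) := subalg_gen (range (@lmul F A) `|` D).

(* F_1, as a subset of A and as a subset of End_F(A) *)
Definition F1 : set A := [set u | forall d, D d -> d u = 0].
Definition F1_endo : set (endo A) := @lmul F A @` F1.

(* F_1[D] *)
Definition F1D : set (endo A) := subalg_gen (F1_endo `|` D).

Definition calD : set (endo A) := Der `&` F1D.
Definition calD_A : set A := span [set x | exists2 d, calD d & exists a, x = d a].

(* d i has degree dg i; being part of a basis, d i is nonzero, so that dg i is
   the color of d i. *)
Definition homogeneous_F1_basis (I : choiceType) (d : I -> endo A)
    (dg : I -> Gamma) : Prop :=
  [/\ forall i, calD (d i) /\ endo_gr (dg i) (d i),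
      forall x, calD x -> exists (s : seq I) (u : I -> A),
        (forall i, F1 (u i)) /\ x = \sum_(i <- s) lmul (u i) * d i &
      forall (s : seq I) (u : I -> A), uniq s -> (forall i, F1 (u i)) ->
        \sum_(i <- s) lmul (u i) * d i = 0 -> forall i, i \in s -> u i = 0].

(* W = [A[D], A[D]] *)
Definition W : set (endo A) :=
  span [set z | exists2 x, AD x & exists2 y, AD y &
                  z = color_bracket eps endo_gr x y].

(* W / F_1 as a subspace of End_F(A) / F_1, with the induced grading and bracket;
   F1_endo is a subspace, so that it is its own span in lmod_quot. *)
Definition W_mod_F1 : set (lmod_quot F1_endo) := lmod_pi F1_endo @` W.
Definition W_mod_F1_gr (l : Gamma) : set (lmod_quot F1_endo) :=
  lmod_pi F1_endo @` (W `&` endo_gr l).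
Definition W_mod_F1_bracket (X Y : lmod_quot F1_endo) : lmod_quot F1_endo :=
  quot_op (color_bracket eps endo_gr) X Y.

(* A = F_1 (+) F_1 t with t homogeneous, t^2 = 0, and ddt is the
   color-derivation d/dt; tl and dl are the colors of t and ddt. The condition
   D = F d/dt is imposed up to F_1-scalars, i.e. on the F_1-span of D: A[D], F_1,
   calD and W only depend on that span, and e.g. D = F d/dt + F u d/dt with u in
   F_1 homogeneous gives the same (abelian) W / F_1 as D = F d/dt. *)
Definition exceptional_case : Prop :=
  exists (t : A) (ddt : endo A) (tl dl : Gamma),
    [/\ [/\ gr tl t, t * t = 0 &
           forall a, exists! uv : A * A,
             [/\ F1 uv.1, F1 uv.2 & a = uv.1 + uv.2 * t]],
        [/\ Der_gr dl ddt, forall u, F1 u -> ddt u = 0 & ddt t = 1],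
        span [set z | exists2 u, F1 u & exists2 d, D d & z = lmul u * d] =
          [set z | exists2 u, F1 u & z = lmul u * ddt] &
        Gamma_minus eps tl /\ Gamma_minus eps dl].

End WithD.
End ColorDerivations.
Arguments W_mod_F1 {F Gamma} eps {A} gr D.
Arguments W_mod_F1_gr {F Gamma} eps {A} gr D l.
Arguments W_mod_F1_bracket {F Gamma} eps {A} gr D.

Section MultiIndices.
Variables (F : fieldType) (Gamma : zmodType) (eps : Gamma -> Gamma -> F).
Variables (disp : Order.disp_t) (I : orderType disp).

Definition multi_index : Type := {fsfun I -> nat with 0%N}.

Definition calJ (dg : I -> Gamma) : set multi_index :=
  [set alpha : multi_index |
    (forall p, p \in [pchar F] -> forall i, (alpha i <= p.-1)%N) /\
    (forall i, Gamma_minus eps (dg i) -> (alpha i <= 1)%N)].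

Definition msize (alpha : multi_index) : nat := \sum_(i <- finsupp alpha) alpha i.

(* the product of the d i ^+ alpha i, i increasing *)
Definition mpow (B : algType F) (d : I -> B) (alpha : multi_index) : B :=
  \prod_(i <- sort <=%O (finsupp alpha)) d i ^+ alpha i.

End MultiIndices.

(* Main.v *)
Require Import Defs.
From HB Require Import structures.
From mathcomp Require Import all_boot all_order all_algebra finmap ring.
From mathcomp Require Import boolp classical_sets functions cardinality fsbigop.
Set Implicit Arguments.
Unset Strict Implicit.
Unset Printing Implicit Defensive.
Import Order.TTheory GRing.Theory.
Local Open Scope classical_set_scope.
Local Open Scope ring_scope.
Local Notation span := Defs.span.

(** Write R for A[D] and [x, y] for its color bracket, and call an element even
    or odd according to whether its degree lies in Gamma_+ or Gamma_-.

    Graded D-simplicity is used in one form only ([simple_ind],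
    [full_of_ideal]): a D-stable subspace of A that contains A y for some
    homogeneous y <> 0 is all of A. It gives two tools. The first is a density
    theorem ([density]): if homogeneous color derivations d_1, ..., d_n
    color-commute with D and are independent over F_1, then the vectors
    (d_1 x, ..., d_n x) span A^n over A. So the d_j are independent over A, and
    when a left A-submodule of R contains the sums of the +- d_j(x) Y_j for all
    x, it contains every Y_j ([separate]). The second is that a nonzero
    homogeneous color derivation of A with values in F_1 exists only in the
    exceptional case ([exceptional_of_F1_derivation]).

    Simplicity of W / F_1. Outside the exceptional case, a left A-submodule
    that contains A and all [d d', x] contains D ([D_sub_of_brackets]); with
    [b d, x] = b d(x) this shows that W contains A and A D. Let U be a graded
    ideal of W not inside F_1. Bracketing repeatedly with A lowers the order of
    an operator, so U meets A outside F_1 ([ideal_meets_A]), and simplicity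
    gives that U contains A. The set T of the x in R with [x, R] inside U is an
    associative subalgebra and contains [U, U]. It too meets A outside F_1,
    hence contains A, then the [d d', x], then D. So T = R and U contains
    [R, R] = W. In the exceptional case R = A + A e for one odd derivation e
    with e(A) inside F_1, and W / F_1 is abelian.

    Description of W. As F_1[D] is color-commutative, odd basis elements
    square to 0, and the p-th power of an even one is again a derivation in
    F_1[D] ([Der_Frobenius]); hence R is spanned over A by the d^alpha with
    alpha in J ([mpows_AD]). Modulo lower order, [d^beta, x] is the sum over j
    of the beta_j d_j(x) d^(beta - e_j), up to nonzero scalars, and beta_j is
    invertible in F ([lead_mpow]). Read on a linear relation, this gives by
    induction on the order that the d^alpha are independent over A
    ([mpow_indep]). Read inside W, it gives A d^alpha, by [separate], as soon
    as some alpha + e_i lies in J ([W_mpow]); only the maximal element of J, if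
    there is one, escapes. Finally W = [R, A] + [R, D] ([W_min_gen]): brackets
    with A have no term in d^gamma since they lower the order, and
    [d, a d^gamma] = d(a) d^gamma. *)

(** * Subspaces and gradings *)

Section Subspace.
Variables (F : fieldType) (V : lmodType F).
Implicit Types (U S : set V).

Definition subsp U := U 0 /\ forall a x y, U x -> U y -> U (a *: x + y).

Lemma subspP U : submod_closed (mem U) <-> subsp U.
Proof.
split=> [[U0 Ul]|[U0 Ul]].
  split=> [|a x y Ux Uy]; first exact/set_mem.
  by apply/set_mem/Ul; apply/mem_set.
split=> [|a x y /set_mem Ux /set_mem Uy]; apply/mem_set => //.
exact: Ul.
Qed.

Lemma subspD U x y : subsp U -> U x -> U y -> U (x + y).
Proof. by move=> [_ h] Ux Uy; rewrite -[x]scale1r; exact: h. Qed.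

Lemma subspZ U a x : subsp U -> U x -> U (a *: x).
Proof. by move=> [U0 h] Ux; rewrite -[_ *: _]addr0; exact: h. Qed.

Lemma subspN U x : subsp U -> U x -> U (- x).
Proof. by move=> h Ux; rewrite -scaleN1r; exact: subspZ. Qed.

Lemma subspB U x y : subsp U -> U x -> U y -> U (x - y).
Proof. by move=> h Ux Uy; apply: subspD => //; exact: subspN. Qed.

Lemma subsp_sum U (T : Type) (s : seq T) (P : pred T) (f : T -> V) :
  subsp U -> (forall i, P i -> U (f i)) -> U (\sum_(i <- s | P i) f i).
Proof.
move=> h hf; elim/big_ind: _ => //; first by case: h.
by move=> x y; exact: subspD.
Qed.

Lemma subsp_sum_seq U (T : eqType) (s : seq T) (f : T -> V) :
  subsp U -> (forall i, i \in s -> U (f i)) -> U (\sum_(i <- s) f i).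
Proof. by move=> h hf; rewrite big_seq; exact: subsp_sum. Qed.

Lemma subspZ_eq U a x : subsp U -> a != 0 -> U (a *: x) -> U x.
Proof.
by move=> h a0 /(subspZ a^-1 h); rewrite scalerA mulVf// scale1r.
Qed.

Lemma span_subsp S : subsp (span S).
Proof.
split=> [U /subspP[]//|a x y xS yS U Us SU].
by have /subspP[_ h] := Us; apply: h; [apply: xS|apply: yS].
Qed.

Lemma sub_span S : S `<=` span S.
Proof. by move=> x Sx U _; exact. Qed.

Lemma span_min S U : subsp U -> S `<=` U -> span S `<=` U.
Proof. by move=> /subspP Us SU x; exact. Qed.

Lemma span_mono S S' : S `<=` S' -> span S `<=` span S'.
Proof.
move=> SS'; apply: span_min (span_subsp _) _.
exact: subset_trans SS' (@sub_span _).
Qed.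

Lemma span_id U : subsp U -> span U = U.
Proof.
by move=> Us; apply/seteqP; split; [exact: span_min|exact: sub_span].
Qed.

Lemma subspI U U' : subsp U -> subsp U' -> subsp (U `&` U').
Proof.
move=> [h0 h] [k0 k]; split=> [|a x y [? ?] [? ?]] //.
by split; [apply: h|apply: k].
Qed.

Lemma subsp0 U : subsp U -> U 0. Proof. by case. Qed.

Lemma subsp_set0 : subsp [set (0 : V)].
Proof. by split=> // a x y -> ->; rewrite scaler0 addr0. Qed.

End Subspace.

Lemma subsp_preim (F : fieldType) (V V' : lmodType F) (f : V -> V') (U : set V') :
  (forall a x y, f (a *: x + y) = a *: f x + f y) -> subsp U ->
  subsp [set x | U (f x)].
Proof.
move=> fl Us; split=> [|a x y Ux Uy] /=; last first.
  by rewrite fl; case: Us => _; apply.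
have /eqP := fl 1 0 0; rewrite scaler0 addr0 scale1r.
by rewrite -subr_eq0 opprD addrA subrr sub0r oppr_eq0 => /eqP f0; rewrite /= f0; case: Us.
Qed.

Lemma big_widen_seq (V : nmodType) (T : eqType) (s t : seq T) (f : T -> V) :
  uniq s -> uniq t -> {subset s <= t} -> (forall i, i \notin s -> f i = 0) ->
  \sum_(i <- t) f i = \sum_(i <- s) f i.
Proof.
move=> us ut st f0; rewrite (bigID (mem s))/= [X in _ + X]big1 ?addr0//.
rewrite -big_filter; apply: perm_big; apply: uniq_perm => //.
  exact: filter_uniq.
by move=> i; rewrite mem_filter/=; case: (boolP (i \in s)) => // /st.
Qed.

Section Graded.
Variables (F : fieldType) (V : lmodType F) (Gamma : zmodType).
Variable gr : Gamma -> set V.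

(** The components need not span V: operators of fixed degree are independent,
    but their sum is a proper subspace of End(A) in general. *)
Definition indep_grading : Prop :=
  (forall l, subsp (gr l)) /\
  forall (s : seq Gamma) (f : Gamma -> V), uniq s ->
    (forall l, l \in s -> gr l (f l)) -> \sum_(l <- s) f l = 0 ->
    forall l, l \in s -> f l = 0.

Definition hspan : set V := span (\bigcup_(l in setT) gr l).

Hypothesis grP : indep_grading.

Let gr_subsp l : subsp (gr l). Proof. by case: grP. Qed.

Lemma span_hom_decomp (P : set Gamma) v : span (\bigcup_(l in P) gr l) v ->
  exists (s : seq Gamma) (f : Gamma -> V),
    [/\ uniq s, forall l, gr l (f l), forall l, ~ P l -> f l = 0,
        forall l, l \notin s -> f l = 0 & v = \sum_(l <- s) f l].
Proof.
pose Q := [set v | exists (s : seq Gamma) (f : Gamma -> V),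
    [/\ uniq s, forall l, gr l (f l), forall l, ~ P l -> f l = 0,
        forall l, l \notin s -> f l = 0 & v = \sum_(l <- s) f l]].
apply: (@span_min _ _ _ Q); last first.
  move=> x [l Pl glx]; exists [:: l], (fun m => if m == l then x else 0).
  split=> //= [m|m Pm|m|].
  - by case: eqP => [->//|_]; exact: subsp0.
  - by case: eqP => // ml; rewrite ml in Pm.
  - by rewrite inE => /negbTE ->.
  - by rewrite big_seq1 eqxx.
split.
  exists [::], (fun=> 0); split=> // [l|]; first exact: subsp0.
  by rewrite big_nil.
move=> a x y [s [f [us fg fP fs ->]]] [t [g [ut gg gP gs ->]]].
exists (undup (s ++ t)), (fun l => a *: f l + g l); split.
- exact: undup_uniq.
- by move=> l; case: (gr_subsp l) => _; apply.
- by move=> l Pl; rewrite fP// gP// scaler0 addr0.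
- move=> l; rewrite mem_undup mem_cat negb_or => /andP[ls lt].
  by rewrite fs// gs// scaler0 addr0.
- rewrite big_split/= -scaler_sumr; congr (_ *: _ + _); apply/esym/big_widen_seq => //;
    rewrite ?undup_uniq// => l; rewrite mem_undup mem_cat => ->//.
  by rewrite orbT.
Qed.

Lemma hcomp_sum_id (s : seq Gamma) (f : Gamma -> V) l :
  uniq s -> (forall l, gr l (f l)) -> (forall l, l \notin s -> f l = 0) ->
  hcomp gr l (\sum_(l <- s) f l) = f l.
Proof.
move=> us fg fs; rewrite /hcomp; case: xgetP => [w _ [gw]|].
  move=> /span_hom_decomp[t [g [ut gg gP gt E]]].
  pose u := undup (l :: s ++ t).
  (* in degree l only f l - w can occur, since g vanishes there *)
  have : \sum_(m <- u) (f m - (if m == l then w else 0) - g m) = 0.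
    rewrite !sumrB (@big_widen_seq _ _ s u f) ?undup_uniq//; last first.
      by move=> m ms; rewrite mem_undup inE mem_cat ms orbT.
    rewrite (@big_widen_seq _ _ t u g) ?undup_uniq//; last first.
      by move=> m mt; rewrite mem_undup inE mem_cat mt !orbT.
    rewrite (@big_widen_seq _ _ [:: l] u) ?undup_uniq//; first last.
    - by move=> m; rewrite inE => /negbTE ->.
    - by move=> m; rewrite mem_undup !inE => ->.
    by rewrite big_seq1 eqxx -E subrr.
  case: grP => _ /[apply]; rewrite undup_uniq => /(_ isT) h.
  have : f l - (if l == l then w else 0) - g l = 0.
    apply: h; last by rewrite mem_undup inE eqxx.
    move=> m _; apply: subspB => //; apply: subspB => //.
    by case: eqP => [->//|_]; exact: subsp0.
  by rewrite eqxx gP => [|/(_ erefl)//]; rewrite subr0 => /eqP; rewrite subr_eq0 => /eqP ->.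
move=> /(_ (f l)) []; split => //.
case: (boolP (l \in s)) => ls; last first.
  rewrite (fs l ls) subr0; apply: subsp_sum_seq (span_subsp _) _ => m ms.
  by apply: sub_span; exists m => //= ml; rewrite -ml ms in ls.
rewrite (bigD1_seq l)//= addrC addrK; apply: subsp_sum (span_subsp _) _ => m ml.
by apply: sub_span; exists m => //=; apply/eqP.
Qed.

Lemma hspan_subsp : subsp hspan. Proof. exact: span_subsp. Qed.

Lemma gr_hspan l x : gr l x -> hspan x.
Proof. by move=> gx; apply: sub_span; exists l. Qed.

Lemma hcompP v : hspan v -> exists s : seq Gamma,
  [/\ uniq s, forall l, l \notin s -> hcomp gr l v = 0 &
      v = \sum_(l <- s) hcomp gr l v].
Proof.
move=> /span_hom_decomp[s [f [us fg _ fs E]]]; exists s.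
have fE l : hcomp gr l v = f l by rewrite E hcomp_sum_id.
by split=> // [l /fs|]; rewrite ?fE//; under eq_bigr do rewrite fE.
Qed.

Lemma hcomp_gr l v : hspan v -> gr l (hcomp gr l v).
Proof.
by move=> /span_hom_decomp[s [f [us fg _ fs ->]]]; rewrite hcomp_sum_id.
Qed.

Lemma hcomp_linear l a x y : hspan x -> hspan y ->
  hcomp gr l (a *: x + y) = a *: hcomp gr l x + hcomp gr l y.
Proof.
move=> /span_hom_decomp[s [f [us fg _ fs Ex]]].
move=> /span_hom_decomp[t [g [ut gg _ gt Ey]]].
pose u := undup (s ++ t).
have su : {subset s <= u} by move=> i; rewrite mem_undup mem_cat => ->.
have tu : {subset t <= u} by move=> i; rewrite mem_undup mem_cat orbC => ->.
have uu : uniq u by rewrite undup_uniq.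
have -> : a *: x + y = \sum_(l <- u) (a *: f l + g l).
  by rewrite big_split/= -scaler_sumr (big_widen_seq us uu su fs) (big_widen_seq ut uu tu gt) Ex Ey.
rewrite Ex Ey !hcomp_sum_id// => m.
  by case: (gr_subsp m) => _; apply.
by rewrite mem_undup mem_cat negb_or => /andP[/fs-> /gt->]; rewrite scaler0 addr0.
Qed.

Lemma hcomp0 l : hcomp gr l 0 = 0.
Proof.
have := hcomp_sum_id l (s := [::]) (f := fun=> 0) isT _ (fun _ _ => erefl).
by rewrite big_nil; apply=> m; exact: subsp0.
Qed.

Lemma hcompD l x y : hspan x -> hspan y ->
  hcomp gr l (x + y) = hcomp gr l x + hcomp gr l y.
Proof. by move=> hx hy; rewrite -[x]scale1r hcomp_linear// !scale1r. Qed.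

Lemma hcomp_sum (T : Type) (s : seq T) (P : pred T) (f : T -> V) l :
  (forall i, P i -> hspan (f i)) ->
  hcomp gr l (\sum_(i <- s | P i) f i) = \sum_(i <- s | P i) hcomp gr l (f i).
Proof.
move=> hf; elim: s => [|i s IH]; first by rewrite !big_nil hcomp0.
rewrite !big_cons; case: ifP => // Pi; rewrite hcompD ?IH ?hf//.
  exact: hf.
exact: subsp_sum hspan_subsp hf.
Qed.

Lemma hcomp_hom l m x : gr l x -> hcomp gr m x = if m == l then x else 0.
Proof.
move=> gx; have := hcomp_sum_id m (s := [:: l]) (f := fun m => if m == l then x else 0).
rewrite big_seq1 eqxx; apply=> // k; last by rewrite inE => /negbTE ->.
by case: eqP => [->//|_]; exact: subsp0.
Qed.

Lemma hcomp_id l x : gr l x -> hcomp gr l x = x.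
Proof. by move=> gx; rewrite (hcomp_hom _ gx) eqxx. Qed.

Lemma gr_unique l m x : gr l x -> gr m x -> x != 0 -> l = m.
Proof.
move=> gl gm /eqP x0; apply/eqP; apply: contra_notT x0 => lm.
by rewrite -(hcomp_id gl) (hcomp_hom _ gm) (negbTE lm).
Qed.

Definition hclosed (U : set V) := forall l x, U x -> U (hcomp gr l x).

Lemma graded_subspaceP U : subsp U ->
  graded_subspace gr U <-> (U `<=` hspan /\ hclosed U).
Proof.
move=> Us; split=> [[_ EU _]|[UH hU]].
  have UH : U `<=` hspan.
    by rewrite EU; apply: span_mono => x [l _ [_ gx]]; exists l.
  split=> // l x; rewrite [in U x]EU => xU.
  suff : (hspan `&` [set x | U (hcomp gr l x)]) x by case.
  apply: (span_min _ _ xU) => [|y [m _ [Uy gy]]].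
    split=> [|a y z [yH Uy] [zH Uz]].
      by split=> /=; [exact: subsp0 hspan_subsp|rewrite hcomp0; exact: subsp0].
    split; first by case: hspan_subsp => _; apply.
    by rewrite /= hcomp_linear//; case: Us => _; apply.
  split; first exact: UH.
  by rewrite /= (hcomp_hom _ gy); case: ifP => // _; exact: subsp0.
split=> [l _||s v us vU].
- by apply/subspP; exact: subspI.
- apply/seteqP; split=> x; last by apply: span_min => // y [l _ []].
  move=> Ux; have [s [us _ ->]] := hcompP (UH _ Ux).
  apply: subsp_sum (span_subsp _) _ => l _; apply: sub_span; exists l => //.
  by split; [exact: hU|exact: hcomp_gr (UH _ Ux)].
- by case: grP => _; apply => // l /vU[_ []].
Qed.

(** Graded subspaces are compared on homogeneous elements only. *)
Lemma hom_sub (U Q : set V) : U `<=` hspan -> hclosed U -> subsp Q ->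
  (forall l x, U x -> gr l x -> Q x) -> U `<=` Q.
Proof.
move=> UH hU Qs h x Ux; have [s [_ _ ->]] := hcompP (UH _ Ux).
apply: subsp_sum => // l _; apply: h (hU l _ Ux) (hcomp_gr _ (UH _ Ux)).
Qed.

Lemma hcomp_span (S : set V) l x : (forall y, S y -> exists m, gr m y) ->
  span S x -> span (S `&` gr l) (hcomp gr l x).
Proof.
move=> hS; suff: span S `<=` hspan `&` [set x | span (S `&` gr l) (hcomp gr l x)].
  by move=> /[apply] -[].
apply: span_min => [|y Sy].
  split=> [|a y z [yH Uy] [zH Uz]].
    by split=> /=; [exact: subsp0 hspan_subsp|rewrite hcomp0; exact: subsp0 (span_subsp _)].
  split; first by case: hspan_subsp => _; apply.
  rewrite /= hcomp_linear//; have [_] := span_subsp (S `&` gr l); exact.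
have [m gy] := hS _ Sy; split; first exact: gr_hspan gy.
rewrite /= (hcomp_hom _ gy); case: ifPn => [/eqP ->|_]; last exact: subsp0 (span_subsp _).
exact: sub_span.
Qed.

Lemma span_hclosed (S : set V) : (forall y, S y -> exists m, gr m y) ->
  hclosed (span S).
Proof.
by move=> hS l x /(hcomp_span (l := l) hS); apply: span_mono => y [].
Qed.

Lemma span_hspan (S : set V) : (forall y, S y -> exists m, gr m y) ->
  span S `<=` hspan.
Proof.
by move=> hS; apply: span_mono => y /hS[m gy]; exists m.
Qed.

Lemma span_hom (S : set V) l x : (forall y, S y -> exists m, gr m y) ->
  span S x -> gr l x -> span (S `&` gr l) x.
Proof. by move=> hS Sx gx; rewrite -(hcomp_id gx); exact: hcomp_span. Qed.

End Graded.

(** * The color bracket on sums of homogeneous elements *)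

Section Bracket.
Variables (F : fieldType) (Gamma : zmodType) (eps : Gamma -> Gamma -> F).
Variables (B : algType F) (gr : Gamma -> set B).
Hypothesis grP : indep_grading gr.

Lemma bracket_sum (s t : seq Gamma) (x y : B) : uniq s -> uniq t ->
  (forall l, l \notin s -> hcomp gr l x = 0) ->
  (forall l, l \notin t -> hcomp gr l y = 0) ->
  color_bracket eps gr x y = \sum_(l <- s) \sum_(m <- t)
    (hcomp gr l x * hcomp gr m y - eps l m *: (hcomp gr m y * hcomp gr l x)).
Proof.
move=> us ut xs yt; rewrite /color_bracket.
have E l : \sum_(m \in [set: Gamma])
    (hcomp gr l x * hcomp gr m y - eps l m *: (hcomp gr m y * hcomp gr l x)) =
    \sum_(m <- t)
    (hcomp gr l x * hcomp gr m y - eps l m *: (hcomp gr m y * hcomp gr l x)).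
  rewrite [RHS]fsbig_seq//; apply/esym/fsbig_widen => // m [_ mt] /=.
  by rewrite yt; [|exact/negP]; rewrite mulr0 mul0r scaler0 subr0.
under eq_fsbigr do rewrite E.
rewrite [RHS]fsbig_seq//; apply/esym/fsbig_widen => // l [_ ls] /=.
by rewrite big1// => m _; rewrite xs; [|exact/negP]; rewrite mulr0 mul0r scaler0 subr0.
Qed.

Lemma bracket_hom l m x y : gr l x -> gr m y ->
  color_bracket eps gr x y = x * y - eps l m *: (y * x).
Proof.
move=> gx gy; rewrite (@bracket_sum [:: l] [:: m])//.
- by rewrite !big_seq1 !hcomp_id.
- by move=> k; rewrite inE => /negbTE E; rewrite (hcomp_hom grP _ gx) E.
- by move=> k; rewrite inE => /negbTE E; rewrite (hcomp_hom grP _ gy) E.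
Qed.

Lemma hcompP2 x y : hspan gr x -> hspan gr y -> exists s : seq Gamma,
  [/\ uniq s, forall l, l \notin s -> hcomp gr l x = 0 &
      forall l, l \notin s -> hcomp gr l y = 0].
Proof.
move=> /(hcompP grP)[s [_ xs _]] /(hcompP grP)[t [_ yt _]].
exists (undup (s ++ t)); rewrite undup_uniq; split=> // l;
  by rewrite mem_undup mem_cat negb_or => /andP[? ?]; (apply: xs || apply: yt).
Qed.

Lemma bracket_linearl a x y z : hspan gr x -> hspan gr y -> hspan gr z ->
  color_bracket eps gr (a *: x + y) z =
  a *: color_bracket eps gr x z + color_bracket eps gr y z.
Proof.
move=> hx hy hz; have [s [us xs ys]] := hcompP2 hx hy.
have [t [ut zt _]] := hcompP grP hz.
rewrite !(@bracket_sum s t)//; last first.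
  by move=> l ls; rewrite hcomp_linear// xs// ys// scaler0 addr0.
rewrite scaler_sumr -big_split/=; apply: eq_bigr => l _.
rewrite scaler_sumr -big_split/=; apply: eq_bigr => m _.
rewrite hcomp_linear// mulrDl mulrDr -scalerAl -scalerAr scalerDr scalerBr.
by rewrite opprD addrACA !scalerA (mulrC a).
Qed.

Lemma bracket_linearr a x y z : hspan gr x -> hspan gr y -> hspan gr z ->
  color_bracket eps gr z (a *: x + y) =
  a *: color_bracket eps gr z x + color_bracket eps gr z y.
Proof.
move=> hx hy hz; have [s [us xs ys]] := hcompP2 hx hy.
have [t [ut zt _]] := hcompP grP hz.
rewrite !(@bracket_sum t s)//; last first.
  by move=> l ls; rewrite hcomp_linear// xs// ys// scaler0 addr0.
rewrite scaler_sumr -big_split/=; apply: eq_bigr => l _.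
rewrite scaler_sumr -big_split/=; apply: eq_bigr => m _.
rewrite hcomp_linear// mulrDl mulrDr -scalerAl -scalerAr scalerDr scalerBr.
by rewrite opprD addrACA !scalerA (mulrC a).
Qed.

(** The bracket is bilinear on sums of homogeneous elements, not on all of B;
    hence the two inclusions in [hspan]. *)
Lemma bracket_span (S1 S2 Q : set B) : S1 `<=` hspan gr -> S2 `<=` hspan gr ->
  subsp Q -> (forall x y, S1 x -> S2 y -> Q (color_bracket eps gr x y)) ->
  forall x y, span S1 x -> span S2 y -> Q (color_bracket eps gr x y).
Proof.
move=> S1H S2H Qs h x y xS yS.
have S1H' : span S1 `<=` hspan gr by apply: span_min S1H; exact: hspan_subsp.
have S2H' : span S2 `<=` hspan gr by apply: span_min S2H; exact: hspan_subsp.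
have H0 : hspan gr 0 by exact: subsp0 (hspan_subsp _).
have b0l z : hspan gr z -> color_bracket eps gr 0 z = 0.
  move=> hz; have := bracket_linearl 1 H0 H0 hz; rewrite scaler0 addr0 scale1r.
  by move=> /eqP; rewrite -subr_eq0 opprD addrA subrr sub0r oppr_eq0 => /eqP.
have b0r z : hspan gr z -> color_bracket eps gr z 0 = 0.
  move=> hz; have := bracket_linearr 1 H0 H0 hz; rewrite scaler0 addr0 scale1r.
  by move=> /eqP; rewrite -subr_eq0 opprD addrA subrr sub0r oppr_eq0 => /eqP.
suff: (hspan gr `&` [set x | Q (color_bracket eps gr x y)]) x by case.
have hy := S2H' _ yS.
apply: (span_min _ _ xS) => [|{xS}x Sx].
  split=> [|a u v [uH Qu] [vH Qv]].
    by split=> //=; rewrite b0l//; exact: subsp0.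
  split; first by case: (hspan_subsp gr) => _; apply.
  by rewrite /= bracket_linearl//; case: Qs => _; apply.
split; first exact: S1H.
have hx := S1H _ Sx; rewrite /=.
suff: (hspan gr `&` [set y | Q (color_bracket eps gr x y)]) y by case.
apply: (span_min _ _ yS) => [|{hy yS}y Sy].
  split=> [|a u v [uH Qu] [vH Qv]].
    by split=> //=; rewrite b0r//; exact: subsp0.
  split; first by case: (hspan_subsp gr) => _; apply.
  by rewrite /= bracket_linearr//; case: Qs => _; apply.
by split; [exact: S2H|exact: h].
Qed.

End Bracket.

(** * Endomorphisms and left multiplications *)

Section Lmul.
Variables (F : fieldType) (A : algType F).
Implicit Types (a b : A) (f g : endo A).

Lemma endo_addE f g x : (f + g) x = f x + g x. Proof. by []. Qed.
Lemma endo_oppE f x : (- f) x = - f x. Proof. by []. Qed.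
Lemma endo_scaleE c f x : (c *: f) x = c *: f x. Proof. by []. Qed.
Lemma endo_mulE f g x : (f * g) x = f (g x). Proof. by []. Qed.
Lemma lmulE a x : lmul a x = a * x. Proof. by []. Qed.

Lemma endoD f x y : f (x + y) = f x + f y. Proof. exact: linearD. Qed.
Lemma endo_0 f : f 0 = 0. Proof. exact: linear0. Qed.

Lemma endo_sumE (I : Type) (s : seq I) (P : pred I) (f : I -> endo A) x :
  (\sum_(i <- s | P i) f i) x = \sum_(i <- s | P i) f i x.
Proof. by elim/big_rec2: _ => // i u v _ <-. Qed.

Lemma lmulM a b : lmul (a * b) = lmul a * lmul b :> endo A.
Proof. by apply: endoP => x; rewrite /= mulrA. Qed.

Lemma lmul1 : lmul (1 : A) = 1.
Proof. by apply: endoP => x; rewrite /= mul1r. Qed.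

Lemma lmul_linear c a b : lmul (c *: a + b) = c *: lmul a + lmul b :> endo A.
Proof. by apply: endoP => x; rewrite /= mulrDl -scalerAl. Qed.

HB.instance Definition _ := GRing.isLinear.Build F A (endo A) *:%R (@lmul F A)
  lmul_linear.

Lemma lmul_inj : injective (@lmul F A).
Proof. by move=> a b /(congr1 (fun f : endo A => f 1)); rewrite /= !mulr1. Qed.

End Lmul.

(** * Bicharacters and homogeneous derivations *)

(** A type class, so that the standing hypotheses are inferred from the grading
    instead of being passed to each lemma. *)
Class setting (F : fieldType) (Gamma : zmodType) (eps : Gamma -> Gamma -> F)
    (A : algType F) (gr : Gamma -> set A) (D : set (endo A)) : Prop := Setting {
  set_char : 2%N \notin [pchar F];
  set_eps : skew_bicharacter eps;
  set_gr : graded_algebra gr;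
  set_comm : color_commutative_algebra eps gr;
  set_Der : D `<=` Der eps gr;
  set_Dgr : graded_subspace (Der_gr eps gr) D;
  set_D0 : exists2 d, D d & d <> 0;
  set_Dcomm : color_commutative_subspace eps gr D;
  set_simple : graded_D_simple gr D }.

Section Eps.
Context {F : fieldType} {Gamma : zmodType} {eps : Gamma -> Gamma -> F}.
Context {A : algType F} {gr : Gamma -> set A} {D : set (endo A)}.
Context {S : setting eps gr D}.
Implicit Types (l m n : Gamma).

Lemma two_neq0 : (2%:R : F) != 0.
Proof.
have /negP h := @set_char _ _ _ _ _ _ S.
by apply/negP => h2; apply: h; apply/andP; split.
Qed.

Lemma eps_neq0 l m : eps l m != 0.
Proof. by case: set_eps => h _ _; exact: h. Qed.

Lemma epsV l m : eps l m = (eps m l)^-1.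
Proof. by case: set_eps => _ h _; exact: h. Qed.

Lemma epsDr l m n : eps l (m + n) = eps l m * eps l n.
Proof. by case: set_eps => _ _ h; exact: h. Qed.

Lemma epsDl l m n : eps (l + m) n = eps l n * eps m n.
Proof. by rewrite epsV epsDr invfM -!epsV. Qed.

Lemma eps0r l : eps l 0 = 1.
Proof.
have := epsDr l 0 0; rewrite addr0 -[in LHS](mulr1 (eps l 0)).
by move/(mulfI (eps_neq0 l 0)).
Qed.

Lemma eps0l l : eps 0 l = 1.
Proof. by rewrite epsV eps0r invr1. Qed.

Lemma epsNr l m : eps l (- m) = (eps l m)^-1.
Proof.
have : eps l (- m) * eps l m = 1 by rewrite -epsDr addNr eps0r.
by move=> h; apply: (mulIf (eps_neq0 l m)); rewrite h mulVf ?eps_neq0.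
Qed.

Lemma epsNl l m : eps (- l) m = (eps l m)^-1.
Proof. by rewrite epsV epsNr -epsV epsV. Qed.

Lemma epsC l m : eps l m * eps m l = 1.
Proof. by rewrite (epsV m l) mulfV ?eps_neq0. Qed.

Lemma epsll l : eps l l = 1 \/ eps l l = -1.
Proof.
have : eps l l ^+ 2 == 1 by rewrite expr2 epsC.
by rewrite sqrf_eq1 => /orP[] /eqP; [left|right].
Qed.

Lemma odd_neq_even : (-1 : F) <> 1.
Proof.
move=> /eqP; rewrite -subr_eq0 -opprD oppr_eq0; apply/negP.
exact: two_neq0.
Qed.

End Eps.

Section Gradings.
Context {F : fieldType} {Gamma : zmodType} {eps : Gamma -> Gamma -> F}.
Context {A : algType F} {gr : Gamma -> set A} {D : set (endo A)}.
Context {S : setting eps gr D}.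
Implicit Types (l m n : Gamma) (a b x y : A) (f g : endo A).

Lemma grA : indep_grading gr.
Proof.
have [[gs _ gi] _] := set_gr; split=> [l|s f us fs s0].
  by apply/subspP; exact: gs.
by apply: gi => // i /fs.
Qed.

Lemma hspanA a : hspan gr a.
Proof. by have [[_ E _] _] := set_gr; rewrite /hspan -E. Qed.

Lemma hcompA_gr l a : gr l (hcomp gr l a).
Proof. by apply: hcomp_gr; [exact: grA|exact: hspanA]. Qed.

Lemma grM l m a b : gr l a -> gr m b -> gr (l + m) (a * b).
Proof. by have [_] := set_gr; exact. Qed.

Lemma grC l m a b : gr l a -> gr m b -> a * b = eps l m *: (b * a).
Proof. exact: set_comm. Qed.

Lemma gr_sub l : subsp (gr l). Proof. by case: grA. Qed.

Lemma hom_ind (P : set A) : subsp P -> (forall l a, gr l a -> P a) ->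
  forall a, P a.
Proof.
by move=> Ps h a; apply: (span_min Ps _ (hspanA a)) => x [l _]; exact: h.
Qed.

Lemma endo_ext f g : (forall l a, gr l a -> f a = g a) -> f = g.
Proof.
move=> h; apply: endoP => x; apply: (hom_ind (P := [set x | f x = g x])) => //.
by split=> [|c u v /= fu fv]; rewrite /= ?linear0// !linearP /= fu fv.
Qed.

Lemma endo_gr_sub l : subsp (endo_gr gr l).
Proof.
split=> [m a _|c f g fl gl m a ma]; first exact: subsp0 (gr_sub _).
by case: (gr_sub (l + m)) => _; apply; [apply: fl|apply: gl].
Qed.

Lemma grE : indep_grading (endo_gr gr).
Proof.
split=> [l|s f us fs s0 l ls]; first exact: endo_gr_sub.
apply: endo_ext => m a ga.
have := congr1 (fun h : endo A => h a) s0; rewrite endo_sumE => E.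
have [_ ind] := grA.
have := ind (map (+%R^~ m) s) (fun k => f (k - m) a).
rewrite (map_inj_uniq (addIr m)) us => /(_ isT).
rewrite big_map; under eq_bigr do rewrite addrK.
move=> h; have := h _ E (l + m); rewrite addrK; apply; last exact: map_f.
by move=> k /mapP[{ls}l ls ->]; rewrite addrK; exact: fs.
Qed.

Lemma endo_grM l m f g : endo_gr gr l f -> endo_gr gr m g ->
  endo_gr gr (l + m) (f * g).
Proof. by move=> fl gm n a ga; rewrite -addrA; apply: fl; apply: gm. Qed.

Lemma endo_gr1 : endo_gr gr 0 1.
Proof. by move=> m a ga; rewrite add0r. Qed.

Lemma lmul_gr l a : gr l a -> endo_gr gr l (lmul a).
Proof. by move=> ga m b gb; exact: grM. Qed.

(** The degree 0 component of 1 is a left unit for homogeneous elements, hence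
    for all elements, hence it is 1. *)
Lemma gr1 : gr 0 1.
Proof.
have h m a : gr m a -> hcomp gr 0 1 * a = a.
  move=> ga; have [s [us s0 E]] := hcompP grA (hspanA 1).
  have := congr1 (fun x => hcomp gr m (x * a)) E.
  rewrite mul1r (hcomp_id grA ga) mulr_suml hcomp_sum; [|exact: grA|by move=> *; exact: hspanA].
  have gl l : gr (l + m) (hcomp gr l 1 * a).
    by apply: (grM _ ga); exact: hcompA_gr.
  have g0 l : hcomp gr m (hcomp gr l 1 * a) = if l == 0 then hcomp gr l 1 * a else 0.
    by rewrite (hcomp_hom grA _ (gl l)) -{1}[m]add0r (inj_eq (addIr m)) eq_sym.
  under eq_bigr do rewrite g0.
  case: (boolP (0 \in s)) => [s0in|s0n].
    rewrite (bigD1_seq 0)//= eqxx big1 ?addr0// => l l0.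
    by rewrite (negbTE l0).
  move=> ->; rewrite s0// mul0r big_seq big1// => l ls.
  by case: eqP => // l0; rewrite l0 (negbTE s0n) in ls.
have -> : (1 : A) = hcomp gr 0 1; last exact: hcompA_gr.
suff H a : hcomp gr 0 1 * a = a by rewrite -[RHS]mulr1 H.
apply: (hom_ind (P := [set a | hcomp gr 0 1 * a = a])) => //.
split=> [|c x y /= hx hy]; first by rewrite /= mulr0.
by rewrite mulrDr -scalerAr hx hy.
Qed.

Lemma lmul_gr_inv l a : endo_gr gr l (lmul a) -> gr l a.
Proof. by move=> /(_ 0 1 gr1); rewrite addr0 /= mulr1. Qed.

Lemma Der_gr_sub l : subsp (Der_gr eps gr l).
Proof.
split=> [|c f g [fl fD] [gl gD]].
  split; first exact: subsp0 (endo_gr_sub l).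
  by move=> m n a b _ _; rewrite /= mul0r mulr0 scaler0 addr0.
split; first by case: (endo_gr_sub l) => _; apply.
move=> m n a b ga gb.
rewrite !endo_addE !endo_scaleE (fD _ _ _ _ ga gb) (gD _ _ _ _ ga gb).
rewrite !scalerDr mulrDl mulrDr -scalerAl -scalerAr scalerDr !scalerA.
by rewrite (mulrC c) addrACA.
Qed.

Lemma Der_gr_endo l d : Der_gr eps gr l d -> endo_gr gr l d.
Proof. by case. Qed.

Lemma der_mul l m d a b : Der_gr eps gr l d -> gr m a ->
  d (a * b) = d a * b + eps l m *: (a * d b).
Proof.
move=> [dl dD] ga.
apply: (hom_ind (P := [set b | d (a * b) = d a * b + eps l m *: (a * d b)])).
  split=> [|c x y /= hx hy]; first by rewrite /= mulr0 !linear0 !mulr0 scaler0 addr0.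
  rewrite mulrDr -scalerAr !linearP /= hx hy !mulrDr -!scalerAr.
  by rewrite !scalerDr !scalerA (mulrC c) addrACA.
by move=> n {}b gb; exact: dD gb.
Qed.

Lemma der_lmul l m d a : Der_gr eps gr l d -> gr m a ->
  d * lmul a = lmul (d a) + eps l m *: (lmul a * d).
Proof. by move=> dl ga; apply: endoP => b; rewrite /= (der_mul _ dl ga). Qed.

Lemma der1 l d : Der_gr eps gr l d -> d 1 = 0.
Proof.
move=> dl; have /eqP := der_mul 1 dl gr1.
by rewrite !mulr1 mul1r eps0r scale1r -subr_eq0 opprD addrA subrr sub0r oppr_eq0 => /eqP.
Qed.

Lemma Der_comp l d : Der eps gr d -> Der_gr eps gr l (hcomp (endo_gr gr) l d).
Proof.
move=> dD; have hS (y : endo A) : (\bigcup_(l in setT) Der_gr eps gr l) y ->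
  exists m, endo_gr gr m y by move=> [m _ [ym _]]; exists m.
have := hcomp_span grE (l := l) hS dD; apply: span_min; first exact: Der_gr_sub.
move=> y [[m _ ym] yl]; have [->|y0] := eqVneq y 0.
  exact: subsp0 (Der_gr_sub _).
by rewrite -(gr_unique grE (Der_gr_endo ym) yl y0).
Qed.

(** The zero operator has every degree, so the degree is an argument. *)
Definition hD l d := D d /\ Der_gr eps gr l d.

Lemma D_spanE : D = span [set d | exists l, hD l d].
Proof.
have [_ E _] := set_Dgr; rewrite {1}E; congr (span _).
by apply/seteqP; split=> [x [l _ [? ?]]|x [l [? ?]]]; exists l.
Qed.

Lemma hD_endo l d : hD l d -> endo_gr gr l d. Proof. by case=> _ /Der_gr_endo. Qed.

Lemma hD_comm l m d d' : hD l d -> hD m d' -> d * d' = eps l m *: (d' * d).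
Proof. by move=> [? ?] [? ?]; apply: set_Dcomm. Qed.

Lemma D_ind (P : set (endo A)) : subsp P -> (forall l d, hD l d -> P d) ->
  D `<=` P.
Proof.
by move=> Ps h; rewrite D_spanE; apply: span_min => // d [l]; exact: h.
Qed.

Lemma exists_hD : exists l d, hD l d /\ d != 0.
Proof.
apply/not_existsP => h; have [d Dd] := set_D0; apply.
apply: (D_ind (subsp_set0 _) _ Dd) => l {Dd}d hd /=.
by apply/eqP; apply: contrapT => /negP d0; apply: (h l); exists d.
Qed.

Lemma F1P u : F1 D u <-> forall l d, hD l d -> d u = 0.
Proof.
split=> [h l d [Dd _]|h d Dd]; first exact: h.
apply: (@D_ind [set d | d u = 0]) Dd => //.
split=> // c x y xu yu; change (c *: x u + y u = 0).
by rewrite xu yu scaler0 addr0.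
Qed.

Lemma notF1_der u : ~ F1 D u -> exists m d, hD m d /\ d u != 0.
Proof.
move=> Fu; apply: contrapT => h; apply: Fu; apply/F1P => m d hd.
by apply/eqP; apply: contrapT => /negP du; apply: h; exists m, d.
Qed.

Lemma F1_sub : subsp (F1 D).
Proof.
split=> [d _|c u v hu hv d Dd]; first by rewrite linear0.
by rewrite linearP /= hu// hv// scaler0 addr0.
Qed.

(** The components of u have different degrees, and so do their images under a
    homogeneous d: they cannot cancel in d u. *)
Lemma F1_hclosed : hclosed gr (F1 D).
Proof.
move=> m u /F1P hu; apply/F1P => l d hd.
have [s [us s0 E]] := hcompP grA (hspanA u).
have gd k : gr (l + k) (d (hcomp gr k u)).
  by apply: (hD_endo hd); exact: hcompA_gr.
case: (boolP (m \in s)) => ms; last by rewrite s0// linear0.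
have H : \sum_(k <- s) d (hcomp gr k u) = 0.
  by rewrite -linear_sum -E; exact: hu hd.
have [_ /(_ (map (+%R l) s) (fun k => d (hcomp gr (k - l) u)))] := grA.
rewrite (map_inj_uniq (addrI l)) us => /(_ isT).
rewrite big_map; under eq_bigr do rewrite addrAC subrr add0r.
move=> h; have := h _ H (l + m); rewrite addrAC subrr add0r; apply; last exact: map_f.
by move=> k /mapP[n _ ->]; rewrite addrAC subrr add0r.
Qed.

Lemma F11 : F1 D 1. Proof. by apply/F1P => l d [_ /der1]. Qed.

Lemma F1M u v : F1 D u -> F1 D v -> F1 D (u * v).
Proof.
move=> hu hv; apply: (@hom_sub _ _ _ gr grA (F1 D) [set u | F1 D (u * v)]) hu.
- by move=> *; exact: hspanA.
- exact: F1_hclosed.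
- apply: subsp_preim F1_sub => a x y; by rewrite mulrDl scalerAl.
move=> l {}u hu gu; apply/F1P => m d hd.
rewrite (der_mul _ (proj2 hd) gu) (proj1 (F1P _) hu _ _ hd) (proj1 (F1P _) hv _ _ hd).
by rewrite mul0r mulr0 scaler0 addr0.
Qed.

End Gradings.
Arguments hD {F Gamma} eps {A} gr D l d.

(** * Graded D-simplicity *)

Section Simple.
Context {F : fieldType} {Gamma : zmodType} {eps : Gamma -> Gamma -> F}.
Context {A : algType F} {gr : Gamma -> set A} {D : set (endo A)}.
Context {S : setting eps gr D}.
Implicit Types (l m n : Gamma) (a b x y : A) (f g : endo A).
Local Notation hD := (hD eps gr D).

(** These elements span the graded D-stable ideal generated by x. *)
Inductive orbit_hom (x : A) (l : Gamma) : Gamma -> A -> Prop :=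
| orbit_base : orbit_hom x l l x
| orbit_mul m n a y : gr m a -> orbit_hom x l n y -> orbit_hom x l (m + n) (a * y)
| orbit_der m n d y : hD m d -> orbit_hom x l n y -> orbit_hom x l (m + n) (d y).

(** The graded D-stable ideal generated by x is A, so whatever holds for x and
    survives multiplications and derivations holds everywhere. *)
Lemma simple_ind (P : set A) l x : subsp P ->
  gr l x -> x != 0 -> P x ->
  (forall m n a y, gr m a -> gr n y -> P y -> P (a * y)) ->
  (forall m n d y, hD m d -> gr n y -> P y -> P (d y)) ->
  forall y, P y.
Proof.
move=> Ps gx x0 Px Pm Pd y.
pose O := [set y | exists m, orbit_hom x l m y].
have Ogr m z : orbit_hom x l m z -> gr m z.
  elim=> {m z} [//|m n a z ga _ gz|m n d z hd _ gz]; first exact: grM.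
  exact: (hD_endo hd).
have OP m z : orbit_hom x l m z -> P z.
  elim=> {m z} [//|m n a z ga oz Pz|m n d z hd oz Pz].
    exact: (Pm _ _ _ _ ga (Ogr _ _ oz)).
  exact: (Pd _ _ _ _ hd (Ogr _ _ oz)).
have hS (z : A) : O z -> exists m, gr m z by move=> [m /Ogr]; exists m.
have Om a z : span O z -> span O (a * z).
  move=> zO; apply: (hom_ind (P := [set a | span O (a * z)])) => /=.
    apply: subsp_preim (span_subsp _) => c u v.
    by rewrite mulrDl scalerAl.
  move=> m {}a ga; apply: (span_min (U := [set z | span O (a * z)]) _ _ zO).
    apply: subsp_preim (span_subsp _) => c u v.
    by rewrite mulrDr scalerAr.
  move=> u [n ou]; by rewrite /=; apply: sub_span; exists (m + n); exact: orbit_mul.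
have Od d z : D d -> span O z -> span O (d z).
  move=> Dd zO; apply: (D_ind (P := [set d | span O (d z)])) Dd.
    exact: (subsp_preim (f := fun d : endo A => d z)) (span_subsp _).
  move=> m {}d hd; apply: (span_min (U := [set z | span O (d z)]) _ _ zO).
    by apply: subsp_preim (span_subsp _) => c u v; rewrite linearP.
  by move=> u [n ou]; rewrite /=; apply: sub_span; exists (m + n); exact: orbit_der.
have [||E|E] := set_simple (U := span O).
- split.
    apply/(graded_subspaceP grA (span_subsp _)); split; first by move=> *; exact: hspanA.
    by apply: span_hclosed; [exact: grA|exact: hS].
  move=> a z zO; split; first exact: Om.
  apply: (hom_ind (P := [set a | span O (z * a)])) => /=.
    by apply: subsp_preim (span_subsp _) => c u v; rewrite mulrDr scalerAr.
  move=> m {}a ga; apply: (span_min (U := [set z | span O (z * a)]) _ _ zO).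
    by apply: subsp_preim (span_subsp _) => c u v; rewrite mulrDl scalerAl.
  move=> u [n ou]; rewrite /= (grC (Ogr _ _ ou) ga); apply: subspZ (span_subsp _) _.
  by apply: sub_span; exists (m + n); exact: orbit_mul.
- by move=> d z Dd zO; exact: Od.
- have : span O x by apply: sub_span; exists l; exact: orbit_base.
  by rewrite E => /= x00; rewrite x00 eqxx in x0.
- have : span O y by rewrite E.
  by apply: span_min => // z [m]; exact: OP.
Qed.

(** The y such that V contains A y form a D-stable ideal, since b (d y) is
    d (b y) - (d b) y up to a scalar. *)
Lemma full_of_ideal (V : set A) l y : subsp V ->
  (forall m n d z, hD m d -> gr n z -> V z -> V (d z)) ->
  gr l y -> y != 0 -> (forall m b, gr m b -> V (b * y)) -> forall z, V z.
Proof.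
move=> Vs Vd gy y0 Vy.
pose Q := [set z | forall m b, gr m b -> V (b * z)].
have Qs : subsp Q.
  split=> [m b _|c u v Qu Qv m b gb]; first by rewrite mulr0; exact: subsp0.
  by rewrite mulrDr -scalerAr; case: Vs => _; apply; [exact: Qu gb|exact: Qv gb].
suff QT : forall z, Q z by move=> z; rewrite -[z]mul1r; exact: QT gr1.
apply: (simple_ind Qs gy y0) => //.
  move=> m n a z ga gz Qz k b gb; rewrite mulrA; apply: Qz; exact: grM gb ga.
move=> m n d z hd gz Qz k b gb.
have E : b * d z = (eps m k)^-1 *: (d (b * z) - d b * z).
  by rewrite (der_mul _ (proj2 hd) gb) addrC addKr scalerA mulVf ?scale1r ?eps_neq0.
rewrite E; apply: subspZ => //; apply: subspB => //.
  by apply: Vd (hd) _ _; [apply: grM gb gz|exact: Qz gb].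
by apply: (Qz (m + k)); exact: (hD_endo hd).
Qed.

(** A u is D-stable because D kills u, so 1 = w u for some w. The component of
    w in degree - l is still a left inverse, and color commutativity turns it
    into a two-sided one. *)
Lemma F1_inv l u : F1 D u -> gr l u -> u != 0 ->
  exists w, [/\ F1 D w, gr (- l) w, w * u = 1 & u * w = 1].
Proof.
move=> Fu gu u0.
have [w0 E0] : exists w, w * u = 1.
  pose V := [set z | exists w, w * u = z].
  apply: (@full_of_ideal V l u) => //.
  - split=> [|c x y [w <-] [w' <-]]; first by exists 0; rewrite mul0r.
    by exists (c *: w + w'); rewrite mulrDl scalerAl.
  - move=> m n d z hd gz [w wz]; rewrite -wz.
    apply: (hom_ind (P := [set w | V (d (w * u))])).
      split=> [|c x y [v Ev] [v' Ev']]; first by exists 0; rewrite /= !mul0r linear0.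
      by exists (c *: v + v'); rewrite /= !mulrDl -!scalerAl linearP /= Ev Ev'.
    move=> k {wz}w gw; exists (d w).
    by rewrite (der_mul _ (proj2 hd) gw) (proj1 (F1P _) Fu _ _ hd) mulr0 scaler0 addr0.
  - by move=> m b _; exists b.
pose w := hcomp gr (- l) w0; have gw : gr (- l) w by exact: hcompA_gr.
have wu : w * u = 1.
  have [s [us s0 E]] := hcompP grA (hspanA w0).
  have := congr1 (fun x => hcomp gr 0 (x * u)) E.
  rewrite E0 (hcomp_id grA gr1) mulr_suml hcomp_sum; [|exact: grA|by move=> *; exact: hspanA].
  have gk k : gr (k + l) (hcomp gr k w0 * u) by apply: (grM _ gu); exact: hcompA_gr.
  have g0 k : hcomp gr 0 (hcomp gr k w0 * u) = if k == - l then hcomp gr k w0 * u else 0.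
    by rewrite (hcomp_hom grA _ (gk k)) eq_sym addr_eq0.
  under eq_bigr do rewrite g0.
  case: (boolP (- l \in s)) => [sl|sl].
    rewrite (bigD1_seq (- l))//= eqxx big1 ?addr0// => k kl.
    by rewrite (negbTE kl).
  move=> ->; rewrite /w s0// mul0r big_seq big1// => k ks.
  by case: eqP => // kl; rewrite kl (negbTE sl) in ks.
have uw : u * w = 1.
  have := grC gu gw; rewrite wu => uwE.
  have : w * (u * w) = w by rewrite mulrA wu mul1r.
  rewrite uwE -scalerAr mulr1 => Ew.
  suff : eps l (- l) = 1 by move=> ->; rewrite scale1r.
  have := congr1 ( *%R^~ u) Ew; rewrite -scalerAl wu => /eqP.
  rewrite -subr_eq0 -[X in _ - X]scale1r -scalerBl scaler_eq0 oner_eq0 orbF subr_eq0.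
  by move=> /eqP.
exists w; split=> //; apply/F1P => m d hd.
have : d (w * u) = 0 by rewrite wu (der1 (proj2 hd)).
rewrite (der_mul _ (proj2 hd) gw) (proj1 (F1P _) Fu _ _ hd) mulr0 scaler0 addr0.
by move=> /(congr1 ( *%R^~ w)); rewrite mul0r -mulrA uw mulr1.
Qed.

Lemma odd_sq l x : gr l x -> eps l l = -1 -> x * x = 0.
Proof.
move=> gx el; have E : x * x = eps l l *: (x * x) by exact: grC.
move/eqP: E; rewrite el scaleN1r -addr_eq0 -mulr2n -scaler_nat.
by rewrite scaler_eq0 (negbTE two_neq0) => /eqP.
Qed.

(** Odd homogeneous elements square to 0, which a unit cannot do. *)
Lemma F1_odd l u : F1 D u -> gr l u -> eps l l = -1 -> u = 0.
Proof.
move=> Fu gu el; apply/eqP; apply: contrapT => /negP u0.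
have [w [_ _ wu _]] := F1_inv Fu gu u0.
have /eqP := odd_sq gu el; apply/negP.
by apply: contra u0 => /eqP uu; rewrite -[u]mul1r -wu -mulrA uu mulr0.
Qed.

End Simple.

(** * The algebras A[D] and F_1[D] *)

Section Words.
Context {F : fieldType} {Gamma : zmodType} {eps : Gamma -> Gamma -> F}.
Context {A : algType F} {gr : Gamma -> set A} {D : set (endo A)}.
Context {S : setting eps gr D}.
Implicit Types (l m n : Gamma) (a b x y : A) (X Y Z : endo A) (C : set A).
Local Notation hD := (hD eps gr D).
Local Notation egr := (endo_gr gr).

(** A[D] and F_1[D] are spanned by words in their homogeneous generators, so
    that homogeneous statements about them are proved letter by letter. *)
Inductive hword C : Gamma -> endo A -> Prop :=
| hword1 : hword C 0 1
| hword_mul m l a X : C a -> gr m a -> hword C l X -> hword C (m + l) (lmul a * X)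
| hword_der m l d X : hD m d -> hword C l X -> hword C (m + l) (d * X).

Definition words C : set (endo A) := [set X | exists l, hword C l X].

Lemma hword_gr C l X : hword C l X -> egr l X.
Proof.
elim=> {l X} [|m l a X _ ga _ gX|m l d X hd _ gX]; first exact: endo_gr1.
  by apply: endo_grM gX; exact: lmul_gr.
by apply: endo_grM gX; exact: hD_endo hd.
Qed.

Lemma hwordM C l m X Y : hword C l X -> hword C m Y -> hword C (l + m) (X * Y).
Proof.
move=> + hY; elim=> {l X} [|n l a X Ca ga _ hX|n l d X hd _ hX].
- by rewrite add0r mul1r.
- by rewrite -addrA -mulrA; exact: hword_mul.
- by rewrite -addrA -mulrA; exact: hword_der.
Qed.

Lemma words_hom C Y : words C Y -> exists m, egr m Y.
Proof. by move=> [m /hword_gr]; exists m. Qed.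

Lemma span_words_mul C X Y : span (words C) X -> span (words C) Y ->
  span (words C) (X * Y).
Proof.
move=> hX hY; apply: (span_min (U := [set X | span (words C) (X * Y)]) _ _ hX).
  by apply: subsp_preim (span_subsp _) => c u v; rewrite mulrDl scalerAl.
move=> {hX}X [l hX]; apply: (span_min (U := [set Y | span (words C) (X * Y)]) _ _ hY).
  by apply: subsp_preim (span_subsp _) => c u v; rewrite mulrDr scalerAr.
by move=> {hY}Y [m hY]; apply: sub_span; exists (l + m); exact: hwordM.
Qed.

Lemma gen_words C : subsp C -> hclosed gr C ->
  subalg_gen (@lmul F A @` C `|` D) = span (words C).
Proof.
move=> Cs Ch; apply/seteqP; split=> X.
  move=> /(_ (span (words C))); apply; last first.
    move=> Y [[a Ca <-]|DY].
      apply: (@hom_sub _ _ _ gr grA C [set a | span (words C) (lmul a)]) Ca => //.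
      - by move=> b _; exact: hspanA.
      - by apply: subsp_preim (span_subsp _) => c u v; rewrite linearP.
      move=> l b Cb gb; apply: sub_span; exists (l + 0); rewrite -[lmul b]mulr1.
      by apply: hword_mul => //; exact: hword1.
    apply: (D_ind (span_subsp _) _ DY) => l d hd; apply: sub_span.
    by exists (l + 0); rewrite -[d]mulr1; apply: hword_der => //; exact: hword1.
  split.
  - by apply/mem_set; apply: sub_span; exists 0; exact: hword1.
  - move=> a u v /set_mem hu /set_mem hv; apply/mem_set.
    by have [_] := span_subsp (words C); apply.
  - by move=> u v /set_mem hu /set_mem hv; apply/mem_set; exact: span_words_mul.
apply: span_min => [|Y [l hY] U Ua CU].
  split=> [U Ua _|a u v hu hv U Ua CU]; have [U1 Ul _] := Ua.
    apply/set_mem; have := Ul (-1) 1 1 U1 U1.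
    by rewrite scaleN1r addNr.
  by apply/set_mem/Ul; apply/mem_set; [exact: hu|exact: hv].
case: (Ua) => U1 _ UM; clear X; elim: hY => {l Y} [|n l a X Ca ga _ hX|n l d X hd _ hX].
- exact/set_mem.
- by apply/set_mem/UM; apply/mem_set => //; apply: CU; left; exists a.
- by apply/set_mem/UM; apply/mem_set => //; apply: CU; right; case: hd.
Qed.

(** In a homogeneous combination of words, those of another degree cancel. *)
Lemma words_ind C (P : Gamma -> set (endo A)) :
  (forall l, subsp (P l)) -> P 0 1 ->
  (forall m l a X, C a -> gr m a -> hword C l X -> P l X -> P (m + l) (lmul a * X)) ->
  (forall m l d X, hD m d -> hword C l X -> P l X -> P (m + l) (d * X)) ->
  forall l X, span (words C) X -> egr l X -> P l X.
Proof.
move=> Ps P1 Pm Pd l X hX gX.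
have : span (words C `&` egr l) X.
  by apply: span_hom hX gX; [exact: grE|exact: words_hom].
apply: span_min; first exact: Ps.
move=> Y [[m hY] gY].
have PY : P m Y.
  elim: hY => {m Y gY} [//|n m a Y Ca ga hY PY|n m d Y hd hY PY].
    exact: Pm.
  exact: Pd.
have [->|Y0] := eqVneq Y 0; first exact: subsp0.
by rewrite -(gr_unique grE (hword_gr hY) gY Y0).
Qed.

Lemma setT_sub : subsp [set: A]. Proof. by []. Qed.
Lemma setT_hclosed : hclosed gr [set: A]. Proof. by []. Qed.

Lemma ADE : AD D = span (words setT).
Proof. exact: gen_words setT_sub setT_hclosed. Qed.

Lemma F1DE : F1D D = span (words (F1 D)).
Proof. exact: gen_words F1_sub F1_hclosed. Qed.

Lemma AD_sub : subsp (AD D). Proof. by rewrite ADE; exact: span_subsp. Qed.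
Lemma AD_M X Y : AD D X -> AD D Y -> AD D (X * Y).
Proof. by rewrite ADE; exact: span_words_mul. Qed.
Lemma F1D_M X Y : F1D D X -> F1D D Y -> F1D D (X * Y).
Proof. by rewrite F1DE; exact: span_words_mul. Qed.

Lemma F1D_1 : F1D D 1.
Proof. by rewrite F1DE; apply: sub_span; exists 0; exact: hword1. Qed.

Lemma AD_lmul a : AD D (lmul a).
Proof. by move=> U _; apply; left; exists a. Qed.
Lemma F1D_lmul u : F1 D u -> F1D D (lmul u).
Proof. by move=> hu U _; apply; left; exists u. Qed.
Lemma AD_D d : D d -> AD D d.
Proof. by move=> Dd U _; apply; right. Qed.
Lemma F1D_D d : D d -> F1D D d.
Proof. by move=> Dd U _; apply; right. Qed.

Lemma F1D_AD : F1D D `<=` AD D.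
Proof.
move=> X hX U Ua CU; apply: hX => // Y [[a _ <-]|DY]; apply: CU; last by right.
by left; exists a.
Qed.

Lemma AD_hspan : AD D `<=` hspan egr.
Proof. by rewrite ADE; apply: span_hspan => Y; exact: words_hom. Qed.

Lemma AD_ind (P : Gamma -> set (endo A)) :
  (forall l, subsp (P l)) -> P 0 1 ->
  (forall m l a X, gr m a -> AD D X -> egr l X -> P l X -> P (m + l) (lmul a * X)) ->
  (forall m l d X, hD m d -> AD D X -> egr l X -> P l X -> P (m + l) (d * X)) ->
  forall l X, AD D X -> egr l X -> P l X.
Proof.
move=> Ps P1 Pm Pd l X; rewrite ADE; apply: words_ind => //.
  move=> m n a Y _ ga hY PY; apply: Pm (hword_gr hY) PY => //.
  by rewrite ADE; apply: sub_span; exists n.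
move=> m n d Y hd hY PY; apply: Pd (hword_gr hY) PY => //.
by rewrite ADE; apply: sub_span; exists n.
Qed.

Definition ccomm l X m Y := X * Y = eps l m *: (Y * X).

Lemma ccomm_sym l X m Y : ccomm l X m Y -> ccomm m Y l X.
Proof. by rewrite /ccomm => ->; rewrite scalerA epsC scale1r. Qed.

Lemma ccommM l X m Y n Z : ccomm l X m Y -> ccomm l X n Z ->
  ccomm l X (m + n) (Y * Z).
Proof.
rewrite /ccomm => h k; rewrite mulrA h -scalerAl -(mulrA Y X Z) k -scalerAr scalerA mulrA.
by rewrite -epsDr.
Qed.

Lemma ccomm_sub l X m : subsp [set Y | ccomm l X m Y].
Proof.
split=> [|c u v hu hv]; first by rewrite /= /ccomm mulr0 mul0r scaler0.
rewrite /= /ccomm mulrDr mulrDl -scalerAr -scalerAl hu hv scalerDr !scalerA.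
by rewrite (mulrC c).
Qed.

Lemma ccomm1 l X : ccomm l X 0 1.
Proof. by rewrite /ccomm mulr1 mul1r eps0r scale1r. Qed.

Lemma ccomm_lmul l m a b : gr l a -> gr m b -> ccomm l (lmul a) m (lmul b).
Proof.
by move=> ga gb; rewrite /ccomm -!lmulM (grC ga gb) linearZ.
Qed.

Lemma ccomm_F1_der l m u d : F1 D u -> gr l u -> hD m d -> ccomm m d l (lmul u).
Proof.
move=> hu gu hd; rewrite /ccomm (der_lmul (proj2 hd) gu).
by rewrite (proj1 (F1P _) hu _ _ hd) linear0 add0r.
Qed.

(** The generators color-commute pairwise, those in F_1 with those in D because
    D kills F_1, and color commutation passes to products. *)
Lemma F1D_comm l X m Y : F1D D X -> egr l X -> F1D D Y -> egr m Y -> ccomm l X m Y.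
Proof.
have key : forall n (G : endo A), (forall k u, F1 D u -> gr k u -> ccomm n G k (lmul u)) ->
    (forall k d, hD k d -> ccomm n G k d) ->
    forall k Z, F1D D Z -> egr k Z -> ccomm n G k Z.
  move=> n G hu hd k Z; rewrite F1DE.
  apply: (words_ind (P := fun k => [set Z | ccomm n G k Z])).
  - by move=> ?; exact: ccomm_sub.
  - exact: ccomm1.
  - by move=> p q a T Ca ga _ hT; apply: ccommM hT; exact: hu.
  - by move=> p q d T hd' _ hT; apply: ccommM hT; exact: hd.
move=> hX gX hY gY; apply: ccomm_sym; apply: (key) => // k Z.
  move=> hZ gZ; apply: ccomm_sym; apply: (key) => // [p u hu gu|p d hd].
    exact: ccomm_lmul.
  by apply: ccomm_sym; apply: ccomm_F1_der.
move=> hZ; apply: ccomm_sym; apply: (key) => // [p u hu gu|p d hd].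
  exact: ccomm_F1_der.
exact: hD_comm.
Qed.

(** X x = (X x)(1) is x (X 1) up to a scalar, which color commutativity of A
    absorbs. *)
Lemma central_lmul l X : egr l X ->
  (forall m x, gr m x -> ccomm l X m (lmul x)) -> X = lmul (X 1).
Proof.
move=> gX hX; apply: endo_ext => m x gx.
have := congr1 (fun f : endo A => f 1) (hX _ _ gx).
rewrite !(endo_mulE, endo_scaleE, lmulE) mulr1 => ->.
have gX1 : gr l (X 1) by rewrite -[l]addr0; apply: gX; exact: gr1.
by rewrite (grC gX1 gx).
Qed.

Local Notation br := (color_bracket eps egr).

Lemma brE l m X Y : egr l X -> egr m Y -> br X Y = X * Y - eps l m *: (Y * X).
Proof. by move=> gX gY; rewrite (bracket_hom eps grE gX gY). Qed.

Lemma br_gr l m X Y : egr l X -> egr m Y -> egr (l + m) (br X Y).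
Proof.
move=> gX gY; rewrite (brE gX gY); apply: (subspB (endo_gr_sub (l + m))).
  exact: endo_grM.
apply: (subspZ _ (endo_gr_sub (l + m))); rewrite addrC; exact: endo_grM.
Qed.

Lemma br_der l m d x : Der_gr eps gr l d -> gr m x -> br d (lmul x) = lmul (d x).
Proof.
move=> hd gx; rewrite (brE (Der_gr_endo hd) (lmul_gr gx)) (der_lmul hd gx).
by rewrite addrK.
Qed.

Lemma br_mulr l m n X Y Z : egr l X -> egr m Y -> egr n Z ->
  br X (Y * Z) = br X Y * Z + eps l m *: (Y * br X Z).
Proof.
move=> gX gY gZ; rewrite (brE gX (endo_grM gY gZ)) (brE gX gY) (brE gX gZ).
rewrite mulrBl mulrBr scalerBr -!scalerAl -!scalerAr scalerA -epsDr !mulrA.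
by rewrite addrA subrK.
Qed.

Lemma br_mull l m n X Y Z : egr l X -> egr m Y -> egr n Z ->
  br (X * Y) Z = X * br Y Z + eps m n *: (br X Z * Y).
Proof.
move=> gX gY gZ; rewrite (brE (endo_grM gX gY) gZ) (brE gX gZ) (brE gY gZ).
rewrite mulrBl mulrBr scalerBr -!scalerAl -!scalerAr scalerA !mulrA.
rewrite (mulrC (eps m n)) -epsDl.
by rewrite addrA subrK.
Qed.

Lemma br_anti l m X Y : egr l X -> egr m Y -> br X Y = - (eps l m *: br Y X).
Proof.
move=> gX gY; rewrite (brE gX gY) (brE gY gX) scalerBr scalerA epsC scale1r.
by rewrite opprB.
Qed.

Lemma egr_hspan l X : egr l X -> hspan egr X.
Proof. exact: gr_hspan. Qed.

Lemma br_linearl (a : F) X Y Z : hspan egr X -> hspan egr Y -> hspan egr Z ->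
  br (a *: X + Y) Z = a *: br X Z + br Y Z.
Proof. by apply: bracket_linearl; exact: grE. Qed.

Lemma br_linearr (a : F) X Y Z : hspan egr X -> hspan egr Y -> hspan egr Z ->
  br Z (a *: X + Y) = a *: br Z X + br Z Y.
Proof. by apply: bracket_linearr; exact: grE. Qed.

Lemma br_Dl X Y Z : hspan egr X -> hspan egr Y -> hspan egr Z ->
  br (X + Y) Z = br X Z + br Y Z.
Proof. by move=> hX hY hZ; rewrite -[X]scale1r br_linearl// !scale1r. Qed.

Lemma br_Dr X Y Z : hspan egr X -> hspan egr Y -> hspan egr Z ->
  br Z (X + Y) = br Z X + br Z Y.
Proof. by move=> hX hY hZ; rewrite -[X]scale1r br_linearr// !scale1r. Qed.

Lemma br_0l Z : hspan egr Z -> br 0 Z = 0.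
Proof.
move=> hZ; have h0 : hspan egr 0 by exact: subsp0 (hspan_subsp _).
by apply: (addrI (br 0 Z)); rewrite -br_Dl// !addr0.
Qed.

Lemma br_0r Z : hspan egr Z -> br Z 0 = 0.
Proof.
move=> hZ; have h0 : hspan egr 0 by exact: subsp0 (hspan_subsp _).
by apply: (addrI (br Z 0)); rewrite -br_Dr// !addr0.
Qed.

Lemma br_Zl (c : F) X Z : hspan egr X -> hspan egr Z -> br (c *: X) Z = c *: br X Z.
Proof.
move=> hX hZ; have h0 : hspan egr 0 by exact: subsp0 (hspan_subsp _).
by rewrite -[c *: X]addr0 br_linearl// br_0l// addr0.
Qed.

(** By the Leibniz rules, [X, -] is a color derivation of the product, hence of
    the bracket. *)
Lemma br_jacobi l m n X Y Z : egr l X -> egr m Y -> egr n Z ->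
  br X (br Y Z) = br (br X Y) Z + eps l m *: br Y (br X Z).
Proof.
move=> gX gY gZ.
have gYZ := endo_grM gY gZ; have gZY := endo_grM gZ gY.
have gXY := br_gr gX gY; have gXZ := br_gr gX gZ.
rewrite (brE gY gZ) -scaleNr addrC.
rewrite (br_linearr _ (egr_hspan gZY) (egr_hspan gYZ) (egr_hspan gX)).
rewrite (br_mulr gX gZ gY) (br_mulr gX gY gZ) (brE gXY gZ) (brE gY gXZ).
rewrite scalerDr scalerBr !scalerA mulNr scaleNr -scaleNr.
rewrite !epsDl !epsDr.
have -> : eps l m * (eps m l * eps m n) = eps m n by rewrite mulrA epsC mul1r.
rewrite (mulrC (eps m n)) !scaleNr.
set p := _ *: (_ * Y); set q := _ *: (Z * _); set r := _ *: (Y * _).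
by rewrite (addrC (- p)) [LHS]addrC addrACA.
Qed.

End Words.
Arguments ccomm {F Gamma} eps {A} l X m Y.
Arguments hword {F Gamma} eps {A} gr D C _ _.
Arguments words {F Gamma} eps {A} gr D C _.

(** * Density of independent derivations *)

Section Density.
Context {F : fieldType} {Gamma : zmodType} {eps : Gamma -> Gamma -> F}.
Context {A : algType F} {gr : Gamma -> set A} {D : set (endo A)}.
Context {S : setting eps gr D}.
Implicit Types (l m n : Gamma) (a b x y : A) (X Y Z : endo A) (C : set A).
Local Notation hD := (hD eps gr D).
Local Notation ccomm := (ccomm eps).

Variables (I : eqType) (d : I -> endo A) (dg : I -> Gamma).

(** A coefficient of degree k - dg i in front of d i makes the relation
    homogeneous of degree k. *)
Definition hom_indep (s : seq I) : Prop := forall (u : I -> A) (k : Gamma),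
  (forall i, F1 D (u i) /\ gr (k - dg i) (u i)) ->
  \sum_(i <- s) lmul (u i) * d i = 0 -> forall i, i \in s -> u i = 0.

(** The degree k part of the right A-submodule of A^I generated by the vectors
    (d_j x)_j. With coefficients on the right, no scalar depending on j enters. *)
Definition jacobian (k : Gamma) (v : I -> A) : Prop :=
  exists q : seq (Gamma * A * A),
    (forall t, t \in q -> gr t.1.1 t.1.2 /\ gr (k - t.1.1) t.2) /\
    forall j, v j = \sum_(t <- q) d j t.1.2 * t.2.

Hypothesis dD : forall i, Der_gr eps gr (dg i) (d i).
Hypothesis dcomm : forall i m e, hD m e -> ccomm m e (dg i) (d i).

Lemma jacobian_gr k v j : jacobian k v -> gr (dg j + k) (v j).
Proof.
move=> [q [gq ->]]; apply: subsp_sum_seq (gr_sub _) _ => t tq.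
have [g1 g2] := gq _ tq.
have -> : dg j + k = dg j + t.1.1 + (k - t.1.1) by rewrite addrC -!addrA subrKC addrC.
by apply: (grM _ g2); exact: (Der_gr_endo (dD j)).
Qed.

Lemma jacobianD k v w : jacobian k v -> jacobian k w ->
  jacobian k (fun j => v j + w j).
Proof.
move=> [q [gq vE]] [r [gR wE]]; exists (q ++ r); split=> [t|j].
  by rewrite mem_cat => /orP[/gq|/gR].
by rewrite big_cat/= -vE -wE.
Qed.

Lemma jacobian_sum k (T : eqType) (r : seq T) (w : T -> I -> A) :
  (forall t, t \in r -> jacobian k (w t)) ->
  jacobian k (fun j => \sum_(t <- r) w t j).
Proof.
elim: r => [|t r IH] h.
  by exists [::]; split=> // j; rewrite !big_nil.
under eq_fun do rewrite big_cons.
apply: jacobianD; first by apply: h; rewrite inE eqxx.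
by apply: IH => t' tr; apply: h; rewrite inE tr orbT.
Qed.

Lemma jacobianM k n v b : jacobian k v -> gr n b ->
  jacobian (k + n) (fun j => v j * b).
Proof.
move=> [q [gq vE]] gb; exists [seq (t.1.1, t.1.2, t.2 * b) | t <- q]; split.
  move=> _ /mapP[t /gq[g1 g2] ->] /=; split=> //.
  by rewrite addrAC; exact: grM.
by move=> j; rewrite vE mulr_suml big_map/=; apply: eq_bigr => t _; rewrite mulrA.
Qed.

Lemma jacobian_hom m x : gr m x -> jacobian m (fun j => d j x).
Proof.
move=> gx; exists [:: (m, x, 1)]; split=> [t|j]; last by rewrite big_seq1 mulr1.
by rewrite inE => /eqP -> /=; rewrite subrr; split=> //; exact: gr1.
Qed.

(** Moving e past d_j costs a scalar that depends on j, so D-stability holds for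
    this twisted action. *)
Lemma jacobian_der m e k v : hD m e -> jacobian k v ->
  jacobian (m + k) (fun j => (eps m (dg j))^-1 *: e (v j)).
Proof.
move=> he [q [gq vE]].
exists ([seq (m + t.1.1, e t.1.2, t.2) | t <- q] ++
        [seq (t.1.1, t.1.2, eps m t.1.1 *: e t.2) | t <- q]); split.
  move=> t; rewrite mem_cat => /orP[] /mapP[{}t /gq[g1 g2] ->] /=; split=> //.
  - exact: (hD_endo he).
  - by rewrite opprD addrACA subrr add0r.
  - by rewrite -addrA; apply: subspZ (gr_sub _) _; exact: (hD_endo he).
move=> j; rewrite vE big_cat/= !big_map -big_split/= linear_sum scaler_sumr.
rewrite big_seq [RHS]big_seq; apply: eq_bigr => t /gq[g1 g2] /=.
rewrite (der_mul _ (proj2 he) (Der_gr_endo (dD j) g1)) scalerDr.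
have -> : e (d j t.1.2) = eps m (dg j) *: d j (e t.1.2).
  exact: (congr1 (fun f : endo A => f t.1.2) (dcomm j he)).
rewrite -scalerAl scalerA mulVf ?eps_neq0// scale1r scalerA epsDr mulrA.
by rewrite mulVf ?eps_neq0// mul1r scalerAr.
Qed.

(** By induction on s: the j0-th entries of the vectors that vanish on the rest
    of s form a D-stable ideal. If it were zero, the vectors (d_j x)_j would be
    determined by their entries on the rest of s; this would express d_j0
    as a combination of the other d_i with coefficients killed by D. *)
Lemma density (s : seq I) : uniq s -> hom_indep s -> forall i, i \in s ->
  exists2 v, jacobian (- dg i) v & forall j, j \in s -> v j = (j == i)%:R.
Proof.
elim: s => // j0 s IH /= /andP[j0s us] hs.
have hs' : hom_indep s.
  move=> u k hu E i si.
  have := hs (fun i => if i \in s then u i else 0) k.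
  have H j : F1 D (if j \in s then u j else 0) /\ gr (k - dg j) (if j \in s then u j else 0).
    by case: ifP => _; [exact: hu|split; [exact: subsp0 F1_sub|exact: subsp0 (gr_sub _)]].
  move=> /(_ H); rewrite big_cons (negbTE j0s) linear0 mul0r add0r.
  rewrite big_seq; under eq_bigr => j -> do []; rewrite -big_seq.
  by move=> /(_ E) /(_ i); rewrite inE si orbT => /(_ isT).
have {IH} IH' i : exists v, i \in s ->
    jacobian (- dg i) v /\ forall j, j \in s -> v j = (j == i)%:R.
  case: (boolP (i \in s)) => si; last by exists (fun=> 0).
  by have [v v1 v2] := IH us hs' i si; exists v.
have [e eP] := choice IH'.
suff [v0 vJ [v01 v0s]] : exists2 v, jacobian (- dg j0) v &
    v j0 = 1 /\ forall j, j \in s -> v j = 0.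
  move=> i; rewrite inE => /orP[/eqP ->|si].
    exists v0 => // j; rewrite inE => /orP[/eqP ->|js]; first by rewrite eqxx.
    by rewrite v0s//; case: eqP => // jj0; rewrite jj0 (negbTE j0s) in js.
  have [eJ es] := eP i si.
  exists (fun j => e i j + v0 j * (- e i j0)).
    apply: jacobianD => //.
    have -> : - dg i = - dg j0 + (dg j0 - dg i) by rewrite addKr.
    apply: jacobianM => //; apply: subspN (gr_sub _) _.
    exact: jacobian_gr eJ.
  move=> j; rewrite inE => /orP[/eqP ->|js].
    rewrite v01 mul1r subrr; case: eqP => // ij; by rewrite ij si in j0s.
  by rewrite v0s// mul0r addr0 es.
pose K := [set z | exists k v, [/\ jacobian k v, v j0 = z & forall j, j \in s -> v j = 0]].
have Kgr z : K z -> exists m, gr m z.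
  by move=> [k [v [vJ <- _]]]; exists (dg j0 + k); exact: jacobian_gr.
have [[z Kz z0]|K0] := pselect (exists2 z, K z & z != 0).
  have K1 : span K 1.
    have [m gz] := Kgr z Kz.
    apply: (simple_ind (span_subsp K) gz z0 (sub_span Kz)).
      move=> p q a y ga gy Ky.
      apply: (span_min (U := [set y | span K (a * y)]) _ _ Ky).
        by apply: subsp_preim (span_subsp _) => c u v; rewrite mulrDr scalerAr.
      move=> {gy Ky}y [k [v [vJ vj vs]]]; rewrite /= -vj.
      rewrite (grC ga (jacobian_gr j0 vJ)); apply: subspZ (span_subsp _) _.
      apply: sub_span; exists (k + p), (fun j => v j * a); split=> //.
        exact: jacobianM.
      by move=> j js; rewrite vs// mul0r.
    move=> p q f y hf gy Ky.
    apply: (span_min (U := [set y | span K (f y)]) _ _ Ky).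
      by apply: subsp_preim (span_subsp _) => c u v; rewrite linearP.
    move=> {gy Ky}y [k [v [vJ vj vs]]]; rewrite /= -vj.
    apply: (subspZ_eq (a := (eps p (dg j0))^-1) (span_subsp _)).
      by rewrite invr_eq0 eps_neq0.
    apply: sub_span; exists (p + k), (fun j => (eps p (dg j))^-1 *: f (v j)); split=> //.
      exact: jacobian_der.
    by move=> j js; rewrite vs// linear0 scaler0.
  have {K1} : span (K `&` gr 0) 1 by apply: span_hom K1 gr1 => //; exact: grA.
  pose K' := [set z | exists v, [/\ jacobian (- dg j0) v, v j0 = z &
                                  forall j, j \in s -> v j = 0]].
  have K's : subsp K'.
    split=> [|c x y [v [vJ vj vs]] [w [wJ wj ws]]].
      exists (fun j => 0); split=> //; exists [::]; split=> // j.
      by rewrite big_nil.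
    have g1 : gr 0 (c%:A : A) by apply: subspZ (gr_sub _) _; exact: gr1.
    exists (fun j => v j * c%:A + w j); split.
    - by apply: jacobianD wJ; rewrite -[- dg j0]addr0; exact: jacobianM.
    - by rewrite vj wj -scalerAr mulr1.
    - by move=> j js; rewrite vs// ws// mul0r addr0.
  suff KK' : K `&` gr 0 `<=` K'.
    by move=> /(span_min K's KK')[v [vJ vj vs]]; exists v.
  move=> y [[k [v [vJ vj vs]]] gy]; have [->|y0] := eqVneq y 0.
    exact: subsp0.
  have : dg j0 + k = 0.
    by apply: (gr_unique grA (x := y)) => //; rewrite -vj; exact: jacobian_gr.
  by move=> /eqP; rewrite addrC addr_eq0 => /eqP kE; exists v; rewrite -kE.
have {}K0 k v : jacobian k v -> (forall j, j \in s -> v j = 0) -> v j0 = 0.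
  move=> vJ vs; apply/eqP; apply: contrapT => /negP v0; apply: K0.
  by exists (v j0) => //; exists k, v.
exfalso.
pose c i := e i j0.
have cF i : i \in s -> F1 D (c i).
  move=> si; have [eJ es] := eP i si; apply/F1P => m f hf.
  have := K0 _ _ (jacobian_der hf eJ) => /(_ _).
  have h j : j \in s -> (eps m (dg j))^-1 *: f (e i j) = 0.
    move=> js; rewrite es//; case: eqP => _; last by rewrite linear0 scaler0.
    by rewrite (der1 (proj2 hf)) scaler0.
  by move=> /(_ h) /eqP; rewrite scaler_eq0 invr_eq0 (negbTE (eps_neq0 _ _)) => /eqP.
have cg i : i \in s -> gr (dg j0 - dg i) (c i).
  by move=> si; have [eJ _] := eP i si; exact: jacobian_gr eJ.
pose u i := if i == j0 then 1 else if i \in s then - c i else 0.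
have := hs u (dg j0).
have uP i : F1 D (u i) /\ gr (dg j0 - dg i) (u i).
  rewrite /u; case: eqP => [->|_]; first by rewrite subrr; split; [exact: F11|exact: gr1].
  case: ifP => si; last by split; [exact: subsp0 F1_sub|exact: subsp0 (gr_sub _)].
  by split; [exact: subspN F1_sub (cF _ si)|exact: subspN (gr_sub _) (cg _ si)].
move=> /(_ uP); have E : \sum_(i <- j0 :: s) lmul (u i) * d i = 0.
  apply: endo_ext => m x gx.
  have J1 : jacobian m (fun j => d j x + \sum_(i <- s) e i j * (- d i x)).
    apply: (jacobianD (jacobian_hom gx)).
    apply: jacobian_sum => i si; have [eJ _] := eP i si.
    have -> : m = - dg i + (dg i + m) by rewrite addKr.
    apply: (jacobianM eJ); apply: subspN (gr_sub _) _.
    exact: (Der_gr_endo (dD i)).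
  have J0 : d j0 x = \sum_(i <- s) c i * d i x.
    have := K0 _ _ J1 => /(_ _) /eqP; rewrite addr_eq0 => h.
    rewrite (eqP (h _)).
      by rewrite -sumrN; apply: eq_bigr => i _; rewrite mulrN opprK.
    move=> j js; rewrite (bigD1_seq j)//= [X in _ + (_ + X)]big_seq_cond big1.
      by have [_ es] := eP j js; rewrite es// eqxx mul1r addr0 subrr.
    by move=> i /andP[si ij]; have [_ es] := eP i si; rewrite es// eq_sym (negbTE ij) mul0r.
  rewrite endo_sumE big_cons/= {1}/u eqxx mul1r J0.
  rewrite -big_split/= big_seq big1// => i si; rewrite /u si.
  case: eqP => [ij|_]; first by rewrite -ij si in j0s.
  by rewrite mulNr subrr.
move=> /(_ E j0); rewrite inE eqxx /u eqxx => /(_ isT) /eqP.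
by rewrite oner_eq0.
Qed.

(** Right multiplication by the coefficients of a dual vector isolates b i. *)
Lemma indep_over_A (s : seq I) (b : I -> A) : uniq s -> hom_indep s ->
  (forall m x, gr m x -> \sum_(j <- s) b j * d j x = 0) ->
  forall i, i \in s -> b i = 0.
Proof.
move=> us hs b0 i si; have [v [q [gq vE]] vs] := density us hs si.
have : \sum_(j <- s) b j * v j = 0.
  under eq_bigr do rewrite vE mulr_sumr; rewrite exchange_big/= big_seq big1// => t tq.
  under eq_bigr do rewrite mulrA; rewrite -mulr_suml (b0 t.1.1) ?mul0r//.
  by have [] := gq _ tq.
rewrite (bigD1_seq i)//= big_seq_cond big1 ?addr0.
  by rewrite vs// eqxx mulr1.
by move=> j /andP[js /negbTE ji]; rewrite vs// ji mulr0.
Qed.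

(** Left multiplication by the coefficients of a dual vector isolates Y i. The
    scalars eps (dg j) m compensate for the change of side, because x and its
    coefficient have the constant total degree - dg i. *)
Lemma separate (s : seq I) (P : set (endo A)) (Y : I -> endo A) :
  uniq s -> hom_indep s -> subsp P ->
  (forall m a X, gr m a -> P X -> P (lmul a * X)) ->
  (forall m x, gr m x ->
     P (\sum_(j <- s) (eps (dg j) m)^-1 *: (lmul (d j x) * Y j))) ->
  forall i, i \in s -> P (Y i).
Proof.
move=> us hs Ps Pl PY i si; have [v [q [gq vE]] vs] := density us hs si.
suff : P (\sum_(j <- s) (eps (dg j) (- dg i))^-1 *: (lmul (v j) * Y j)).
  rewrite (bigD1_seq i)//= big_seq_cond big1 ?addr0.
    rewrite vs// eqxx lmul1 mul1r; apply: subspZ_eq => //.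
    by rewrite invr_eq0 eps_neq0.
  by move=> j /andP[js /negbTE ji]; rewrite vs// ji linear0 mul0r scaler0.
under eq_bigr do rewrite vE linear_sum mulr_suml scaler_sumr.
rewrite exchange_big/=; apply: subsp_sum_seq => // t tq.
have [g1 g2] := gq _ tq; pose n := - dg i - t.1.1.
have nE : - dg i = t.1.1 + n by rewrite /n subrKC.
have {}g2 : gr n t.2 by [].
clearbody n.
have := Pl _ _ _ g2 (PY _ _ g1); rewrite mulr_sumr.
move=> /(subspZ (eps n t.1.1)^-1 Ps); rewrite scaler_sumr.
congr P; apply: eq_bigr => j _.
rewrite -scalerAr mulrA -lmulM (grC g2 (Der_gr_endo (dD j) g1)) [lmul (_ *: _)]linearZ/=.
rewrite -scalerAl !scalerA; congr (_ *: _).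
rewrite nE !epsDr (epsV n (dg j)).
have h1 : eps n t.1.1 != 0 by exact: eps_neq0.
have h2 : eps (dg j) n != 0 by exact: eps_neq0.
have h3 : eps (dg j) t.1.1 != 0 by exact: eps_neq0.
by field; rewrite h1 h2 h3.
Qed.

End Density.

(** * The exceptional case *)

Section Exceptional.
Context {F : fieldType} {Gamma : zmodType} {eps : Gamma -> Gamma -> F}.
Context {A : algType F} {gr : Gamma -> set A} {D : set (endo A)}.
Context {S : setting eps gr D}.
Implicit Types (l m n : Gamma) (a b x y : A) (X Y Z : endo A) (C : set A).
Local Notation hD := (hD eps gr D).
Local Notation egr := (endo_gr gr).
Local Notation br := (color_bracket eps egr).

Let F1s := @F1_sub F A D.
Let gA := grA (S := S).

Lemma Der_lmul k m w d : gr k w -> Der_gr eps gr m d ->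
  Der_gr eps gr (k + m) (lmul w * d).
Proof.
move=> gw hd; split; first exact: endo_grM (lmul_gr gw) (Der_gr_endo hd).
move=> p q a b ga gb; rewrite !endo_mulE !lmulE (der_mul _ hd ga) mulrDr -scalerAr.
rewrite !mulrA (grC gw ga) -!scalerAl scalerA epsDl (mulrC (eps k p)).
by [].
Qed.

Lemma der_F1 l d u : hD l d -> F1 D u -> d u = 0.
Proof. by move=> hd hu; exact: (proj1 (F1P _) hu _ _ hd). Qed.

Lemma hcompA_mulr m k b x : gr m x -> hcomp gr (k + m) (b * x) = hcomp gr k b * x.
Proof.
move=> gx; apply: (hom_ind (P := [set b | hcomp gr (k + m) (b * x) = hcomp gr k b * x])).
  split=> [|c u v /= hu hv]; first by rewrite /= mul0r !hcomp0 ?mul0r//; exact: gA.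
  rewrite mulrDl -scalerAl !(hcomp_linear gA) ?hu ?hv; try exact: hspanA.
  by rewrite mulrDl scalerAl.
move=> l {}b gb /=; rewrite (hcomp_hom gA _ (grM gb gx)) (hcomp_hom gA _ gb).
by rewrite (inj_eq (addIr m)); case: ifP => // _; rewrite mul0r.
Qed.

Lemma endo_neq0P X : X <> 0 -> exists m x, gr m x /\ X x != 0.
Proof.
move=> X0; apply: contrapT => h; apply: X0; apply: endo_ext => m x gx.
by apply/eqP; apply: contrapT => /negP Xx; apply: h; exists m, x.
Qed.

(** Let e x be a nonzero homogeneous element u of F_1. It is a unit, and
    e (x y) = u y + eps x (e y) puts y in F_1 + F_1 x. If x were even, then
    e (x x) = 2 u x would put x itself in F_1, so that A = F_1 and D = 0. Hence
    x is odd and x x = 0. Some d0 in D sends x to a unit of F_1, as otherwise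
    the annihilator of x, which contains x, would be a D-stable ideal; and
    commutation with d0 makes every other homogeneous element of D an
    F_1-multiple of it. *)
Lemma exceptional_of_F1_derivation n e : Der_gr eps gr n e -> e <> 0 ->
  (forall a, F1 D (e a)) -> exceptional_case eps gr D.
Proof.
move=> he /endo_neq0P[mu [x [gx ex0]]] eF.
have geu : gr (n + mu) (e x) by exact: (Der_gr_endo he).
have [w [Fw gw we ew]] := F1_inv (eF x) geu ex0.
have dec k y : gr k y -> exists a b,
    [/\ F1 D a, F1 D b, gr k a, gr (k - mu) b & y = a + b * x].
  move=> gy; pose c := eps n mu * eps mu (n + k).
  (* e (x y) = u y + eps x (e y), multiplied by the inverse w of u = e x *)
  exists (w * e (x * y)), (w * e y * (- c)%:A); split.
  - exact: F1M.
  - by rewrite -scalerAr mulr1; apply: subspZ F1s _; exact: F1M.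
  - rewrite [k](_ : _ = - (n + mu) + (n + (mu + k))); last by rewrite (addrA n) addKr.
    by apply: grM gw _; apply: (Der_gr_endo he); exact: grM.
  - rewrite -scalerAr mulr1; apply: subspZ (gr_sub _) _.
    rewrite [k - mu](_ : _ = - (n + mu) + (n + k)).
      by apply: grM gw _; exact: (Der_gr_endo he).
    by rewrite opprD addrACA addNr add0r addrC.
  - rewrite (der_mul _ he gx) mulrDr mulrA we mul1r.
    rewrite (grC gx (Der_gr_endo he gy)) scalerA -/c -!scalerAr -!scalerAl mulr1.
    by rewrite -!mulrA addrC !scaleNr mulrA addrC -addrA subrr addr0.
have decT y : exists a b, [/\ F1 D a, F1 D b & y = a + b * x].
  apply: (hom_ind (P := [set y | exists a b, [/\ F1 D a, F1 D b & y = a + b * x]])).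
    split=> [|c y1 y2 [a [b [ha hb ->]]] [a' [b' [ha' hb' ->]]]].
      exists 0, 0; split; [exact: subsp0 F1s|exact: subsp0 F1s|].
      by rewrite mul0r addr0.
    exists (c *: a + a'), (c *: b + b'); split.
    - by case: F1s => _; apply.
    - by case: F1s => _; apply.
    - by rewrite scalerDr mulrDl scalerAl addrACA.
  by move=> k {}y gy; have [a [b [? ? _ _ ?]]] := dec _ _ gy; exists a, b.
have x0 : x != 0 by apply: contra ex0 => /eqP ->; rewrite linear0.
have xodd : eps mu mu = -1.
  case: (@epsll _ _ _ _ _ _ S mu) => // mu1; exfalso.
  have Fx : F1 D x.
    have : F1 D (e (x * x)) by exact: eF.
    rewrite (der_mul _ he gx) (grC gx geu) scalerA epsDr mu1 mulr1 epsC scale1r.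
    rewrite -mulr2n -scaler_nat => /(subspZ_eq F1s two_neq0) /(F1M Fw).
    by rewrite mulrA we mul1r.
  have [m [d [hd /eqP]]] := exists_hD; apply; apply: endo_ext => k y gy.
  have [a [b [ha hb ->]]] := decT y.
  by apply: (der_F1 hd); apply: subspD F1s _ _ => //; exact: F1M.
have xx : x * x = 0 by exact: odd_sq gx xodd.
have [m [d0 [v [hd0 Fv gv v0 dx]]]] : exists m d0 v,
    [/\ hD m d0, F1 D v, gr (m + mu) v, v != 0 & d0 x = v].
  apply: contrapT => h.
  have d_x k d : hD k d -> exists b, [/\ F1 D b, gr k b & d x = b * x].
    move=> hd; have [a [b [ha hb ga gb E]]] := dec _ _ (hD_endo hd gx).
    rewrite addrK in gb; exists b; split=> //.
    have [a0|a0] := eqVneq a 0; first by rewrite E a0 add0r.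
    exfalso; apply: h; exists k, d, a; split=> //.
    have [k1|k1] := @epsll _ _ _ _ _ _ S k.
      have : a = 0.
        apply: F1_odd ha ga _; rewrite epsDr !epsDl k1 xodd.
        by rewrite mul1r mulrN1 mulrN epsC.
      by move=> a00; rewrite a00 eqxx in a0.
    by rewrite E (F1_odd hb gb k1) mul0r addr0.
  have : 1 * x = 0.
    apply: (simple_ind (P := [set y | y * x = 0]) _ gx x0) => //.
    - by apply: (subsp_preim (U := [set 0]) _ (subsp_set0 _)) => c u v; rewrite mulrDl scalerAl.
    - by move=> p q a y _ _ /= yx; rewrite -mulrA yx mulr0.
    - move=> p q d y hd gy /= yx; have [b [hb gb E]] := d_x _ _ hd.
      have : d (y * x) = 0 by rewrite yx linear0.
      rewrite (der_mul _ (proj2 hd) gy) E mulrA (grC gy gb) -scalerAl -mulrA yx.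
      by rewrite mulr0 !scaler0 addr0.
  by move=> /eqP; rewrite mul1r (negbTE x0).
have [v' [Fv' gv' v'v vv']] := F1_inv Fv gv v0.
(* normalized so that it maps x to 1 *)
pose ddt := lmul v' * d0; pose dl := - (m + mu) + m.
have dlE : dl = - mu by rewrite /dl opprD addrAC addNr add0r.
have hdt : Der_gr eps gr dl ddt by exact: Der_lmul gv' (proj2 hd0).
have ddtF u : F1 D u -> ddt u = 0 by move=> hu; rewrite /ddt endo_mulE (der_F1 hd0 hu) linear0.
have ddtx : ddt x = 1 by rewrite /ddt endo_mulE dx.
have ddt_mul k b : F1 D b -> gr k b -> ddt (b * x) = eps dl k *: b.
  by move=> hb gb; rewrite (der_mul _ hdt gb) ddtF// mul0r add0r ddtx mulr1.
have uniq0 p q : F1 D p -> F1 D q -> p + q * x = 0 -> q = 0.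
  move=> hp hq pq; have [s [us _ ->]] := hcompP gA (hspanA q).
  rewrite big1// => k _.
  have Fqk : F1 D (hcomp gr k q) by exact: F1_hclosed.
  have gqk : gr k (hcomp gr k q) by exact: hcompA_gr.
  have := congr1 (hcomp gr (k + mu)) pq; rewrite (hcompD gA) ?hcomp0; try exact: hspanA; last exact: gA.
  rewrite (hcompA_mulr _ _ gx) => /(congr1 ddt).
  rewrite endo_0 endoD ddtF ?add0r; last exact: F1_hclosed.
  rewrite (ddt_mul _ _ Fqk gqk) => /eqP.
  by rewrite scaler_eq0 (negbTE (eps_neq0 _ _)) => /eqP.
have D_ddt k d : hD k d -> exists2 u, F1 D u & d = lmul u * ddt.
  move=> hd; have [a [b [ha hb ga gb E]]] := dec _ _ (hD_endo hd gx).
  rewrite addrK in gb.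
  have b0 : b = 0.
    have : d0 (d x) = eps m k *: d (d0 x).
      by have cd : d0 * d = eps m k *: (d * d0); [exact: hD_comm|exact: (congr1 (fun f : endo A => f x) cd)].
    rewrite dx (der_F1 hd Fv) scaler0 E endoD.
    rewrite (der_F1 hd0 ha) add0r (der_mul _ (proj2 hd0) gb) (der_F1 hd0 hb) mul0r add0r dx.
    move=> /eqP; rewrite scaler_eq0 (negbTE (eps_neq0 _ _)) => /eqP.
    by move=> /(congr1 ( *%R^~ v')); rewrite mul0r -mulrA vv' mulr1.
  rewrite b0 mul0r addr0 in E; exists a => //; apply: endo_ext => q y gy.
  have [a1 [b1 [ha1 hb1 ga1 gb1 ->]]] := dec _ _ gy.
  rewrite endo_mulE lmulE !endoD (der_F1 hd ha1) (ddtF _ ha1) !add0r.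
  rewrite (ddt_mul _ _ hb1 gb1) (der_mul _ (proj2 hd) gb1) (der_F1 hd hb1) mul0r add0r E.
  rewrite -scalerAr (grC ga gb1) scalerA dlE epsDl epsNl mulrCA mulVf ?eps_neq0//.
  by rewrite mulr1.
exists x, ddt, mu, dl; split.
- split=> // y; have [a [b [ha hb ->]]] := decT y.
  exists (a, b); split=> //= -[a' b'] [/= ha' hb' /eqP].
  rewrite -subr_eq0 opprD addrACA -mulrBl => /eqP E.
  have /eqP := uniq0 _ _ (subspB F1s ha ha') (subspB F1s hb hb') E.
  rewrite subr_eq0 => /eqP bb'; move: E; rewrite bb' subrr mul0r addr0 => /eqP.
  by rewrite subr_eq0 => /eqP ->.
- by split.
- apply/seteqP; split=> z; last first.
    move=> [u hu ->]; apply: sub_span; exists (u * v'); first exact: F1M.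
    by exists d0; [case: hd0|rewrite /ddt mulrA -lmulM].
  have Us : subsp [set z | exists2 u, F1 D u & z = lmul u * ddt].
    split=> [|c z1 z2 [u hu ->] [u' hu' ->]].
      by exists 0; [exact: subsp0 F1s|rewrite linear0 mul0r].
    exists (c *: u + u'); first by case: F1s => _; apply.
    by rewrite linearP/= mulrDl scalerAl.
  apply: span_min => // {}z [u hu [d Dd ->]].
  apply: (D_ind (P := [set d | exists2 u', F1 D u' & lmul u * d = lmul u' * ddt]) _ _ Dd).
    by apply: (subsp_preim (f := fun d => lmul u * d) _ Us) => c a b; rewrite mulrDr scalerAr.
  move=> k {Dd}d hd; have [u' hu' ->] := D_ddt _ _ hd.
  by exists (u * u'); [exact: F1M|rewrite mulrA -lmulM].
- split; first exact: xodd.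
  by rewrite /Gamma_minus /= dlE epsNl epsNr invrK xodd.
Qed.

Lemma hom_indep1 m d : hD m d -> d != 0 ->
  hom_indep (D := D) (gr := gr) (fun _ : unit => d) (fun _ => m) [:: tt].
Proof.
move=> hd d0 u k hu; rewrite big_seq1 => E [] _.
apply/eqP; apply: contrapT => /negP u0; have [Fu gu] := hu tt.
have [w [_ _ wu _]] := F1_inv Fu gu u0.
move: E => /(congr1 ( *%R (lmul w))); rewrite mulrA -lmulM wu lmul1 mul1r mulr0.
by move=> E; rewrite E eqxx in d0.
Qed.

Lemma br_dd m n k d d' x : hD m d -> hD n d' -> gr k x ->
  br (d * d') (lmul x) = lmul (d (d' x)) + eps m (n + k) *: (lmul (d' x) * d)
     + eps n k *: (lmul (d x) * d').
Proof.
move=> hd hd' gx.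
rewrite (br_mull (hD_endo hd) (hD_endo hd') (lmul_gr gx)).
rewrite (br_der (proj2 hd) gx) (br_der (proj2 hd') gx).
by rewrite (der_lmul (proj2 hd) (hD_endo hd' gx)).
Qed.

(** Modulo P and up to scalars, [d d', x] is (d' x) d + (d x) d'. For d even,
    d' = d gives 2 (d x) d. For d odd, a d' outside F_1 d makes the pair
    independent, so that [separate] applies; if there is none, then d d = 0
    makes d a derivation with values in F_1. *)
Lemma D_sub_of_brackets (P : set (endo A)) : ~ exceptional_case eps gr D ->
  subsp P -> (forall m a X, gr m a -> P X -> P (lmul a * X)) ->
  (forall a, P (lmul a)) ->
  (forall m n k d d' x, hD m d -> hD n d' -> gr k x -> P (br (d * d') (lmul x))) ->
  forall m d, hD m d -> P d.
Proof.
move=> nex Ps Pl PA Pbr m d hd.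
have [->|d0] := eqVneq d 0; first exact: subsp0.
have Pbr' n k d' x : hD n d' -> gr k x ->
    P (eps m (n + k) *: (lmul (d' x) * d) + eps n k *: (lmul (d x) * d')).
  move=> hd' gx; have := subspB Ps (Pbr _ _ _ _ _ _ hd hd' gx) (PA (d (d' x))).
  by rewrite (br_dd hd hd' gx) -(addrA (lmul _)) [X in P X -> _]addrC addKr.
case: (@epsll _ _ _ _ _ _ S m) => m1.
  have := @separate _ _ eps A gr D S unit (fun _ => d) (fun _ => m) _ _ [:: tt] P
     (fun _ => d) _ _ Ps Pl _ tt; apply => //.
  - by move=> _; case: hd.
  - by move=> _ n e he; exact: hD_comm.
  - exact: hom_indep1.
  - move=> k x gx; rewrite big_seq1.
    have := Pbr' _ _ _ _ hd gx; rewrite epsDr m1 mul1r -scalerDr -mulr2n -scaler_nat scalerA.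
    move=> h; apply: (subspZ _ Ps); apply: (subspZ_eq Ps _ h) => //.
    by rewrite mulf_neq0 ?eps_neq0 ?two_neq0.
have [H|/existsNP[n /existsNP[d' /not_implyP[hd' ndep]]]] := pselect (forall n d', hD n d' ->
    exists2 u, F1 D u & d' = lmul u * d).
  exfalso; apply: nex; apply: (exceptional_of_F1_derivation (proj2 hd)).
    exact/eqP.
  move=> a; apply/F1P => n d' hd'; have [u _ ->] := H _ _ hd'.
  have : d * d = 0.
    have /eqP : d * d = eps m m *: (d * d) by exact: hD_comm.
    rewrite m1 scaleN1r -addr_eq0 -mulr2n -scaler_nat.
    by rewrite scaler_eq0 (negbTE two_neq0) => /eqP.
  move=> /(congr1 (fun f : endo A => f a)); rewrite endo_mulE => dda.
  by rewrite endo_mulE dda linear0.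
pose dd (i : bool) := if i then d else d'.
pose dg (i : bool) := if i then m else n.
have hdd i : hD (dg i) (dd i) by case: i.
have ind : hom_indep (D := D) (gr := gr) dd dg [:: true; false].
  move=> u k hu; rewrite big_cons big_seq1 /= => E.
  have [Fu gu] := hu false; have [Fu' gu'] := hu true.
  have uf : u false = 0.
    apply/eqP; apply: contrapT => /negP u0; apply: ndep.
    have [w [Fw _ wu _]] := F1_inv Fu gu u0.
    exists (- (w * u true)); first by apply: subspN F1s _; exact: F1M.
    move: E => /(congr1 ( *%R (lmul w))).
    rewrite mulrDr !mulrA -!lmulM wu lmul1 mul1r mulr0 => /eqP.
    by rewrite addrC addr_eq0 => /eqP ->; rewrite linearN/= mulNr.
  have ut : u true = 0.
    have Eu : \sum_(i <- [:: tt]) lmul (u true) * d = 0.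
      by rewrite big_seq1; move: E; rewrite uf linear0 mul0r addr0.
    have := @hom_indep1 m d hd d0 (fun _ => u true) k (fun _ => conj Fu' gu') Eu tt.
    by apply; rewrite inE.
  by move=> [].
have := @separate _ _ eps A gr D S bool dd dg _ _ [:: true; false] P
   (fun i => if i then d' else eps m n *: d) _ ind Ps Pl _ false.
move=> H; have : P (eps m n *: d).
  apply: H => //.
  - by move=> i; case: (hdd i).
  - by move=> i p e he; exact: hD_comm.
  move=> k x gx; rewrite big_cons big_seq1 /=.
  have := Pbr' _ _ _ _ hd' gx; move=> /(subspZ (eps m k * eps n k)^-1 Ps).
  congr P; rewrite scalerDr addrC !scalerA -scalerAr scalerA epsDr.
  have h1 : eps m k != 0 by exact: eps_neq0.
  have h2 : eps n k != 0 by exact: eps_neq0.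
  by congr (_ *: _ + _ *: _); field; rewrite h1 h2.
by apply: subspZ_eq => //; rewrite eps_neq0.
Qed.

End Exceptional.

(** * The derived algebra W *)

Section Derived.
Context {F : fieldType} {Gamma : zmodType} {eps : Gamma -> Gamma -> F}.
Context {A : algType F} {gr : Gamma -> set A} {D : set (endo A)}.
Context {S : setting eps gr D}.
Implicit Types (l m n : Gamma) (a b x y : A) (X Y Z : endo A) (C : set A).
Local Notation hD := (hD eps gr D).
Local Notation egr := (endo_gr gr).
Local Notation ccomm := (ccomm eps).
Local Notation br := (color_bracket eps egr).
Local Notation W := (W eps gr D).

Let gE := grE (S := S).
Let ADs := AD_sub (S := S).

Lemma AD_span : AD D = span [set X | AD D X /\ exists l, egr l X].
Proof.
apply/seteqP; split; last by apply: span_min => // X [].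
rewrite {1}ADE; apply: span_mono => X [l hX]; split; last by exists l; exact: hword_gr hX.
by rewrite ADE; apply: sub_span; exists l.
Qed.

Lemma AD_br l m X Y : AD D X -> egr l X -> AD D Y -> egr m Y -> AD D (br X Y).
Proof.
move=> hX gX hY gY; rewrite (brE gX gY); apply: (subspB ADs); first exact: AD_M.
by apply: (subspZ _ ADs); exact: AD_M.
Qed.

Lemma W_sub : subsp W. Proof. exact: span_subsp. Qed.

Lemma W_br X Y : AD D X -> AD D Y -> W (br X Y).
Proof. by move=> hX hY; apply: sub_span; exists X => //; exists Y. Qed.

Lemma W_min (Q : set (endo A)) : subsp Q ->
  (forall l m X Y, AD D X -> egr l X -> AD D Y -> egr m Y -> Q (br X Y)) ->
  W `<=` Q.
Proof.
move=> Qs h; apply: span_min => // z [X hX [Y hY ->]].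
move: hX hY; rewrite AD_span => hX hY.
apply: (bracket_span (eps := eps) gE (S1 := [set X | AD D X /\ exists l, egr l X])
  (S2 := [set X | AD D X /\ exists l, egr l X]) _ _ Qs _ hX hY).
- by move=> ? [_ [l]]; exact: gr_hspan.
- by move=> ? [_ [l]]; exact: gr_hspan.
- by move=> X' Y' [hX' [l gX']] [hY' [m gY']]; exact: (h l m).
Qed.

Lemma W_AD : W `<=` AD D.
Proof. by apply: W_min => // l m X Y *; exact: (@AD_br l m). Qed.

Lemma W_spanE : W = span [set X | W X /\ exists l, egr l X].
Proof.
apply/seteqP; split; last by apply: span_min => [|X []//]; exact: W_sub.
apply: W_min => [|l m X Y hX gX hY gY]; first exact: span_subsp.
apply: sub_span; split; first exact: W_br.
by exists (l + m); exact: br_gr.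
Qed.

Lemma W_hspan : W `<=` hspan egr.
Proof. exact: subset_trans W_AD AD_hspan. Qed.

Lemma W_hclosed : hclosed egr W.
Proof. by rewrite W_spanE; apply: span_hclosed => // X []. Qed.

(** The bracket with a product reduces to brackets with its factors. *)
Lemma br_assocr l m n X Y Z : egr l X -> egr m Y -> egr n Z ->
  br X (Y * Z) = br (X * Y) Z + eps (l + m) n *: br (Z * X) Y.
Proof.
move=> gX gY gZ; rewrite (brE gX (endo_grM gY gZ)) (brE (endo_grM gX gY) gZ).
rewrite (brE (endo_grM gZ gX) gY) scalerBr scalerA !mulrA addrA subrK.
congr (_ - _ *: _); rewrite !epsDl !epsDr mulrC.
have -> : eps l n * eps m n * (eps n m * eps l m) =
  (eps m n * eps n m) * (eps l n * eps l m) by ring.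
by rewrite epsC mul1r mulrC.
Qed.

Lemma br_assocl l m n X Y Z : egr l X -> egr m Y -> egr n Z ->
  br (X * Y) Z = br X (Y * Z) + eps l (m + n) *: br Y (Z * X).
Proof.
move=> gX gY gZ; rewrite (brE gX (endo_grM gY gZ)) (brE (endo_grM gX gY) gZ).
rewrite (brE gY (endo_grM gZ gX)) scalerBr scalerA !mulrA addrA subrK.
congr (_ - _ *: _); rewrite !epsDl !epsDr.
have -> : eps l m * eps l n * (eps m n * eps m l) =
  (eps l m * eps m l) * (eps l n * eps m n) by ring.
by rewrite epsC mul1r.
Qed.

(** [R, R] = [R, A] + [R, D], since A and D generate R. *)
Lemma W_min_gen (Q : set (endo A)) : subsp Q ->
  (forall l m X a, AD D X -> egr l X -> gr m a -> Q (br X (lmul a))) ->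
  (forall l m X d, AD D X -> egr l X -> hD m d -> Q (br X d)) ->
  W `<=` Q.
Proof.
move=> Qs hA hd; apply: W_min => // l m X Y hX gX hY gY.
pose P (m : Gamma) : set (endo A) := [set Y | hspan egr Y /\
  forall l X, AD D X -> egr l X -> Q (br X Y)].
suff : P m Y by move=> [_ h]; exact: (h l).
apply: (AD_ind (P := P) _ _ _ _ hY gY) => {l m X Y hX gX hY gY}.
- move=> l; split=> [|c Y Z [hY QY] [hZ QZ]]; split.
  + exact: subsp0 (hspan_subsp _).
  + move=> k X hX gX; rewrite (brE gX (subsp0 (endo_gr_sub 0))).
    by rewrite mulr0 mul0r scaler0 subr0; exact: subsp0.
  + by case: (hspan_subsp egr) => _; apply.
  + move=> k X hX gX; rewrite (br_linearr c hY hZ (egr_hspan gX)).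
    by case: Qs => _; apply; [exact: (QY _ _ hX gX)|exact: (QZ _ _ hX gX)].
- split; first exact: egr_hspan endo_gr1.
  move=> k X hX gX; rewrite (brE gX endo_gr1) mulr1 mul1r eps0r scale1r subrr.
  exact: subsp0.
- move=> m l a Y ga hY gY [_ QY]; split.
    exact: egr_hspan (endo_grM (lmul_gr ga) gY).
  move=> k X hX gX; rewrite (br_assocr gX (lmul_gr ga) gY); apply: (subspD Qs).
    by apply: (QY _ _ _ (endo_grM gX (lmul_gr ga))); apply: AD_M => //; exact: AD_lmul.
  by apply: (subspZ _ Qs); apply: (hA _ _ _ _ _ (endo_grM gY gX) ga); exact: AD_M.
- move=> m l d Y hd' hY gY [_ QY]; split.
    exact: egr_hspan (endo_grM (hD_endo hd') gY).
  move=> k X hX gX; rewrite (br_assocr gX (hD_endo hd') gY); apply: (subspD Qs).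
    by apply: (QY _ _ _ (endo_grM gX (hD_endo hd'))); apply: AD_M => //; apply: AD_D; case: hd'.
  by apply: (subspZ _ Qs); apply: (hd _ _ _ _ _ (endo_grM gY gX) hd'); exact: AD_M.
Qed.

Lemma br_lmul l m a b : gr l a -> gr m b -> br (lmul a) (lmul b) = 0.
Proof.
move=> ga gb; rewrite (brE (lmul_gr ga) (lmul_gr gb)).
by rewrite (ccomm_lmul ga gb) subrr.
Qed.

Lemma br_lmul_mul l m k a X x : gr l a -> egr m X -> gr k x ->
  br (lmul a * X) (lmul x) = lmul a * br X (lmul x).
Proof.
move=> ga gX gx; rewrite (br_mull (lmul_gr ga) gX (lmul_gr gx)).
by rewrite (br_lmul ga gx) mul0r scaler0 addr0.
Qed.

Lemma br_Ad l m k b d x : gr l b -> hD m d -> gr k x ->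
  br (lmul b * d) (lmul x) = lmul (b * d x).
Proof.
move=> gb hd gx; rewrite (br_lmul_mul gb (hD_endo hd) gx) (br_der (proj2 hd) gx).
by rewrite lmulM.
Qed.

Lemma ccomm_br0 l m X Y : egr l X -> egr m Y -> ccomm l X m Y -> br X Y = 0.
Proof. by move=> gX gY XY; rewrite (brE gX gY) XY subrr. Qed.

(** F_1 is in the color center: it color-commutes with the generators. *)
Lemma br_F1l l u m X : F1 D u -> gr l u -> AD D X -> egr m X -> br (lmul u) X = 0.
Proof.
move=> hu gu hX gX; apply: (ccomm_br0 (lmul_gr gu) gX).
apply: (AD_ind (P := fun m => [set X | ccomm l (lmul u) m X]) _ _ _ _ hX gX).
- by move=> ?; exact: ccomm_sub.
- exact: ccomm1.
- by move=> k n a Y ga _ _ hY; apply: ccommM hY; exact: ccomm_lmul.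
- move=> k n d Y hd _ _ hY; apply: ccommM hY; apply: ccomm_sym.
  exact: ccomm_F1_der.
Qed.

Lemma exists_der_neq0 : exists m d k a, [/\ hD m d, gr k a & d a != 0].
Proof.
have [m [d [hd /eqP d0]]] := exists_hD.
by have [k [a [ga da]]] := endo_neq0P d0; exists m, d, k, a.
Qed.

(** By [b d, x] = b (d x), the intersection of W and A contains an ideal. *)
Lemma W_lmul a : W (lmul a).
Proof.
have [m [d [k [x [hd gx dx]]]]] := exists_der_neq0.
apply: (@full_of_ideal _ _ _ _ _ _ S [set a | W (lmul a)] (m + k) (d x)) => //.
- by apply: subsp_preim W_sub => c u v; rewrite linearP.
- move=> p q e z he gz _; rewrite /= -(br_der (proj2 he) gz).
  by apply: W_br; [apply: AD_D; case: he|exact: AD_lmul].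
- exact: (hD_endo hd).
- move=> p b gb; rewrite /= -(br_Ad gb hd gx).
  apply: W_br; last exact: AD_lmul.
  by apply: AD_M; [exact: AD_lmul|apply: AD_D; case: hd].
Qed.

(** The X with A X inside W satisfy the hypotheses of [D_sub_of_brackets], since
    a [X, x] = [a X, x]. *)
Lemma W_Ad : ~ exceptional_case eps gr D ->
  forall m d a, hD m d -> W (lmul a * d).
Proof.
move=> nex m d a hd; move: a.
pose P := [set X | forall a, W (lmul a * X)].
suff : P d by exact.
apply: (D_sub_of_brackets nex (P := P) _ _ _ _ hd).
- split=> [a|c X Y hX hY a]; first by rewrite mulr0; exact: subsp0 W_sub.
  by rewrite mulrDr -scalerAr; case: W_sub => _; apply.
- by move=> p a X _ hX b; rewrite mulrA -lmulM.
- by move=> a b; rewrite -lmulM; exact: W_lmul.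
- move=> p q k d1 d2 x h1 h2 gx a.
  apply: (hom_ind (P := [set a | W (lmul a * br (d1 * d2) (lmul x))])).
    by apply: subsp_preim W_sub => c u v; rewrite linearP/= mulrDl scalerAl.
  move=> l {}a ga; rewrite /= -(br_lmul_mul ga (endo_grM (hD_endo h1) (hD_endo h2)) gx).
  apply: W_br; last exact: AD_lmul.
  by do 2?[apply: AD_M; first by [exact: AD_lmul|apply: AD_D; case: h1]]; apply: AD_D; case: h2.
Qed.

Lemma br_dd_lmul m n k j d d' x z : hD m d -> hD n d' -> gr k x -> gr j z ->
  exists c, gr (m + n + k + j) c /\ br (br (d * d') (lmul x)) (lmul z) = lmul c.
Proof.
move=> hd hd' gx gz.
exists (eps m (n + k) *: (d' x * d z) + eps n k *: (d x * d' z)).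
have g1 : gr (m + k) (d x) by exact: (hD_endo hd).
have g2 : gr (n + k) (d' x) by exact: (hD_endo hd').
have h1 : hspan egr (lmul (d' x) * d) by exact: egr_hspan (endo_grM (lmul_gr g2) (hD_endo hd)).
have h2 : hspan egr (lmul (d x) * d') by exact: egr_hspan (endo_grM (lmul_gr g1) (hD_endo hd')).
have h3 : hspan egr (lmul (d (d' x))) by exact: egr_hspan (lmul_gr (hD_endo hd g2)).
have h0 : hspan egr 0 by exact: subsp0 (hspan_subsp _).
have hz : hspan egr (lmul z) by exact: egr_hspan (lmul_gr gz).
split.
  apply: (subspD (gr_sub _)); apply: (subspZ _ (gr_sub _)).
    rewrite (_ : m + n + k + j = n + k + (m + j)).
      by apply: grM; [exact: g2|exact: (hD_endo hd)].
    by rewrite -!addrA addrCA; congr (_ + _); rewrite addrCA.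
  rewrite (_ : m + n + k + j = m + k + (n + j)).
    by apply: grM; [exact: g1|exact: (hD_endo hd')].
  by rewrite (addrAC m) addrA.
have hs c X : hspan egr X -> hspan egr (c *: X).
  by move=> hX; exact: (subspZ _ (hspan_subsp egr)).
have hp X Y : hspan egr X -> hspan egr Y -> hspan egr (X + Y).
  by move=> hX hY; exact: (subspD (hspan_subsp egr)).
rewrite (br_dd hd hd' gx) br_Dl ?br_Dl ?br_Zl//; try by [apply: hs|apply: hp => //; apply: hs].
rewrite (br_lmul (hD_endo hd g2) gz) add0r (br_Ad g2 hd gz) (br_Ad g1 hd' gz).
by rewrite linearD/= !linearZ.
Qed.

End Derived.

(** * Ideals of W *)

Section Ideals.
Context {F : fieldType} {Gamma : zmodType} {eps : Gamma -> Gamma -> F}.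
Context {A : algType F} {gr : Gamma -> set A} {D : set (endo A)}.
Context {S : setting eps gr D}.
Implicit Types (l m : Gamma) (a b x y : A) (X Y Z : endo A) (C : set A).
Local Notation hD := (hD eps gr D).
Local Notation egr := (endo_gr gr).
Local Notation br := (color_bracket eps egr).
Local Notation W := (W eps gr D).
Local Notation F1e := (@F1_endo F A D).

Let F1s := @F1_sub F A D.
Let gE := grE (S := S).
Let ADs := AD_sub (S := S).
Let Ws := @W_sub F Gamma eps A gr D.
Let hs0 := @hspan_subsp F (endo A) Gamma egr.

Lemma F1_endo_subsp : subsp F1e.
Proof.
split=> [|c X Y [u hu <-] [v hv <-]]; first by exists 0; [exact: subsp0|rewrite linear0].
by exists (c *: u + v); [case: F1s => _; apply|rewrite linearP].
Qed.

(** Differential operators of order less than n in the sense of Grothendieck: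
    n brackets with A annihilate them. *)
Fixpoint order_lt (n : nat) (l : Gamma) (X : endo A) : Prop :=
  if n is n'.+1 then
    egr l X /\ forall m x, gr m x -> order_lt n' (l + m) (br X (lmul x))
  else X = 0.

Lemma order_sub (n : nat) l : subsp (order_lt n l).
Proof.
elim: n l => [|n IH] l; first exact: subsp_set0.
split=> [|c X Y [gX hX] [gY hY]]; split.
- exact: subsp0 (endo_gr_sub l).
- move=> m x gx; rewrite br_0l; first exact: (subsp0 (IH _)).
  exact: egr_hspan (lmul_gr gx).
- by case: (endo_gr_sub (S := S) l) => _; apply.
- move=> m x gx; have hx : hspan egr (lmul x) by exact: egr_hspan (lmul_gr gx).
  rewrite (br_linearl _ (egr_hspan gX) (egr_hspan gY) hx).
  by case: (IH (l + m)) => _; apply; [exact: hX|exact: hY].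
Qed.

Lemma order_S (n : nat) l X : order_lt n l X -> order_lt n.+1 l X.
Proof.
elim: n l X => [|n IH] l X.
  move=> -> ; exact: (subsp0 (order_sub 1 l)).
by move=> [gX hX]; split=> // m x gx; apply: IH; exact: hX.
Qed.

Lemma order_le (n n' : nat) l X : (n <= n')%N -> order_lt n l X -> order_lt n' l X.
Proof.
by move=> /subnK <-; elim: (n' - n)%N => //= k IH h; apply: order_S; exact: IH.
Qed.

Lemma order_lmul (n : nat) l m a X : gr m a -> order_lt n l X ->
  order_lt n (m + l) (lmul a * X).
Proof.
move=> ga; elim: n l X => [|n IH] l X; first by move=> ->; rewrite /= mulr0.
move=> [gX hX]; split; first exact: endo_grM (lmul_gr ga) gX.
move=> k x gx; rewrite (br_lmul_mul ga gX gx) -addrA; apply: IH; exact: hX.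
Qed.

Lemma order_der (n : nat) l m d X : hD m d -> order_lt n l X ->
  order_lt n.+1 (m + l) (d * X).
Proof.
move=> hd; elim: n l X => [|n IH] l X.
  by move=> ->; rewrite mulr0; exact: (subsp0 (order_sub 1 _)).
move=> oX; have [gX hX] := oX; split; first exact: endo_grM (hD_endo hd) gX.
move=> k x gx; rewrite (br_mull (hD_endo hd) gX (lmul_gr gx)) (br_der (proj2 hd) gx).
apply: (subspD (order_sub _ _)).
  by rewrite -addrA; apply: IH; exact: hX.
apply: (subspZ _ (order_sub _ _)); rewrite addrAC.
by apply: order_lmul (hD_endo hd gx) oX.
Qed.

(** Left multiplication by a derivation raises the order by at most one. *)
Lemma AD_order l X : AD D X -> egr l X -> exists n, order_lt n l X.
Proof.
move=> hX gX.
apply: (AD_ind (P := fun l => [set X | exists n, order_lt n l X]) _ _ _ _ hX gX).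
- move=> k; split=> [|c Y Z [n hY] [n' hZ]]; first by exists 0.
  exists (maxn n n'); case: (order_sub (maxn n n') k) => _; apply.
    by apply: order_le hY; exact: leq_maxl.
  by apply: order_le hZ; exact: leq_maxr.
- exists 1%N; split; first exact: endo_gr1.
  move=> m x gx; rewrite (brE endo_gr1 (lmul_gr gx)) mul1r mulr1 eps0l scale1r.
  by rewrite subrr.
- by move=> m n a Y ga _ _ [k hY]; exists k; exact: order_lmul.
- by move=> m n d Y hd _ _ [k hY]; exists k.+1; exact: order_der.
Qed.

Lemma F1_endo_lmul X : F1e X -> X = lmul (X 1) /\ F1 D (X 1).
Proof. by move=> [u hu <-]; rewrite /= mulr1. Qed.

(** [X, -] is then a color derivation of A with values in F_1. *)
Lemma bracket_F1_eq0 l X : ~ exceptional_case eps gr D -> egr l X ->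
  (forall m x, gr m x -> F1e (br X (lmul x))) ->
  forall m x, gr m x -> br X (lmul x) = 0.
Proof.
move=> nex gX hX.
have hl x : hspan egr (lmul x).
  apply: (hom_ind (P := [set x | hspan egr (lmul x)])) => [|m {}x gx].
    by apply: subsp_preim hs0 => c u v; rewrite linearP.
  exact: egr_hspan (lmul_gr gx).
have hXs := egr_hspan gX.
pose f x := br X (lmul x) 1.
have fl : is_endo f.
  apply/asboolP => c x y; rewrite /f linearP/= (br_linearr _ (hl x) (hl y) hXs).
  by [].
pose e := Endo fl.
have FX x : F1e (br X (lmul x)).
  apply: (hom_ind (P := [set x | F1e (br X (lmul x))])); last exact: hX.
  apply: subsp_preim F1_endo_subsp => c u v.
  by rewrite linearP/= (br_linearr _ (hl u) (hl v) hXs).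
have eE x : br X (lmul x) = lmul (e x) by have [] := F1_endo_lmul (FX x).
have hder : Der_gr eps gr l e.
  split=> [m a ga|m n a b ga gb].
    by apply: lmul_gr_inv; rewrite -eE; exact: br_gr gX (lmul_gr ga).
  apply: lmul_inj; rewrite -eE lmulM (br_mulr gX (lmul_gr ga) (lmul_gr gb)) !eE.
  by rewrite linearD/= linearZ/= !lmulM.
move=> m x gx; rewrite eE; have [->|e0] := eqVneq e 0; first by rewrite linear0.
exfalso; apply: nex; apply: (exceptional_of_F1_derivation hder); first exact/eqP.
by move=> a; have [] := F1_endo_lmul (FX a).
Qed.

Lemma commuting_lmul l X : egr l X ->
  (forall m x, gr m x -> br X (lmul x) = 0) -> X = lmul (X 1).
Proof.
move=> gX hX; apply: (central_lmul gX) => m x gx.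
by apply/eqP; rewrite -subr_eq0 -(brE gX (lmul_gr gx)) (hX _ _ gx).
Qed.

Section Ideal.
Hypothesis nex : ~ exceptional_case eps gr D.
Variable U : set (endo A).
Hypothesis Us : subsp U.
Hypothesis UW : U `<=` W.
Hypothesis Uh : hclosed egr U.
Hypothesis WU : forall X Y, W X -> U Y -> U (br X Y).

Lemma ideal_right l m X Y : U X -> egr l X -> W Y -> egr m Y -> U (br X Y).
Proof.
move=> UX gX WY gY; rewrite (br_anti gX gY); apply: (subspN Us).
by apply: (subspZ _ Us); exact: WU.
Qed.

(** An element of U outside F_1 of minimal order has all its brackets with A in
    F_1. These brackets then vanish, so that the element lies in A. *)
Lemma ideal_meets_A : ~ (U `<=` F1e) ->
  exists l x, [/\ gr l x, U (lmul x) & ~ F1 D x].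
Proof.
move=> UF.
have [l [X [gX UX FX]]] : exists l X, [/\ egr l X, U X & ~ F1e X].
  apply: contrapT => h; apply: UF; apply: (hom_sub gE _ Uh F1_endo_subsp).
    exact: subset_trans UW W_hspan.
  by move=> l X UX gX; apply: contrapT => FX; apply: h; exists l, X.
have [n oX] := AD_order (W_AD (UW UX)) gX.
elim: n l X gX UX FX oX => [|n IH] l X gX UX FX oX.
  by exfalso; apply: FX; rewrite oX; exact: subsp0 F1_endo_subsp.
have [[m [x [gx Fx]]]|h] := pselect (exists m x, gr m x /\ ~ F1e (br X (lmul x))).
  apply: (IH (l + m) (br X (lmul x))) => //.
  - exact: br_gr gX (lmul_gr gx).
  - exact: (ideal_right UX gX (W_lmul x) (lmul_gr gx)).
  - by case: oX => _; exact.
have E := commuting_lmul gX (bracket_F1_eq0 nex gX _).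
have {}E : X = lmul (X 1).
  by apply: E => m x gx; apply: contrapT => Fx; apply: h; exists m, x.
exists l, (X 1); split.
- by apply: lmul_gr_inv; rewrite -E.
- by rewrite -E.
- by move=> FX1; apply: FX; rewrite E; exists (X 1).
Qed.

(** U meets A in a D-stable subspace that contains A (d x) = [A d, x]. *)
Lemma ideal_contains_A : ~ (U `<=` F1e) -> forall a, U (lmul a).
Proof.
move=> /ideal_meets_A[l [x [gx Ux Fx]]].
have [m [d [hd dx]]] := notF1_der Fx.
apply: (@full_of_ideal _ _ _ _ _ _ S [set a | U (lmul a)] (m + l) (d x)).
- by apply: subsp_preim Us => c u v; rewrite linearP.
- move=> p q e z he gz Uz; rewrite /= -(br_der (proj2 he) gz); apply: WU => //.
  by rewrite -[e]mul1r -lmul1; apply: W_Ad nex _ _ _ he.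
- exact: (hD_endo hd).
- exact: dx.
- move=> p b gb; rewrite /= -(br_Ad gb hd gx); apply: WU => //.
  by apply: W_Ad nex _ _ _ hd.
Qed.

(** As in the theory of Lie ideals of associative rings, these elements form an
    associative subalgebra, and the Jacobi identity shows that it contains
    [U, U], because brackets of U with A[D] lie in W. It remains to show that
    the subalgebra is all of A[D]. *)
Definition absorbing X := AD D X /\
  forall m Y, AD D Y -> egr m Y -> U (br X Y).

Local Notation T := absorbing.

Lemma absorbing_subsp : subsp T.
Proof.
split=> [|c X Y [hX TX] [hY TY]]; split.
- exact: subsp0 ADs.
- by move=> m Y hY gY; rewrite br_0l; [exact: subsp0|exact: egr_hspan gY].
- by case: ADs => _; apply.
- move=> m Z hZ gZ; rewrite (br_linearl _ (AD_hspan hX) (AD_hspan hY) (egr_hspan gZ)).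
  by case: Us => _; apply; [exact: TX gZ|exact: TY gZ].
Qed.

Lemma absorbing_mul l m X Y : T X -> egr l X -> T Y -> egr m Y -> T (X * Y).
Proof.
move=> [hX TX] gX [hY TY] gY; split; first exact: AD_M.
move=> n Z hZ gZ; rewrite (br_assocl gX gY gZ); apply: (subspD Us).
  by apply: TX (endo_grM gY gZ); exact: AD_M.
by apply: (subspZ _ Us); apply: TY (endo_grM gZ gX); exact: AD_M.
Qed.

Lemma absorbing_of_ideal l m X Y : U X -> egr l X -> U Y -> egr m Y -> T (br X Y).
Proof.
move=> UX gX UY gY; have hX : AD D X by exact: (W_AD (UW UX)).
have hY : AD D Y by exact: (W_AD (UW UY)).
split; first exact: AD_br gX hY gY.
move=> n Z hZ gZ.
have -> : br (br X Y) Z = br X (br Y Z) - eps l m *: br Y (br X Z).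
  by rewrite (br_jacobi gX gY gZ) addrK.
apply: (subspB Us).
  by apply: (ideal_right UX gX _ (br_gr gY gZ)); exact: W_br.
apply: (subspZ _ Us); apply: (ideal_right UY gY _ (br_gr gX gZ)); exact: W_br.
Qed.

Lemma absorbing_bracket l m X Y : W X -> egr l X -> T Y -> egr m Y -> T (br X Y).
Proof.
move=> WX gX [hY TY] gY; have hX : AD D X by exact: (W_AD WX).
split; first exact: AD_br gX hY gY.
move=> n Z hZ gZ.
have -> : br (br X Y) Z = br X (br Y Z) - eps l m *: br Y (br X Z).
  by rewrite (br_jacobi gX gY gZ) addrK.
apply: (subspB Us); first by apply: WU => //; exact: TY gZ.
by apply: (subspZ _ Us); apply: TY (br_gr gX gZ); exact: AD_br gX hZ gZ.
Qed.

(** F_1[D] color-commutes with d, so the bracket of d with a d' d'' only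
    differentiates a. *)
Lemma W_dA_dd m n p k d d' d'' a : hD m d -> hD n d' -> hD p d'' -> gr k a ->
  W (lmul (d a) * (d' * d'')).
Proof.
move=> h h' h'' ga.
have g12 := endo_grM (hD_endo h') (hD_endo h'').
have -> : lmul (d a) * (d' * d'') = br d (lmul a * (d' * d'')).
  rewrite (br_mulr (hD_endo h) (lmul_gr ga) g12) (br_der (proj2 h) ga).
  rewrite (_ : br d (d' * d'') = 0) ?mulr0 ?scaler0 ?addr0//.
  apply: (ccomm_br0 (hD_endo h) g12).
  by apply: ccommM; exact: hD_comm.
have [Dd _] := h; have [Dd' _] := h'; have [Dd'' _] := h''.
by apply: W_br; [exact: AD_D|do ?[apply: AD_M]; by [exact: AD_lmul|exact: AD_D]].
Qed.

Hypothesis UF : ~ (U `<=` F1e).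

Let UA := ideal_contains_A UF.

Lemma ideal_der_mul_bracket m n p k j d d' d'' a x : hD m d -> hD n d' -> hD p d'' -> gr k a ->
  gr j x -> U (lmul (d a) * br (d' * d'') (lmul x)).
Proof.
move=> h h' h'' ga gx.
rewrite -(br_lmul_mul (hD_endo h ga) (endo_grM (hD_endo h') (hD_endo h'')) gx).
by apply: WU => //; exact: W_dA_dd h h' h'' ga.
Qed.

(** Two brackets with elements of A turn (d a) d' d'' into (d a) c with c in A.
    If these all lay in F_1, then c d would be a derivation with values in F_1,
    so c d = 0 for all d in D, and c = 0 by simplicity. Then every [d' d'', x]
    would commute with A and so lie in A, and [D_sub_of_brackets] would put D
    inside A. *)
Lemma absorbing_meets_A : exists l x, [/\ gr l x, T (lmul x) & ~ F1 D x].
Proof.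
apply: contrapT => hT.
have TF l x : gr l x -> T (lmul x) -> F1 D x.
  by move=> gx Tx; apply: contrapT => Fx; apply: hT; exists l, x.
have [m0 [d0 [hd0 nd0]]] := exists_hD.
suff key n p j d' d'' x : hD n d' -> hD p d'' -> gr j x ->
    exists c, br (d' * d'') (lmul x) = lmul c.
  have := @D_sub_of_brackets _ _ _ _ _ _ S [set X | exists c, X = lmul c] nex.
  move=> /(_ _ _ _ _ _ _ hd0) [] => [|m a X ga [c ->]|a||c E].
  - split=> [|c X Y [a ->] [b ->]]; first by exists 0; rewrite linear0.
    by exists (c *: a + b); rewrite linearP.
  - by exists (a * c); rewrite lmulM.
  - by exists a.
  - by move=> *; apply: key; eassumption.
  have : c = 0.
    have : d0 1 = 0 by exact: der1 (proj2 hd0).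
    by rewrite E lmulE mulr1.
  by move=> c0; move: nd0; rewrite E c0 linear0 eqxx.
move=> h' h'' gx.
have gB : egr (n + p + j) (br (d' * d'') (lmul x)).
  exact: br_gr (endo_grM (hD_endo h') (hD_endo h'')) (lmul_gr gx).
eexists; apply: (commuting_lmul gB) => q z gz.
have [c [gc E]] := br_dd_lmul h' h'' gx gz; rewrite E.
suff -> : c = 0 by rewrite linear0.
have cF m k d a : hD m d -> gr k a -> F1 D (d a * c).
  move=> hd ga; have gda := hD_endo hd ga.
  apply: (TF _ _ (grM gda gc)); rewrite lmulM -E -(br_lmul_mul gda gB gz).
  apply: (absorbing_of_ideal _ (endo_grM (lmul_gr gda) gB) (UA z) (lmul_gr gz)).
  exact: ideal_der_mul_bracket hd h' h'' ga gx.
have cd m k d a : hD m d -> gr k a -> c * d a = 0.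
  move=> hd ga.
  have hder : Der_gr eps gr (n + p + j + q + m) (lmul c * d).
    exact: Der_lmul gc (proj2 hd).
  have [c0|c0] := eqVneq (lmul c * d) 0.
    exact: (congr1 (fun f : endo A => f a) c0).
  exfalso; apply: nex; apply: (exceptional_of_F1_derivation hder).
    exact/eqP.
  move=> b; apply: (hom_ind (P := [set b | F1 D ((lmul c * d) b)])).
    by apply: subsp_preim F1s => r u v; rewrite linearP.
  move=> i {}b gb; rewrite /= (grC gc (hD_endo hd gb)).
  by apply: (subspZ _ F1s); exact: cF hd gb.
apply/eqP; apply: contrapT => /negP c0.
have [m1 [d1 [k1 [a1 [hd1 ga1 /eqP]]]]] := exists_der_neq0; apply.
rewrite -[LHS]mul1r.
pose I := [set y | forall m k d a, hD m d -> gr k a -> y * d a = 0].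
suff : I 1 by move=> h; exact: h hd1 ga1.
apply: (simple_ind (P := I) _ gc c0 cd).
- split=> [r k d a _ _|r u v hu hv i k d a hd ga]; first by rewrite mul0r.
  by rewrite mulrDl -scalerAl (hu _ _ _ _ hd ga) (hv _ _ _ _ hd ga) scaler0 addr0.
- by move=> r k b y gb gy hy i h d a hd ga; rewrite -mulrA (hy _ _ _ _ hd ga) mulr0.
- move=> r k e y he gy hy i h d a hd ga.
  have := congr1 e (hy _ _ _ _ hd ga); rewrite (der_mul _ (proj2 he) gy) linear0.
  suff -> : y * e (d a) = 0 by rewrite scaler0 addr0.
  have -> : e (d a) = eps r i *: d (e a).
    have ed : e * d = eps r i *: (d * e) by exact: hD_comm.
    exact: (congr1 (fun f : endo A => f a) ed).
  by rewrite -scalerAr (hy _ _ _ _ hd (hD_endo he ga)) scaler0.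
Qed.

Lemma hD_W m d : hD m d -> W d.
Proof. by move=> hd; rewrite -[d]mul1r -lmul1; apply: W_Ad nex _ _ _ hd. Qed.

Lemma absorbing_A a : T (lmul a).
Proof.
have [l [x [gx Tx Fx]]] := absorbing_meets_A.
have [m [d [hd dx]]] := notF1_der Fx.
apply: (@full_of_ideal _ _ _ _ _ _ S [set a | T (lmul a)] (m + l) (d x)).
- by apply: subsp_preim absorbing_subsp => c u v; rewrite linearP.
- move=> p q e z he gz Tz; rewrite /= -(br_der (proj2 he) gz).
  exact: absorbing_bracket (hD_W he) (hD_endo he) Tz (lmul_gr gz).
- exact: (hD_endo hd).
- exact: dx.
- move=> p b gb; rewrite /= -(br_Ad gb hd gx).
  apply: (absorbing_bracket _ _ Tx (lmul_gr gx)); first exact: W_Ad nex _ _ _ hd.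
  exact: endo_grM (lmul_gr gb) (hD_endo hd).
Qed.

(** The y such that y [d' d'', x] is absorbing for all x form a D-stable ideal,
    which contains d a because (d a) d' d'' lies in W. *)
Lemma absorbing_bracket_dd n p j d' d'' x : hD n d' -> hD p d'' -> gr j x ->
  T (br (d' * d'') (lmul x)).
Proof.
move=> h' h'' gx.
have [m [d [k [a [hd ga da]]]]] := exists_der_neq0.
have g12 : egr (n + p) (d' * d'') by exact: endo_grM (hD_endo h') (hD_endo h'').
pose P := [set y | forall j x, gr j x -> T (lmul y * br (d' * d'') (lmul x))].
suff : P 1 by move=> /(_ _ _ gx); rewrite lmul1 mul1r.
apply: (simple_ind (P := P) _ (hD_endo hd ga) da) => {j x gx}.
- split=> [j x gx|c u v hu hv j x gx]; first by rewrite linear0 mul0r; exact: subsp0 absorbing_subsp.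
  rewrite linearP/= mulrDl -scalerAl; case: absorbing_subsp => _; apply.
    exact: hu gx.
  exact: hv gx.
- move=> j x gx; rewrite -(br_lmul_mul (hD_endo hd ga) g12 gx).
  apply: (absorbing_bracket _ _ (absorbing_A x) (lmul_gr gx)); first exact: W_dA_dd hd h' h'' ga.
  exact: endo_grM (lmul_gr (hD_endo hd ga)) g12.
- move=> q r b y gb gy hy j x gx; rewrite lmulM -mulrA.
  apply: (absorbing_mul (absorbing_A b) (lmul_gr gb) (hy _ _ gx)).
  exact: endo_grM (lmul_gr gy) (br_gr g12 (lmul_gr gx)).
move=> q r e y he gy hy j x gx.
have gB : egr (n + p + j) (br (d' * d'') (lmul x)).
  exact: br_gr g12 (lmul_gr gx).
have E0 : br e (d' * d'') = 0.
  by apply: (ccomm_br0 (hD_endo he) g12); apply: ccommM; exact: hD_comm.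
have E1 : br e (br (d' * d'') (lmul x)) = eps q (n + p) *: br (d' * d'') (lmul (e x)).
  rewrite (br_jacobi (hD_endo he) g12 (lmul_gr gx)) E0 (br_der (proj2 he) gx).
  by rewrite br_0l ?add0r//; exact: egr_hspan (lmul_gr gx).
have -> : lmul (e y) * br (d' * d'') (lmul x) =
    br e (lmul y * br (d' * d'') (lmul x)) -
    (eps q r * eps q (n + p)) *: (lmul y * br (d' * d'') (lmul (e x))).
  rewrite (br_mulr (hD_endo he) (lmul_gr gy) gB) (br_der (proj2 he) gy) E1.
  by rewrite -scalerAr scalerA addrK.
apply: (subspB absorbing_subsp); last by apply: (subspZ _ absorbing_subsp); exact: hy (hD_endo he gx).
apply: (absorbing_bracket (hD_W he) (hD_endo he) (hy _ _ gx)).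
exact: endo_grM (lmul_gr gy) gB.
Qed.

Lemma absorbing_D m d : hD m d -> T d.
Proof.
move=> hd; pose P := span [set X | T X /\ exists l, egr l X].
suff : P d by apply: span_min => [|X []//]; exact: absorbing_subsp.
apply: (D_sub_of_brackets nex (P := P) (span_subsp _) _ _ _ hd).
- move=> k a X ga hX; apply: (span_min (U := [set X | P (lmul a * X)]) _ _ hX).
    by apply: subsp_preim (span_subsp _) => c u v; rewrite mulrDr scalerAr.
  move=> Y [TY [l gY]]; apply: sub_span; split.
    exact: (absorbing_mul (absorbing_A a) (lmul_gr ga) TY gY).
  by exists (k + l); exact: endo_grM (lmul_gr ga) gY.
- move=> a; apply: (hom_ind (P := [set a | P (lmul a)])).
    by apply: subsp_preim (span_subsp _) => c u v; rewrite linearP.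
  move=> k b gb; apply: sub_span; split; first exact: absorbing_A.
  by exists k; exact: lmul_gr.
- move=> p q k d' d'' x h' h'' gx; apply: sub_span; split.
    exact: absorbing_bracket_dd h' h'' gx.
  by exists (p + q + k); exact: br_gr (endo_grM (hD_endo h') (hD_endo h'')) (lmul_gr gx).
Qed.

Lemma ideal_full : W `<=` U.
Proof.
apply: (W_min Us) => l m X Y hX gX hY gY.
suff : T X by move=> [_ h]; exact: (h _ _ hY gY).
apply: (AD_ind (P := fun l => T) _ _ _ _ hX gX).
- by move=> _; exact: absorbing_subsp.
- by rewrite -lmul1; exact: absorbing_A.
- by move=> k n a Z ga _ gZ TZ; exact: (absorbing_mul (absorbing_A a) (lmul_gr ga) TZ gZ).
- by move=> k n d Z hd _ gZ TZ; exact: (absorbing_mul (absorbing_D hd) (hD_endo hd) TZ gZ).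
Qed.

End Ideal.

End Ideals.

(** * The quotient W / F_1 *)

Section Quotient.
Context {F : fieldType} {Gamma : zmodType} {eps : Gamma -> Gamma -> F}.
Context {A : algType F} {gr : Gamma -> set A} {D : set (endo A)}.
Context {S : setting eps gr D}.
Implicit Types (l m n : Gamma) (a b x y : A) (X Y Z : endo A) (C : set A).
Local Notation hD := (hD eps gr D).
Local Notation egr := (endo_gr gr).
Local Notation br := (color_bracket eps egr).
Local Notation W := (W eps gr D).
Local Notation F1e := (@F1_endo F A D).
Local Notation pi := (lmod_pi F1e).
Local Notation Wq := (W_mod_F1 eps gr D).
Local Notation Wg := (W_mod_F1_gr eps gr D).
Local Notation brq := (W_mod_F1_bracket eps gr D).

Let F1s := @F1_sub F A D.
Let gA := grA (S := S).
Let gE := grE (S := S).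
Let Ws := @W_sub F Gamma eps A gr D.
Let hs0 := @hspan_subsp F (endo A) Gamma egr.
Let F1es := @F1_endo_subsp F A D.

Lemma F1_endo_hom_span : F1e `<=` span [set X | exists l u, [/\ F1 D u, gr l u & X = lmul u]].
Proof.
move=> _ [u hu <-]; have hF1 : hclosed gr (F1 D) by exact: F1_hclosed.
pose Q := [set u | span [set X | exists l u, [/\ F1 D u, gr l u & X = lmul u]]
                        (lmul u)].
apply: (hom_sub (Q := Q) gA _ hF1 _ _ hu).
- by move=> *; exact: hspanA.
- by apply: subsp_preim (span_subsp _) => c x y; rewrite linearP.
- by move=> l x hx gx; apply: sub_span; exists l, x.
Qed.

Lemma F1_endo_hclosed : hclosed egr F1e.
Proof.
suff -> : F1e = span [set X | exists l u, [/\ F1 D u, gr l u & X = lmul u]].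
  by apply: span_hclosed => // X [l [u [_ gu ->]]]; exists l; exact: lmul_gr.
apply/seteqP; split; first exact: F1_endo_hom_span.
by apply: span_min => // X [l [u [hu _ ->]]]; exists u.
Qed.

Lemma br_F1_endol X Y : F1e X -> AD D Y -> br X Y = 0.
Proof.
move=> /F1_endo_hom_span hX hY; rewrite (AD_span (S := S)) in hY.
apply: (bracket_span (eps := eps) gE _ _ (subsp_set0 _) _ hX hY) => [Z [l [u [_ gu ->]]]|Z [_ [l]]|].
- exact: gr_hspan (lmul_gr gu).
- exact: gr_hspan.
- by move=> _ Y' [l [u [hu gu ->]]] [hY' [m gY']] /=; exact: (br_F1l hu gu hY' gY').
Qed.

Lemma br_F1_endor X Y : F1e X -> AD D Y -> br Y X = 0.
Proof.
move=> /F1_endo_hom_span hX hY; rewrite (AD_span (S := S)) in hY.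
apply: (bracket_span (eps := eps) gE _ _ (subsp_set0 _) _ hY hX) => [Z [_ [l]]|Z [l [u [_ gu ->]]]|].
- exact: gr_hspan.
- exact: gr_hspan (lmul_gr gu).
- move=> Y' _ [hY' [m gY']] [l [u [hu gu ->]]] /=.
  by rewrite (br_anti gY' (lmul_gr gu)) (br_F1l hu gu hY' gY') scaler0 oppr0.
Qed.

Lemma F1_endo_W : F1e `<=` W.
Proof. by move=> _ [u _ <-]; exact: W_lmul. Qed.

Lemma piP X Y : pi X = pi Y <-> F1e (X - Y).
Proof. by rewrite lmod_piE span_id. Qed.

Lemma pi_eq0 X : pi X = 0 <-> F1e X.
Proof. by rewrite -(linear0 pi) piP subr0. Qed.

(** F_1 has zero bracket with A[D], so representatives do not matter. *)
Lemma W_mod_F1_bracketE X Y : W X -> W Y -> brq (pi X) (pi Y) = pi (br X Y).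
Proof.
move=> hX hY; rewrite /W_mod_F1_bracket /quot_op.
pose X' := lmod_repr (pi X); pose Y' := lmod_repr (pi Y).
have FX : F1e (X' - X) by apply/piP; exact: lmod_reprK.
have FY : F1e (Y' - Y) by apply/piP; exact: lmod_reprK.
rewrite -/X' -/Y' -(subrK X X') -(subrK Y Y').
have hu : hspan egr (X' - X) by exact: AD_hspan (W_AD (F1_endo_W FX)).
have hv : hspan egr (Y' - Y) by exact: AD_hspan (W_AD (F1_endo_W FY)).
have hX' : hspan egr X by exact: AD_hspan (W_AD hX).
have hY' : hspan egr Y by exact: AD_hspan (W_AD hY).
have h : hspan egr (Y' - Y + Y) by exact: (subspD hs0).
rewrite (br_Dl hu hX' h) (br_Dr hv hY' hu) (br_Dr hv hY' hX').
rewrite (br_F1_endor FY (W_AD hX)) (br_F1_endol FX (W_AD hY)).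
by rewrite (br_F1_endol FX (W_AD (F1_endo_W FY))) !add0r.
Qed.

Lemma W_closed_bracket X Y : W X -> W Y -> W (br X Y).
Proof. by move=> hX hY; apply: W_br; exact: W_AD. Qed.

Lemma subsp_image (V V' : lmodType F) (f : {linear V -> V'}) (U : set V) :
  subsp U -> subsp (f @` U).
Proof.
move=> Us; split=> [|c _ _ [x Ux <-] [y Uy <-]].
  by exists 0; [exact: subsp0|rewrite linear0].
by exists (c *: x + y); [case: Us => _; apply|rewrite linearP].
Qed.

Lemma W_mod_F1_subsp : subsp Wq. Proof. exact: subsp_image. Qed.

(** F_1 is graded: if a sum of homogeneous elements lies in it, so does each. *)
Lemma W_mod_F1_gr_indep : indep_grading Wg.
Proof.
split=> [l|s f us fs s0 l ls].
  by apply: subsp_image; apply: subspI => //; exact: endo_gr_sub.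
have : forall l, exists w, [/\ egr l w & l \in s -> f l = pi w].
  move=> k; case: (boolP (k \in s)) => ks; last by exists 0; split=> //; exact: subsp0 (endo_gr_sub k).
  by have [w [_ gw] <-] := fs _ ks; exists w.
move=> /choice[g gP].
have : F1e (\sum_(l <- s) (if l \in s then g l else 0)).
  apply/pi_eq0; rewrite linear_sum -[RHS]s0 big_seq [RHS]big_seq; apply: eq_bigr => k ks.
  by rewrite ks; have [_ ->] := gP k.
move=> /(F1_endo_hclosed l); rewrite (hcomp_sum_id gE) ?ls//; last first.
  by move=> k /negbTE ->.
  move=> k; case: ifP => _; [by have [] := gP k|exact: subsp0 (endo_gr_sub k)].
by move=> /pi_eq0; have [_ <-] := gP l.
Qed.

Lemma W_mod_F1_gr_sub l : Wg l `<=` Wq.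
Proof. by move=> _ [x [Wx _] <-]; exists x. Qed.

Lemma hcomp_pi l X : W X -> hcomp Wg l (pi X) = pi (hcomp egr l X).
Proof.
move=> WX; have hX : hspan egr X by exact: W_hspan.
have [s [us s0 E]] := hcompP gE hX; rewrite [in LHS]E linear_sum.
rewrite (hcomp_sum_id (f := fun l => pi (hcomp egr l X)) W_mod_F1_gr_indep)// => m.
  exists (hcomp egr m X) => //; split; first exact: W_hclosed.
  exact: (hcomp_gr gE).
by move=> ms; rewrite s0// linear0.
Qed.

Lemma W_mod_F1_hspan : Wq `<=` hspan Wg.
Proof.
move=> _ [X WX <-]; have hX : hspan egr X by exact: W_hspan.
have [s [us s0 E]] := hcompP gE hX; rewrite [in X in _ X]E linear_sum.
apply: subsp_sum_seq; first exact: hspan_subsp.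
move=> l _; apply: sub_span; exists l => //; exists (hcomp egr l X) => //; split.
  exact: W_hclosed.
exact: (hcomp_gr gE).
Qed.

Lemma jacobi_hspan l m X Y Z : egr l X -> egr m Y -> AD D X -> AD D Y -> AD D Z ->
  br X (br Y Z) = br (br X Y) Z + eps l m *: br Y (br X Z).
Proof.
move=> gX gY hX hY; rewrite AD_span.
have hXs : hspan egr X by exact: egr_hspan gX.
have hYs : hspan egr Y by exact: egr_hspan gY.
have hXY : hspan egr (br X Y) by exact: egr_hspan (br_gr gX gY).
pose P : set (endo A) := [set Z | [/\ hspan egr Z, hspan egr (br X Z), hspan egr (br Y Z) &
  br X (br Y Z) = br (br X Y) Z + eps l m *: br Y (br X Z)]].
suff: span [set X | AD D X /\ exists l, egr l X] `<=` P by move=> /[apply] -[].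
apply: span_min => [|Z' [hZ [n gZ]]]; last first.
  split; [exact: egr_hspan gZ|exact: egr_hspan (br_gr gX gZ)|
    exact: egr_hspan (br_gr gY gZ)|exact: br_jacobi gZ].
have h0 : hspan egr 0 by exact: subsp0 hs0.
have hl c u v : hspan egr u -> hspan egr v -> hspan egr (c *: u + v).
  by case: hs0 => _; apply.
split=> [|c u v [hu hu1 hu2 Eu] [hv hv1 hv2 Ev]].
  by split; rewrite ?br_0r// ?br_0r// scaler0 addr0.
have E1 T : hspan egr T -> br T (c *: u + v) = c *: br T u + br T v.
  by move=> hT; rewrite br_linearr.
split; [exact: hl|by rewrite E1//; exact: hl|by rewrite E1//; exact: hl|].
rewrite (E1 _ hYs) (E1 _ hXY) (E1 _ hXs).
rewrite (br_linearr c hu2 hv2 hXs) (br_linearr c hu1 hv1 hYs).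
rewrite Eu Ev !scalerDr !scalerA (mulrC c).
by rewrite addrACA.
Qed.

Lemma W_mod_F1_lie_color : lie_color_algebra eps Wq Wg brq.
Proof.
have piW X : W X -> Wq (pi X) by move=> WX; exists X.
split.
- apply/(graded_subspaceP W_mod_F1_gr_indep W_mod_F1_subsp); split; first exact: W_mod_F1_hspan.
  by move=> l X /W_mod_F1_hspan hX; apply: (@W_mod_F1_gr_sub l); exact: (hcomp_gr W_mod_F1_gr_indep).
- move=> a _ _ _ [X WX <-] [Y WY <-] [Z WZ <-].
  have hX : hspan egr X by exact: W_hspan.
  have hY : hspan egr Y by exact: W_hspan.
  have hZ : hspan egr Z by exact: W_hspan.
  have WXY : W (a *: X + Y) by case: Ws => _; apply.
  rewrite -[a *: pi X + pi Y](linearP pi).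
  rewrite (W_mod_F1_bracketE WXY WZ) (W_mod_F1_bracketE WX WZ).
  rewrite (W_mod_F1_bracketE WY WZ).
  rewrite (W_mod_F1_bracketE WZ WXY) (W_mod_F1_bracketE WZ WX) (W_mod_F1_bracketE WZ WY).
  rewrite (br_linearl a hX hY hZ) (br_linearr a hX hY hZ).
  by split; exact: (linearP pi).
- move=> l m _ _ [_ [X [WX gX] <-]] [_ [Y [WY gY] <-]]; rewrite W_mod_F1_bracketE//.
  have WB : W (br X Y) by exact: W_closed_bracket.
  by split; [exact: piW|exists (br X Y) => //; split=> //; exact: br_gr].
- move=> l m _ _ [_ [X [WX gX] <-]] [_ [Y [WY gY] <-]]; rewrite !W_mod_F1_bracketE//.
  by rewrite (br_anti gX gY) linearN linearZ.
- move=> l m _ _ _ [_ [X [WX gX] <-]] [_ [Y [WY gY] <-]] [Z WZ <-].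
  rewrite !W_mod_F1_bracketE//; try exact: W_closed_bracket.
  rewrite (jacobi_hspan gX gY (W_AD WX) (W_AD WY) (W_AD WZ)).
  by rewrite (linearD pi) (linearZ_LR pi).
Qed.

(** If W / F_1 were abelian, then A (d x) = [A d, x] would lie in F_1, so that
    F_1 = A and D = 0. An ideal is treated through its preimage in W. *)
Lemma W_mod_F1_simple : ~ exceptional_case eps gr D -> lie_color_simple Wq Wg brq.
Proof.
move=> nex; split.
  apply: contrapT => h.
  have hF X Y : W X -> W Y -> F1e (br X Y).
    move=> WX WY; apply/pi_eq0; apply/eqP; apply: contrapT => /negP nz.
    by apply: h; exists (pi X), (pi Y); split; [exists X|exists Y|rewrite W_mod_F1_bracketE].
  have [m [d [k [x [hd gx dx]]]]] := exists_der_neq0 (S := S).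
  have FA : forall a, F1 D a.
    apply: (full_of_ideal (V := F1 D) F1s _ (hD_endo hd gx) dx).
      by move=> p q e z he gz hz; rewrite (der_F1 he hz); exact: subsp0.
    move=> n b gb; have : F1e (br (lmul b * d) (lmul x)).
      by apply: hF; [exact: W_Ad nex _ _ _ hd|exact: W_lmul].
    by rewrite (br_Ad gb hd gx) => -[u hu /lmul_inj <-].
  have : d x = 0 by exact: der_F1 hd (FA x).
  by move=> dx0; rewrite dx0 eqxx in dx.
move=> U' [grU UL UI].
have U's : subsp U' by have [_ -> _] := grU; exact: span_subsp.
have [UH Uhc] := (graded_subspaceP W_mod_F1_gr_indep U's).1 grU.
pose U := W `&` [set X | U' (pi X)].
have Us : subsp U by apply: subspI => //; apply: subsp_preim U's => c u v; rewrite linearP.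
have Uh : hclosed egr U.
  move=> l X [WX UX]; split; first exact: W_hclosed.
  by rewrite /= -(hcomp_pi l WX); exact: Uhc.
have WU X Y : W X -> U Y -> U (br X Y).
  move=> WX [WY UY]; split; first exact: W_closed_bracket.
  by rewrite /= -(W_mod_F1_bracketE WX WY); apply: UI => //; exists X.
have [UF|UF] := pselect (U `<=` F1e); [left|right]; apply/seteqP; split.
- move=> X' UX'; have [X WX E] := UL _ UX'; rewrite -E; apply/pi_eq0; apply: UF.
  by split=> //=; rewrite E.
- by move=> _ ->; exact: subsp0.
- exact: UL.
- move=> _ [X WX <-]; have WsU : W `<=` U.
    by apply: ideal_full => // X' [].
  by have [] := WsU X WX.
Qed.

(** Here A[D] = A + A e with e e = 0 and e A inside F_1, so that W lies in
    A + F_1 e, whose brackets lie in F_1. *)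
Lemma exceptional_abelian : exceptional_case eps gr D ->
  forall X Y, W X -> W Y -> F1e (br X Y).
Proof.
move=> [t [e [tl [dl [[gt tt dec] [he eF et] Esp [todd dodd]]]]]].
have eFA a : F1 D (e a).
  have [[u v] [[/= hu hv ->] _]] := dec a; rewrite endoD eF// add0r.
  have hF1 : hclosed gr (F1 D) by exact: F1_hclosed.
  apply: (hom_sub (Q := [set v | F1 D (e (v * t))]) gA _ hF1 _ _ hv).
  - by move=> *; exact: hspanA.
  - by apply: subsp_preim F1s => c x y; rewrite mulrDl -scalerAl linearP.
  - move=> l x hx gx; rewrite /= (der_mul _ he gx) eF// mul0r add0r et mulr1.
    exact: (subspZ _ F1s hx).
have ee : e * e = 0 by apply: endoP => a; rewrite endo_mulE eF.
have De m d : hD m d -> d = lmul (d t) * e.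
  move=> [Dd _]; have : [set z | exists2 u, F1 D u & z = lmul u * e] d.
    by rewrite -Esp; apply: sub_span; exists 1; [exact: F11|exists d => //; rewrite lmul1 mul1r].
  by move=> [u hu E]; rewrite {1}E [in RHS]E endo_mulE et lmulE mulr1.
have Ft m d : hD m d -> F1 D (d t).
  move=> hd; have [Dd _] := hd; have : [set z | exists2 u, F1 D u & z = lmul u * e] d.
    by rewrite -Esp; apply: sub_span; exists 1; [exact: F11|exists d => //; rewrite lmul1 mul1r].
  by move=> [u hu E]; rewrite E endo_mulE et lmulE mulr1.
have ge := Der_gr_endo he.
pose G : set (endo A) := [set X | exists l a, gr l a /\ (X = lmul a \/ X = lmul a * e)].
have GH : G `<=` hspan egr.
  move=> X [l [a [ga [->|->]]]]; first exact: gr_hspan (lmul_gr ga).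
  exact: gr_hspan (endo_grM (lmul_gr ga) ge).
have Gl a X : span G X -> span G (lmul a * X).
  move=> hX; apply: (hom_ind (P := [set a | span G (lmul a * X)])).
    by apply: subsp_preim (span_subsp _) => c x y; rewrite linearP/= mulrDl scalerAl.
  move=> l {}a ga; apply: (span_min (U := [set X | span G (lmul a * X)]) _ _ hX).
    by apply: subsp_preim (span_subsp _) => c x y; rewrite mulrDr scalerAr.
  move=> Y [m [b [gb [->|->]]]]; apply: sub_span; exists (l + m), (a * b);
    (split; first exact: grM); [left|right]; by rewrite lmulM ?mulrA.
have Ge X : span G X -> span G (e * X).
  move=> hX; apply: (span_min (U := [set X | span G (e * X)]) _ _ hX).
    by apply: subsp_preim (span_subsp _) => c x y; rewrite mulrDr scalerAr.
  move=> Y [m [b [gb [->|->]]]]; rewrite /= ?mulrA (der_lmul he gb).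
    apply: (subspD (span_subsp _)).
      by apply: sub_span; exists (dl + m), (e b); split; [exact: ge|left].
    by apply: (subspZ _ (span_subsp _)); apply: sub_span; exists m, b; split; [|right].
  rewrite mulrDl -scalerAl -mulrA ee mulr0 scaler0 addr0.
  by apply: sub_span; exists (dl + m), (e b); split; [exact: ge|right].
have ADG : AD D `<=` span G.
  rewrite (AD_span (S := S)); apply: span_min => [|X [hX [l gX]]]; first exact: span_subsp.
  apply: (AD_ind (P := fun=> span G) _ _ _ _ hX gX) => [_||m k a Y ga _ _|m k d Y hd _ _ hY].
  - exact: span_subsp.
  - by apply: sub_span; exists 0, 1; split; [exact: gr1|left; rewrite lmul1].
  - exact: Gl.
  - by rewrite (De _ _ hd) -mulrA; apply: Gl; exact: Ge.
pose GZ : set (endo A) := [set X | exists l a, gr l a /\ (X = lmul a \/ (F1 D a /\ X = lmul a * e))].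
have GZH : GZ `<=` hspan egr.
  move=> X [l [a [ga [->|[_ ->]]]]]; first exact: gr_hspan (lmul_gr ga).
  exact: gr_hspan (endo_grM (lmul_gr ga) ge).
have bra l m u a : gr l u -> gr m a -> br (lmul u * e) (lmul a) = lmul (u * e a).
  by move=> gu ga; rewrite (br_lmul_mul gu ge ga) (br_der he ga) lmulM.
have bru l m u b : F1 D u -> gr l u -> gr m b ->
    br (lmul u * e) (lmul b * e) = lmul (u * e b) * e.
  move=> hu gu gb; have gue : egr (l + dl) (lmul u * e) by exact: endo_grM (lmul_gr gu) ge.
  rewrite (br_mulr gue (lmul_gr gb) ge) (bra _ _ _ _ gu gb).
  suff -> : br (lmul u * e) e = 0 by rewrite mulr0 scaler0 addr0.
  have ue : e * lmul u = eps dl l *: (lmul u * e).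
    by rewrite (der_lmul he gu) eF// linear0 add0r.
  by rewrite (brE gue ge) mulrA ue -mulrA -scalerAl -mulrA ee mulr0 !scaler0 subr0.
have WZ : W `<=` span GZ.
  have key m Y : egr m Y -> (forall X, G X -> span GZ (br X Y)) ->
      forall X, AD D X -> span GZ (br X Y).
    move=> gY h X /ADG hX; have h1 : span [set Y] Y by apply: sub_span.
    apply: (bracket_span (eps := eps) gE GH _ (span_subsp GZ) _ hX h1).
      by move=> _ ->; exact: gr_hspan gY.
    by move=> X' _ GX' ->; exact: h.
  apply: W_min_gen => [|l m X a hX gX ga|l m X d hX gX hd]; first exact: span_subsp.
    apply: (key m) => // [|Y [k [b [gb [->|->]]]]]; first exact: lmul_gr.
      by rewrite (br_lmul gb ga); exact: subsp0 (span_subsp _).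
    rewrite (bra _ _ _ _ gb ga); apply: sub_span; exists (k + (dl + m)), (b * e a).
    by split; [apply: (grM gb); exact: ge|left].
  have gdt : gr (m + tl) (d t) by exact: (hD_endo hd).
  have gde : egr (m + tl + dl) (lmul (d t) * e) by exact: endo_grM (lmul_gr gdt) ge.
  rewrite (De _ _ hd); apply: (key (m + tl + dl)) => // Y [k [b [gb [->|->]]]].
    rewrite (br_anti (lmul_gr gb) gde) (bra _ _ _ _ gdt gb).
    apply: (subspN (span_subsp _)); apply: (subspZ _ (span_subsp _)); apply: sub_span.
    by exists (m + tl + (dl + k)), (d t * e b); split; [apply: (grM gdt); exact: ge|left].
  rewrite (br_anti (endo_grM (lmul_gr gb) ge) gde) (bru _ _ _ _ (Ft _ _ hd) gdt gb).
  apply: (subspN (span_subsp _)); apply: (subspZ _ (span_subsp _)); apply: sub_span.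
  exists (m + tl + (dl + k)), (d t * e b); split; first by apply: (grM gdt); exact: ge.
  by right; split=> //; apply: F1M; [exact: Ft hd|].
move=> X Y /WZ hX /WZ hY.
apply: (bracket_span (eps := eps) gE GZH GZH F1es _ hX hY) => {hX hY} {}X {}Y.
move=> [l [a [ga [->|[ha ->]]]]] [m [b [gb [->|[hb ->]]]]].
- by rewrite (br_lmul ga gb); exact: subsp0 F1es.
- rewrite (br_anti (lmul_gr ga) (endo_grM (lmul_gr gb) ge)) (bra _ _ _ _ gb ga).
  by apply: (subspN F1es); apply: (subspZ _ F1es); exists (b * e a) => //; exact: F1M.
- by rewrite (bra _ _ _ _ ga gb); exists (a * e b) => //; exact: F1M.
- rewrite (bru _ _ _ _ ha ga gb) eF// mulr0 linear0 mul0r.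
  exact: subsp0 F1es.
Qed.

Lemma W_mod_F1_simplicity :
  [/\ forall x y : endo A, W x -> W y -> brq (pi x) (pi y) = pi (br x y),
      lie_color_algebra eps Wq Wg brq &
      lie_color_simple Wq Wg brq <-> ~ exceptional_case eps gr D].
Proof.
split; [exact: W_mod_F1_bracketE|exact: W_mod_F1_lie_color|split; last exact: W_mod_F1_simple].
move=> [[_ [_ [[X WX <-] [Y WY <-] /eqP nz]]] _] exc; apply: nz.
by rewrite W_mod_F1_bracketE//; apply/pi_eq0; exact: exceptional_abelian.
Qed.

End Quotient.

(** * Multi-indices *)

Section MultiIndex.
Variables (disp : Order.disp_t) (I : orderType disp).
Implicit Types (al be : multi_index I) (i j : I) (r s : seq I).

Definition upd al i (n : nat) : multi_index I := [fsfun al with i |-> n].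

Lemma updE al i n j : upd al i n j = if j == i then n else al j.
Proof. by rewrite /upd fsfun_withE. Qed.

Lemma upd_id al i : upd al i (al i) = al.
Proof. exact: fsfun_with_id. Qed.

Lemma upd_upd al i n m : upd (upd al i n) i m = upd al i m.
Proof. by apply/fsfunP => j; rewrite !updE; case: eqP. Qed.

Definition msum (V : zmodType) (g : I -> V) al : V := \sum_(i <- finsupp al) g i *+ al i.

Lemma msumE (V : zmodType) (g : I -> V) al r : uniq r ->
  {subset finsupp al <= r} -> msum g al = \sum_(i <- r) g i *+ al i.
Proof.
move=> ur sr; apply/esym/big_widen_seq => //; first exact: fset_uniq.
by move=> i /fsfun_dflt ->.
Qed.

Lemma msum_upd (V : zmodType) (g : I -> V) al i n :
  msum g (upd al i n) + g i *+ al i = msum g al + g i *+ n.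
Proof.
pose r := undup (i :: finsupp al).
have ur : uniq r by exact: undup_uniq.
have ir : i \in r by rewrite mem_undup inE eqxx.
rewrite (@msumE _ _ al r)//; last by move=> j; rewrite mem_undup inE orbC => ->.
rewrite (@msumE _ _ (upd al i n) r)//; last first.
  move=> j; rewrite mem_finsupp updE mem_undup in_cons mem_finsupp.
  by case: (j == i).
rewrite !(bigD1_seq i)//= updE eqxx.
under eq_bigr => j /negbTE ji do rewrite updE ji.
by rewrite addrAC [RHS]addrAC; congr (_ + _); exact: addrC.
Qed.

Lemma msizeE al r : uniq r -> {subset finsupp al <= r} ->
  msize al = (\sum_(i <- r) al i)%N.
Proof.
move=> ur sr; rewrite [RHS](bigID (mem (finsupp al)))/= [X in (_ + X)%N]big1.
  rewrite addn0 -[RHS]big_filter; apply: perm_big; apply: uniq_perm.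
  - exact: fset_uniq.
  - exact: filter_uniq.
  by move=> i; rewrite mem_filter/=; case: (boolP (i \in finsupp al)) => // /sr.
by move=> i /fsfun_dflt.
Qed.

Lemma msize_upd al i n : (msize (upd al i n) + al i = msize al + n)%N.
Proof.
pose r := undup (i :: finsupp al).
have ur : uniq r by exact: undup_uniq.
have ir : i \in r by rewrite mem_undup inE eqxx.
rewrite (@msizeE al r)//; last by move=> j; rewrite mem_undup inE orbC => ->.
rewrite (@msizeE (upd al i n) r)//; last first.
  move=> j; rewrite mem_finsupp updE mem_undup in_cons mem_finsupp.
  by case: (j == i).
rewrite !(bigD1_seq i)//= updE eqxx.
under eq_bigr => j /negbTE ji do rewrite updE ji.
by rewrite addnAC [RHS]addnAC; congr addn; exact: addnC.
Qed.

Lemma msize_eq0 al : msize al = 0%N -> forall i, al i = 0%N.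
Proof.
move=> h i; have [|/fsfun_dflt//] := boolP (i \in finsupp al).
move=> ia; apply/eqP; rewrite -leqn0; rewrite -[X in (_ <= X)%N]h.
rewrite /msize (bigD1_seq i)//=; last exact: fset_uniq.
exact: leq_addr.
Qed.

Lemma mpow_sorted (F : fieldType) (B : algType F) (d : I -> B) al s :
  sorted <=%O s -> uniq s -> {subset finsupp al <= s} ->
  mpow d al = \prod_(i <- s) d i ^+ al i.
Proof.
move=> ss us fs; rewrite /mpow.
have -> : sort <=%O (finsupp al) = [seq i <- s | i \in finsupp al].
  apply: (sorted_eq le_trans le_anti).
  - exact: sort_sorted le_total _.
  - exact: sorted_filter le_trans _ _ ss.
  apply: uniq_perm; rewrite ?sort_uniq ?filter_uniq ?fset_uniq//.
  by move=> i; rewrite mem_sort mem_filter; case: (boolP (i \in finsupp al)) => // /fs ->.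
rewrite big_filter big_mkcond/=; apply: eq_bigr => i _.
by case: ifPn => // /fsfun_dflt ->; rewrite expr0.
Qed.

End MultiIndex.

Lemma natr_neq0 (F : fieldType) (n : nat) : (0 < n)%N ->
  (forall p, p \in [pchar F] -> (n <= p.-1)%N) -> (n%:R : F) != 0.
Proof.
move=> n0 h; rewrite natf_neq0_pchar; apply/pnatP => // p pp pn.
apply/negP => pF; have := leq_trans (dvdn_leq n0 pn) (h p pF).
by have := prime_gt0 pp; case: (p) => // k _; rewrite ltnn.
Qed.

(** * The p-th power of an even derivation *)

Section PowerDerivation.
Context {F : fieldType} {Gamma : zmodType} {eps : Gamma -> Gamma -> F}.
Context {A : algType F} {gr : Gamma -> set A} {D : set (endo A)}.
Context {S : setting eps gr D}.
Local Notation egr := (endo_gr gr).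

Lemma endo_gr_exp l (d : endo A) n : egr l d -> egr (l *+ n) (d ^+ n).
Proof.
move=> gd; elim: n => [|n IH]; first by rewrite expr0 mulr0n; exact: endo_gr1.
by rewrite exprS mulrS; exact: endo_grM.
Qed.

Lemma epsMn l m n : eps (l *+ n) m = eps l m ^+ n.
Proof.
elim: n => [|n IH]; first by rewrite mulr0n expr0 eps0l.
by rewrite mulrS epsDl IH exprS.
Qed.

Lemma epsMnr l m n : eps l (m *+ n) = eps l m ^+ n.
Proof.
elim: n => [|n IH]; first by rewrite mulr0n expr0 eps0r.
by rewrite mulrS epsDr IH exprS.
Qed.

(** The operators T -> d T and T -> T d on End(A) commute, so the Frobenius
    identity applies to their combination T -> d T - eps T d. On left
    multiplications it acts as d, which gives the Leibniz rule for d ^+ p. *)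
Lemma Der_Frobenius p l (d : endo A) : p \in [pchar F] -> eps l l = 1 ->
  Der_gr eps gr l d -> Der_gr eps gr (l *+ p) (d ^+ p).
Proof.
move=> pF el hd; split; first exact: endo_gr_exp (Der_gr_endo hd).
move=> m n a b ga gb.
have rl : is_endo (fun T : endo A => T * d).
  by apply/asboolP => c u v; rewrite mulrDl -scalerAl.
pose x : endo (endo A) := lmul d; pose y : endo (endo A) := Endo rl.
have xy : GRing.comm x y by apply: endoP => T; rewrite /= mulrA.
pose e := eps l m.
have pE : p \in [pchar (endo (endo A))].
  apply/andP; split; first by case/andP: pF.
  by rewrite -scaler_nat; case/andP: pF => _ /eqP ->; rewrite scale0r.
have cxy : GRing.comm x (- (e *: y)).
  by rewrite /GRing.comm mulrN mulNr -scalerAl -scalerAr xy.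
have := pFrobenius_autD_comm pE cxy; rewrite !pFrobenius_autE.
have -> : (- (e *: y)) ^+ p = - ((e ^+ p) *: y ^+ p).
  rewrite -scaleN1r exprZn exprZn -[RHS]scaleN1r; congr (_ *: _).
  by rewrite -pFrobenius_autE pFrobenius_autN ?pFrobenius_aut1.
have zE k c : gr (l *+ k + m) c -> (x - e *: y) (lmul c) = lmul (d c).
  move=> gc; apply/eqP; rewrite -subr_eq0; apply/eqP.
  rewrite endo_addE endo_oppE endo_scaleE /= (der_lmul hd gc) epsDr epsMnr el expr1n mul1r.
  by rewrite -/e addrK subrr.
have zn k : ((x - e *: y) ^+ k) (lmul a) = lmul ((d ^+ k) a) /\ gr (l *+ k + m) ((d ^+ k) a).
  elim: k => [|k [IH gk]]; first by rewrite !expr0 mulr0n add0r.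
  rewrite !exprS !endo_mulE IH (zE k)//; split=> //.
  by rewrite mulrS -addrA; apply: (Der_gr_endo hd).
have xn (k : nat) (T : endo A) : (x ^+ k) T = d ^+ k * T.
  elim: k => [|k IH]; first by rewrite !expr0 mul1r.
  by rewrite !exprS endo_mulE IH /= mulrA.
have yn (k : nat) (T : endo A) : (y ^+ k) T = T * d ^+ k.
  elim: k => [|k IH]; first by rewrite !expr0 mulr1.
  by rewrite exprS endo_mulE IH exprSr mulrA.
move=> /(congr1 (fun f : endo (endo A) => f (lmul a))).
rewrite (zn p).1 endo_addE endo_oppE endo_scaleE xn yn.
move=> /(congr1 (fun f : endo A => f b)).
rewrite endo_addE endo_oppE endo_scaleE /= => ->.
by rewrite epsMn -/e subrK.
Qed.

End PowerDerivation.

(** * Monomials in an F_1-basis of the derivations in F_1[D] *)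

Section Basis.
Context {F : fieldType} {Gamma : zmodType} {eps : Gamma -> Gamma -> F}.
Context {A : algType F} {gr : Gamma -> set A} {D : set (endo A)}.
Context {S : setting eps gr D}.
Implicit Types (l m : Gamma) (a b x y : A) (X Y Z : endo A) (n k : nat).
Local Notation hD := (hD eps gr D).
Local Notation egr := (endo_gr gr).
Local Notation ccomm := (ccomm eps).
Local Notation br := (color_bracket eps egr).
Local Notation W := (W eps gr D).

Let gA := grA (S := S).
Let gE := grE (S := S).
Let Ws := @W_sub F Gamma eps A gr D.
Let hs0 := @hspan_subsp F (endo A) Gamma egr.

Variables (disp : Order.disp_t) (I : orderType disp).
Variables (d : I -> endo A) (dg : I -> Gamma).
Hypothesis basis : homogeneous_F1_basis eps gr D d dg.
Implicit Types (al be : multi_index I) (i j : I) (r s : seq I).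

Local Notation J := (calJ eps dg).
Local Notation mp := (mpow d).

Lemma basis_F1D i : F1D D (d i).
Proof. by have [/(_ i)[[]]] := basis. Qed.

Lemma basis_gr i : egr (dg i) (d i).
Proof. by have [/(_ i)[]] := basis. Qed.

Lemma basis_Der i : Der_gr eps gr (dg i) (d i).
Proof.
have [/(_ i)[[hD _] gd] _ _] := basis.
by rewrite -(hcomp_id gE gd); exact: Der_comp.
Qed.

Lemma basis_comm i j : ccomm (dg i) (d i) (dg j) (d j).
Proof. by apply: F1D_comm; [exact: basis_F1D|exact: basis_gr|exact: basis_F1D|exact: basis_gr]. Qed.

Lemma basis_commD i m e : hD m e -> ccomm m e (dg i) (d i).
Proof.
move=> he; apply: F1D_comm; [|exact: hD_endo he|exact: basis_F1D|exact: basis_gr].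
by apply: F1D_D; case: he.
Qed.

Lemma basis_indep s : uniq s -> hom_indep (D := D) (gr := gr) d dg s.
Proof.
move=> us u k hu E i si; have [_ _ h] := basis.
by apply: (h s u us _ E) => // j; have [] := hu j.
Qed.

Lemma D_calD m e : hD m e -> calD eps gr D e.
Proof.
move=> [De he]; split; last exact: F1D_D.
by apply: sub_span; exists m.
Qed.

Lemma basis_odd i : eps (dg i) (dg i) = -1 -> d i * d i = 0.
Proof.
move=> e1; have /eqP : d i * d i = eps (dg i) (dg i) *: (d i * d i) by exact: basis_comm.
rewrite e1 scaleN1r -addr_eq0 -mulr2n -scaler_nat.
by rewrite scaler_eq0 (negbTE two_neq0) => /eqP.
Qed.

Lemma F1D_exp X n : F1D D X -> F1D D (X ^+ n).
Proof.
move=> hX; elim: n => [|n IH]; first by rewrite expr0; exact: F1D_1.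
by rewrite exprS; exact: F1D_M.
Qed.

Lemma basis_pow_p p i : p \in [pchar F] -> eps (dg i) (dg i) = 1 ->
  calD eps gr D (d i ^+ p).
Proof.
move=> pF e1; split; last by apply: F1D_exp; exact: basis_F1D.
by apply: sub_span; exists (dg i *+ p) => //; exact: Der_Frobenius e1 (basis_Der i).
Qed.

Definition mdeg al : Gamma := msum dg al.

(** The list s is independent of the exponents, so that one list serves for an
    exponent and for the smaller ones that come from it. *)
Definition mon s (al : I -> nat) : endo A := \prod_(i <- s) d i ^+ al i.

Lemma mon_eq s (al be : I -> nat) : {in s, al =1 be} -> mon s al = mon s be.
Proof.
move=> h; rewrite /mon big_seq [RHS]big_seq; apply: eq_bigr => i /h ->; by [].
Qed.

Lemma mon_cons i s (al : I -> nat) : mon (i :: s) al = d i ^+ al i * mon s al.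
Proof. by rewrite /mon big_cons. Qed.

Lemma mon_gr s (al : I -> nat) : egr (\sum_(i <- s) dg i *+ al i) (mon s al).
Proof.
elim: s => [|i s IH]; first by rewrite /mon !big_nil; exact: endo_gr1.
rewrite mon_cons big_cons; apply: endo_grM => //.
by apply: endo_gr_exp; exact: basis_gr.
Qed.

Lemma mon_F1D s (al : I -> nat) : F1D D (mon s al).
Proof.
elim: s => [|i s IH]; first by rewrite /mon big_nil; exact: F1D_1.
by rewrite mon_cons; apply: F1D_M => //; apply: F1D_exp; exact: basis_F1D.
Qed.

Lemma mpow_mon al s : sorted <=%O s -> uniq s -> {subset finsupp al <= s} ->
  mp al = mon s al.
Proof. exact: mpow_sorted. Qed.

Lemma mpow_gr al : egr (mdeg al) (mp al).
Proof.
rewrite /mdeg (@msumE _ _ _ _ al (sort <=%O (finsupp al))) ?sort_uniq ?fset_uniq//; first exact: mon_gr.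
by move=> i; rewrite mem_sort.
Qed.

Lemma mpow_F1D al : F1D D (mp al).
Proof. exact: mon_F1D. Qed.

Lemma mpow_AD al : AD D (mp al).
Proof. by apply: F1D_AD; exact: mpow_F1D. Qed.

Definition support_seq r : seq I := sort <=%O (undup r).

Lemma support_seqP r : [/\ sorted <=%O (support_seq r), uniq (support_seq r) &
  forall i, (i \in support_seq r) = (i \in r)].
Proof.
split; first exact: sort_sorted le_total _.
  by rewrite sort_uniq undup_uniq.
by move=> i; rewrite mem_sort mem_undup.
Qed.

(** Monomials color-commute, so a power can be moved to the front at the cost of
    a nonzero scalar. *)
Lemma mon_extract s (al : I -> nat) (be : I -> nat) i : uniq s -> i \in s ->
  be i = 0%N -> (forall j, j != i -> be j = al j) ->
  exists2 c : F, c != 0 & mon s al = c *: (d i ^+ al i * mon s be).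
Proof.
move=> + + bi bj; elim: s => // j s IH /= /andP[js us]; rewrite inE => /orP[/eqP ij|si].
  rewrite -{}ij in js *; exists 1; first exact: oner_neq0.
  rewrite !mon_cons bi expr0 mul1r scale1r; congr (_ * _); apply: mon_eq => k ks.
  by rewrite bj//; apply: contraNneq js => <-.
have [c c0 E] := IH us si.
have ij : j != i by apply: contraNneq js => ->.
exists (c * eps (dg j *+ al j) (dg i *+ al i)); first by rewrite mulf_neq0 ?eps_neq0.
rewrite !mon_cons E (bj _ ij) -scalerAr (mulrA (d j ^+ al j)).
have : ccomm (dg j *+ al j) (d j ^+ al j) (dg i *+ al i) (d i ^+ al i).
  by apply: F1D_comm; try (apply: F1D_exp; exact: basis_F1D); apply: endo_gr_exp; exact: basis_gr.
by move=> ->; rewrite -scalerAl scalerA (mulrA (d i ^+ al i)).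
Qed.

Lemma mpow_extract al i :
  exists2 c : F, c != 0 & mp al = c *: (d i ^+ al i * mp (upd al i 0)).
Proof.
have [ss us sE] := support_seqP (i :: finsupp al); set s := support_seq _ in ss us sE.
have [|||c c0 E] := @mon_extract s al (upd al i 0) i us.
- by rewrite sE inE eqxx.
- by rewrite updE eqxx.
- by move=> j /negbTE ji; rewrite updE ji.
exists c => //; rewrite (mpow_mon ss us) ?E; last by move=> j ja; rewrite sE inE ja orbT.
rewrite (mpow_mon ss us)// => j; rewrite mem_finsupp updE sE inE mem_finsupp.
by case: (j == i).
Qed.

Lemma mpow_incr al i :
  exists2 c : F, c != 0 & d i * mp al = c *: mp (upd al i (al i).+1).
Proof.
have [c c0 E] := mpow_extract al i.
have [c' c'0] := mpow_extract (upd al i (al i).+1) i.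
rewrite updE eqxx upd_upd => E'.
exists (c / c'); first by rewrite mulf_neq0// invr_eq0.
by rewrite E' scalerA -mulrA mulVf// mulr1 E -scalerAr mulrA exprS.
Qed.

Lemma calJ_upd al i n : J al -> (n <= al i)%N -> J (upd al i n).
Proof.
move=> [hp ho] nai; split=> [p pF j|j jo]; rewrite updE; case: (eqVneq j i) => [ji|_].
- exact: leq_trans nai (hp _ pF i).
- exact: hp.
- by apply: leq_trans nai (ho i _); rewrite -ji.
- exact: ho.
Qed.

(** With the strict bound, mpows 0 is the zero space; it is the space of
    remainders for exponents of size at most 1. *)
Definition mpows n : set (endo A) :=
  span [set X | exists a al, [/\ J al, (msize al < n)%N & X = lmul a * mp al]].

Lemma mpows_sub n : subsp (mpows n). Proof. exact: span_subsp. Qed.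

Lemma mpows_le n n' : (n <= n')%N -> mpows n `<=` mpows n'.
Proof.
move=> nn; apply: span_mono => X [a [al [Ja sa ->]]]; exists a, al; split=> //.
exact: leq_trans nn.
Qed.

Lemma mpows0 X : mpows 0 X -> X = 0.
Proof.
by apply: (span_min (subsp_set0 _)) => Y [a [al []]]; rewrite ltn0.
Qed.

Lemma mpows_in n a al : J al -> (msize al < n)%N -> mpows n (lmul a * mp al).
Proof. by move=> Ja sa; apply: sub_span; exists a, al. Qed.

Lemma mpows_lmul n a X : mpows n X -> mpows n (lmul a * X).
Proof.
apply: (span_min (U := [set X | mpows n (lmul a * X)])).
  by apply: subsp_preim (span_subsp _) => c u v; rewrite mulrDr scalerAr.
move=> _ [b [al [Ja sa ->]]]; rewrite /= mulrA -lmulM; exact: mpows_in.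
Qed.

Lemma mpows_basis_from n i X :
  (forall be, J be -> (msize be < n)%N -> mpows (msize be).+2 (d i * mp be)) ->
  mpows n X -> mpows n.+1 (d i * X).
Proof.
move=> h; apply: (span_min (U := [set X | mpows n.+1 (d i * X)])).
  by apply: subsp_preim (span_subsp _) => c u v; rewrite mulrDr scalerAr.
move=> _ [a [be [Jb sb ->]]].
apply: (hom_ind (P := [set a | mpows n.+1 (d i * (lmul a * mp be))])).
  by apply: subsp_preim (span_subsp _) => c u v; rewrite linearP/= mulrDl mulrDr -scalerAl -scalerAr.
move=> m {}a ga; rewrite /= mulrA (der_lmul (basis_Der i) ga) mulrDl.
apply: (subspD (mpows_sub _)); first by apply: mpows_in => //; exact: leqW.
rewrite -scalerAl -mulrA; apply: (subspZ _ (mpows_sub _)); apply: mpows_lmul.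
by apply: (@mpows_le (msize be).+2) => //; exact: h.
Qed.

(** If alpha + e_i is not in J, there are two cases. Either d_i is odd and occurs
    in d^alpha, and the product is 0; or alpha_i = p - 1, and d_i^p is a
    derivation in F_1[D], that is, a combination of basis elements, so that the
    product has smaller order. *)
Lemma basis_mpow al i : J al -> mpows (msize al).+2 (d i * mp al).
Proof.
have [n] := ubnP (msize al); elim: n al i => // n IH al i; rewrite ltnS => sn Ja.
have [c c0 E] := mpow_incr al i.
have s1 : msize (upd al i (al i).+1) = (msize al).+1.
  apply/eqP; rewrite -(eqn_add2r (al i)) msize_upd addnS addSn; exact: eqxx.
have [Ju|nJu] := pselect (J (upd al i (al i).+1)).
  rewrite E; apply: (subspZ _ (mpows_sub _)); rewrite -[mp _]mul1r -lmul1.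
  by apply: mpows_in => //; rewrite s1.
have [hp ho] := Ja.
have [e cE0 eE] := mpow_extract al i.
have [o|o] := @epsll _ _ _ _ _ _ S (dg i); last first.
  have ai : (0 < al i)%N.
    rewrite lt0n; apply/eqP => ai0; apply: nJu; split=> [p pF j|j jo]; rewrite updE; case: eqP => [_|_].
    - rewrite ai0; have := prime_gt1 (pcharf_prime pF); by case: (p) => // -[].
    - exact: hp.
    - by rewrite ai0.
    - exact: ho.
  rewrite eE -scalerAr mulrA -(prednK ai) exprS mulrA (basis_odd o) !mul0r scaler0.
  exact: subsp0 (mpows_sub _).
have [p pF pa] : exists2 p, p \in [pchar F] & (al i).+1 = p.
  apply: contrapT => h; apply: nJu; split=> [p pF j|j jo]; rewrite updE; case: eqP => [ji|_].
  - rewrite ltn_neqAle (hp _ pF) andbT; apply/eqP => E1; apply: h; exists p => //.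
    by rewrite E1 prednK// prime_gt0 //; exact: pcharf_prime pF.
  - exact: hp.
  - by exfalso; move: jo; rewrite /Gamma_minus/= ji o => /esym; apply: (@odd_neq_even _ _ _ _ _ _ S).
  - exact: ho.
have [_ gen _] := basis.
have [s [u [hu uE]]] := gen _ (basis_pow_p pF o).
rewrite eE -scalerAr mulrA -exprS pa uE; apply: (subspZ _ (mpows_sub _)).
rewrite mulr_suml; apply: subsp_sum_seq => [|j _]; first exact: mpows_sub.
rewrite -mulrA; apply: mpows_lmul.
have Ju0 : J (upd al i 0) by exact: calJ_upd.
have s0 : (msize (upd al i 0) < msize al)%N.
  have := msize_upd al i 0; rewrite addn0 => <-.
  rewrite -addn1 leq_add2l; have := prime_gt1 (pcharf_prime pF).
  by rewrite -pa ltnS.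
apply: (@mpows_le (msize al).+1) => //; apply: mpows_basis_from => [be Jb sb|].
  by apply: IH => //; exact: leq_trans sb sn.
by rewrite -[mp _]mul1r -lmul1; exact: mpows_in.
Qed.

Lemma mpows_basis n i X : mpows n X -> mpows n.+1 (d i * X).
Proof. by apply: mpows_basis_from => be Jb _; exact: basis_mpow. Qed.

Lemma calJ0 : J [fsfun].
Proof. by split=> *; rewrite fsfunE. Qed.

Lemma msize_fsfun0 : msize ([fsfun] : multi_index I) = 0%N.
Proof. by rewrite /msize big1_seq// => i; rewrite fsfunE. Qed.

Lemma mpow0 : mp [fsfun] = 1.
Proof.
rewrite (@mpow_mon _ [::])//; first by rewrite /mon big_nil.
by move=> i; rewrite mem_finsupp fsfunE.
Qed.

Lemma mpows1 : mpows 1 1.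
Proof.
by rewrite -mpow0 -[mp _]mul1r -lmul1; apply: mpows_in; [exact: calJ0|rewrite msize_fsfun0].
Qed.

Lemma mpows_AD X : AD D X -> exists n, mpows n X.
Proof.
pose P : set (endo A) := [set X | exists n, mpows n X].
have Ps : subsp P.
  split=> [|c Y Z [n hY] [n' hZ]]; first by exists 0%N; exact: subsp0 (mpows_sub _).
  exists (maxn n n'); have [_] := mpows_sub (maxn n n'); apply.
    exact: (mpows_le (leq_maxl _ _) hY).
  exact: (mpows_le (leq_maxr _ _) hZ).
rewrite (AD_span (S := S)); apply: (span_min Ps) => Y [hY [l gY]].
apply: (AD_ind (P := fun=> P) _ _ _ _ hY gY) => //.
- by exists 1%N; exact: mpows1.
- by move=> m k a Z _ _ _ [n hZ]; exists n; exact: mpows_lmul.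
move=> m k e Z he _ _ [n hZ]; have [_ gen _] := basis.
have [s [u [hu ->]]] := gen _ (D_calD he).
exists n.+1; rewrite mulr_suml; apply: subsp_sum_seq => [|j _]; first exact: mpows_sub.
by rewrite -mulrA; apply: mpows_lmul; exact: mpows_basis.
Qed.

(** * Leading terms of brackets with A *)

(** A triple (c, j, Z) of q stands for the term c (d_j x) Z of [Y, x]; the scalar
    eps (l - dg j) m comes from moving x to the left past the other factors of
    Y. *)
Definition lead k l Y (q : seq (F * I * endo A)) : Prop :=
  (forall t, t \in q -> mpows k t.2) /\ forall m x, gr m x ->
  mpows k.-1 (br Y (lmul x) -
    \sum_(t <- q) (t.1.1 * eps (l - dg t.1.2) m) *: (lmul (d t.1.2 x) * t.2)).

Lemma mpows_basis_pred k i X : mpows k.-1 X -> mpows k (d i * X).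
Proof.
case: k => [|k] hX; last exact: mpows_basis.
by rewrite (mpows0 hX) mulr0; exact: subsp0 (mpows_sub _).
Qed.

Lemma mpows_exp k n i X : mpows k X -> mpows (n + k) (d i ^+ n * X).
Proof.
move=> hX; elim: n => [|n IH]; first by rewrite expr0 mul1r.
by rewrite exprS -mulrA addSn; exact: mpows_basis.
Qed.

Lemma lead_step k l Y q i : egr l Y -> mpows k.+1 Y -> lead k l Y q ->
  lead k.+1 (dg i + l) (d i * Y)
    ((1, i, Y) :: [seq (t.1.1 * eps (dg i) (dg t.1.2), t.1.2, d i * t.2) | t <- q]).
Proof.
move=> gY hY [hq lq]; split.
  move=> t; rewrite inE => /orP[/eqP -> //|/mapP[u uq ->]] /=.
  by apply: mpows_basis; exact: hq.
move=> m x gx /=; rewrite big_cons big_map /= mul1r [dg i + l]addrC addrK.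
rewrite (br_mull (basis_gr i) gY (lmul_gr gx)) (br_der (basis_Der i) gx).
rewrite opprD addrA addrK.
pose T1 (t : F * I * endo A) := (t.1.1 * eps (l - dg t.1.2) m) *: (lmul (d t.1.2 x) * t.2).
pose T2 (t : F * I * endo A) := (t.1.1 * eps (l - dg t.1.2) m) *: (lmul (d i (d t.1.2 x)) * t.2).
have E (t : F * I * endo A) :
    (t.1.1 * eps (dg i) (dg t.1.2) * eps (l + dg i - dg t.1.2) m) *:
      (lmul (d t.1.2 x) * (d i * t.2)) = d i * T1 t - T2 t.
  rewrite /T1 /T2 -scalerAr (mulrA (d i)) (der_lmul (basis_Der i) (basis_gr t.1.2 gx)).
  rewrite mulrDl scalerDr [X in _ = X - _]addrC addrK -scalerAl scalerA -(mulrA (lmul _)); congr (_ *: _).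
  by rewrite (addrAC l) !(epsDl (l - _)) epsDr; ring.
under eq_bigr do rewrite E.
rewrite sumrB -mulr_sumr opprB addrC -addrA -mulrN -mulrDr.
apply: (subspD (mpows_sub _)).
  apply: subsp_sum_seq => [|t tq]; first exact: mpows_sub.
  by apply: (subspZ _ (mpows_sub _)); apply: mpows_lmul; exact: hq.
by apply: mpows_basis_pred; rewrite addrC; exact: lq.
Qed.

Lemma lead_ext k l Y q q' : lead k l Y q ->
  (forall t, t \in q' -> mpows k t.2) ->
  (forall m x, \sum_(t <- q) (t.1.1 * eps (l - dg t.1.2) m) *: (lmul (d t.1.2 x) * t.2) =
   \sum_(t <- q') (t.1.1 * eps (l - dg t.1.2) m) *: (lmul (d t.1.2 x) * t.2)) ->
  lead k l Y q'.
Proof.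
by move=> [_ lq] hq' E; split=> // m x gx; rewrite -E; exact: lq.
Qed.

(** The n factors d_i of the block contribute the same term, up to powers of
    eps (dg i) (dg i); these terms add up to n times the first one when d_i is
    even, and for n = 1. *)
Lemma lead_block k l Y q i n : egr l Y -> mpows k.+1 Y -> lead k l Y q ->
  (0 < n)%N -> ((1 < n)%N -> eps (dg i) (dg i) = 1) ->
  lead (n + k) (dg i *+ n + l) (d i ^+ n * Y)
    ((n%:R, i, d i ^+ n.-1 * Y) ::
     [seq (t.1.1 * eps (dg i) (dg t.1.2) ^+ n, t.1.2, d i ^+ n * t.2) | t <- q]).
Proof.
move=> gY hY lq; case: n => // n _; elim: n => [|n IH] ein.
  by rewrite /= expr0 mul1r; exact: (lead_step i gY hY lq).
have e1 := ein isT; have {IH}lq' := IH (fun _ => e1).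
have gY' : egr (dg i *+ n.+1 + l) (d i ^+ n.+1 * Y).
  by apply: endo_grM => //; apply: endo_gr_exp; exact: basis_gr.
have hY' : mpows (n.+1 + k).+1 (d i ^+ n.+1 * Y) by rewrite -addnS; exact: mpows_exp.
have := lead_step i gY' hY' lq'.
rewrite addrA -mulrS -addSn mulrA -exprS => h.
apply: lead_ext (h) _ _.
  move=> t; rewrite inE => /orP[/eqP ->|/mapP[u uq ->]] /=.
    by rewrite -mulrA -exprS in h *; rewrite addSn.
  by have [hq _] := lq; apply: mpows_exp; apply: hq.
move=> m x; rewrite !big_cons !big_map /= addrA; congr (_ + _).
  rewrite e1 mulr1 (mulrA (d i)) -exprS -scalerDl -mulrDl; congr ((_ * _) *: _).
by apply: eq_bigr => t _ /=; rewrite -(mulrA t.1.1) -exprSr (mulrA (d i)) -exprS.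
Qed.

Definition pred_at (al : I -> nat) j i := if i == j then (al i).-1 else al i.

Lemma lead_mon s (al : I -> nat) : uniq s ->
  (forall i, (1 < al i)%N -> eps (dg i) (dg i) = 1) ->
  exists c : I -> F, [/\ forall j, c j != 0,
    mpows (\sum_(i <- s) al i).+1 (mon s al) &
    lead (\sum_(i <- s) al i) (\sum_(i <- s) dg i *+ al i) (mon s al)
      [seq ((al j)%:R * c j, j, mon s (pred_at al j)) | j <- s & (0 < al j)%N]].
Proof.
move=> us e1; elim: s us => [_|i s IH /= /andP[iNs us]].
  exists (fun=> 1); rewrite !big_nil /mon !big_nil; split=> [j||].
  - exact: oner_neq0.
  - exact: mpows1.
  split=> // m x gx; rewrite big_nil subr0 (brE endo_gr1 (lmul_gr gx)).
  by rewrite mul1r mulr1 eps0l scale1r subrr; exact: subsp0 (mpows_sub _).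
have [c [c0 hY lY]] := IH us.
have pred_i j : j \in s -> pred_at al j i = al i.
  by rewrite /pred_at => js; case: eqP => // ij; rewrite ij js in iNs.
have [ai0|ai] := posnP (al i).
  exists c; rewrite !big_cons mon_cons ai0 add0n mulr0n add0r expr0 mul1r; split=> //.
  have -> // : [seq ((al j)%:R * c j, j, mon (i :: s) (pred_at al j)) | j <- s & (0 < al j)%N] =
      [seq ((al j)%:R * c j, j, mon s (pred_at al j)) | j <- s & (0 < al j)%N].
  apply/eq_in_map => j; rewrite mem_filter => /andP[_ js].
  by rewrite mon_cons (pred_i _ js) ai0 expr0 mul1r.
exists (fun j => if j == i then 1 else c j * eps (dg i) (dg j) ^+ al i); split.
- by move=> j; case: (j == i); [exact: oner_neq0|]; rewrite mulf_neq0// expf_neq0// eps_neq0.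
- by rewrite big_cons mon_cons -addnS; exact: mpows_exp.
rewrite /= !big_cons mon_cons.
have := lead_block (mon_gr s al) hY lY ai (e1 i).
have -> : mon (i :: s) (pred_at al i) = d i ^+ (al i).-1 * mon s al.
  rewrite mon_cons {1}/pred_at eqxx; congr (_ * _); apply: mon_eq => j js.
  by rewrite /pred_at; case: eqP => // ji; rewrite -ji js in iNs.
rewrite eqxx mulr1 -map_comp.
congr lead; congr cons; apply/eq_in_map => j; rewrite mem_filter => /andP[_ js] /=.
rewrite mon_cons (pred_i _ js); case: eqP => [ji|_]; first by rewrite -ji js in iNs.
by rewrite mulrA.
Qed.

Lemma lead_mpow al r : J al -> uniq r -> {subset finsupp al <= r} ->
  exists2 c : I -> F, forall j, c j != 0 &
  forall m x, gr m x -> mpows (msize al).-1 (br (mp al) (lmul x) -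
    \sum_(j <- r | (0 < al j)%N) ((al j)%:R * c j * eps (mdeg al - dg j) m) *:
       (lmul (d j x) * mp (upd al j (al j).-1))).
Proof.
move=> [_ ho] ur sr; have [ss us sE] := support_seqP (finsupp al).
set s := support_seq _ in ss us sE.
have asupp : {subset finsupp al <= s} by move=> i; rewrite sE.
have e1 i : (1 < al i)%N -> eps (dg i) (dg i) = 1.
  move=> ai; have [//|o] := @epsll _ _ _ _ _ _ S (dg i).
  by have := ho i o; rewrite leqNgt ai.
have [c [c0 _ [_ lY]]] := lead_mon us e1; exists c => // m x gx.
have := lY m x gx; rewrite -(mpow_mon ss us asupp) -(msizeE us asupp).
rewrite -(msumE dg us asupp) big_map big_filter/=.
congr (mpows _ (_ - _)); rewrite -big_filter -[RHS]big_filter.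
rewrite (perm_big [seq j <- r | (0 < al j)%N])/=; last first.
  apply: uniq_perm; rewrite ?filter_uniq// => j; rewrite !mem_filter lt0n.
  case: eqVneq => //= aj; have ja : j \in finsupp al by rewrite mem_finsupp.
  by rewrite sE ja (sr _ ja).
apply: eq_bigr => j _; congr (_ *: (_ * _)).
rewrite (mpow_mon (al := upd al j (al j).-1) ss us); last first.
  move=> i; rewrite mem_finsupp updE; case: (eqVneq i j) => [->|ij].
    by move=> aj; apply: asupp; rewrite mem_finsupp; apply: contra aj => /eqP ->.
  by rewrite -mem_finsupp; exact: asupp.
by apply: mon_eq => i _; rewrite updE /pred_at; case: (eqVneq i j) => [->|].
Qed.




Lemma msize_pred al j : (0 < al j)%N -> (msize (upd al j (al j).-1)).+1 = msize al.
Proof.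
move=> aj; have := msize_upd al j (al j).-1.
by rewrite -{2}(prednK aj) addnS -addSn => /addIn.
Qed.

Lemma mdeg_pred al j : (0 < al j)%N -> mdeg (upd al j (al j).-1) = mdeg al - dg j.
Proof.
move=> aj; have := msum_upd dg al j (al j).-1.
rewrite -{2}(prednK aj) mulrSr addrA => E; apply/eqP; rewrite eq_sym subr_eq eq_sym; apply/eqP.
apply: (addIr (dg j *+ (al j).-1)); rewrite -E addrAC; by [].
Qed.

Lemma calJ_pred al j : J al -> J (upd al j (al j).-1).
Proof. by move=> Ja; apply: calJ_upd => //; exact: leq_pred. Qed.

Lemma br_mpow al m x : J al -> gr m x -> mpows (msize al) (br (mp al) (lmul x)).
Proof.
move=> Ja gx; have [c c0 h] := lead_mpow Ja (fset_uniq (finsupp al)) (fun _ => id).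
have := h m x gx; set T := (\sum_(j <- _ | _) _) => hT.
rewrite -[br _ _](subrK T); apply: (subspD (mpows_sub _)).
  exact: (mpows_le (leq_pred _) hT).
apply: subsp_sum => [|j aj]; first exact: mpows_sub.
apply: (subspZ _ (mpows_sub _)); apply: mpows_in; first exact: calJ_pred.
by rewrite -(msize_pred aj).
Qed.

Lemma exponent_neq0 al j : J al -> (0 < al j)%N -> ((al j)%:R : F) != 0.
Proof. by move=> [hp _] aj; apply: natr_neq0 => // p pF; exact: hp. Qed.

(** If beta = alpha + e_i is in J, the brackets of A d^beta with A lie in W and
    have d^alpha among their leading terms, from which [separate] extracts it.
    The lower terms are covered by induction on the size of alpha. *)
Lemma W_mpow (J' : set (multi_index I)) : J' `<=` J ->
  (forall al, J' al -> exists i, J (upd al i (al i).+1)) ->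
  (forall al be, J' al -> J be -> (msize be < msize al)%N -> J' be) ->
  forall al a, J' al -> W (lmul a * mp al).
Proof.
move=> J'J cover low al a Ja.
pose P := [set X | forall a, W (lmul a * X)].
have Ps : subsp P.
  split=> [b|c X Y hX hY b]; first by rewrite mulr0; exact: subsp0 Ws.
  by rewrite mulrDr -scalerAr; case: Ws => _; apply.
have Pl b X : P X -> P (lmul b * X) by move=> hX e; rewrite mulrA -lmulM.
suff : P (mp al) by exact.
have [n] := ubnP (msize al); elim: n al Ja => // n IH al Ja; rewrite ltnS => sn.
have [i Jb] := cover _ Ja; set be := upd al i _ in Jb.
have bi : be i = (al i).+1 by rewrite /be updE eqxx.
have bpos : (0 < be i)%N by rewrite bi.
have bal : upd be i (be i).-1 = al by rewrite bi /be upd_upd upd_id.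
have sb : msize be = (msize al).+1 by rewrite -(msize_pred bpos) bal.
have lowP X : mpows (msize al) X -> P X.
  apply: span_min => // Y [b [ga [Jg sg ->]]]; apply: Pl.
  by apply: IH; [exact: low Jg sg|exact: leq_trans sg sn].
have [c c0 lb] := lead_mpow Jb (fset_uniq (finsupp be)) (fun _ => id).
rewrite -bal; apply: (subspZ_eq (a := (be i)%:R * c i) Ps).
  by rewrite mulf_neq0//; exact: exponent_neq0.
pose Y j := ((be j)%:R * c j) *: mp (upd be j (be j).-1).
have := @separate _ _ eps A gr D S I d dg basis_Der basis_commD (finsupp be) P Y
  (fset_uniq _) (basis_indep (fset_uniq _)) Ps.
apply=> [m b X _|m x gx|]; [exact: Pl| |by rewrite mem_finsupp bi].
have PB : P (br (mp be) (lmul x)).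
  move=> b; apply: (hom_ind (P := [set b | W (lmul b * br (mp be) (lmul x))])).
    by apply: subsp_preim Ws => e u v; rewrite linearP/= mulrDl scalerAl.
  move=> k {}b gb; rewrite /= -(br_lmul_mul gb (mpow_gr be) gx).
  by apply: W_br; [apply: AD_M; [exact: AD_lmul|exact: mpow_AD]|exact: AD_lmul].
have := lb m x gx; rewrite sb /= => /lowP /(subspB Ps PB).
rewrite subKr => /(subspZ (eps (mdeg be) m)^-1 Ps); congr P.
rewrite big_mkcond/= scaler_sumr big_seq [RHS]big_seq; apply: eq_bigr => j jb.
have -> : (0 < be j)%N by rewrite lt0n -mem_finsupp.
rewrite /Y -scalerAr !scalerA; congr (_ *: _).
have e1 : eps (mdeg be) m != 0 by exact: eps_neq0.
have e2 : eps (dg j) m != 0 by exact: eps_neq0.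
by rewrite epsDl epsNl; field; rewrite e1 e2.
Qed.

(** * Independence of the monomials over A *)

Definition indep_lt n := forall (t : seq (multi_index I)) (a : multi_index I -> A),
  uniq t -> (forall al, al \in t -> J al /\ (msize al < n)%N) ->
  \sum_(al <- t) lmul (a al) * mp al = 0 -> forall al, al \in t -> a al = 0.

Lemma indep_list n (q : seq (A * multi_index I)) : indep_lt n ->
  (forall u, u \in q -> J u.2 /\ (msize u.2 < n)%N) ->
  \sum_(u <- q) lmul u.1 * mp u.2 = 0 ->
  forall be, \sum_(u <- q | u.2 == be) u.1 = 0.
Proof.
move=> ind hq E be; pose t := undup [seq u.2 | u <- q].
pose a be := \sum_(u <- q | u.2 == be) u.1.
have [bt|bt] := boolP (be \in t); last first.
  rewrite big1_seq// => u /andP[/eqP ub uq]; case/negP: bt.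
  by rewrite mem_undup -ub; exact: map_f.
apply: (ind t a) => //; first exact: undup_uniq.
  by move=> al; rewrite mem_undup => /mapP[u uq ->]; exact: hq.
rewrite -[RHS]E.
under eq_bigr do rewrite linear_sum mulr_suml.
rewrite (exchange_big_dep xpredT)//= big_seq [RHS]big_seq; apply: eq_bigr => u uq.
have ut : u.2 \in t by rewrite mem_undup; exact: map_f.
rewrite big_mkcond (bigD1_seq u.2)//= ?undup_uniq// eqxx big1 ?addr0// => al ne.
by rewrite eq_sym (negbTE ne).
Qed.

Lemma mpows_list n X : mpows n X -> exists q : seq (A * multi_index I),
  (forall u, u \in q -> J u.2 /\ (msize u.2 < n)%N) /\
  X = \sum_(u <- q) lmul u.1 * mp u.2.
Proof.
pose P := [set X | exists q : seq (A * multi_index I),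
  (forall u, u \in q -> J u.2 /\ (msize u.2 < n)%N) /\
  X = \sum_(u <- q) lmul u.1 * mp u.2].
apply: (span_min (U := P)) => [|Y [a [al [Ja sa ->]]]]; last first.
  by exists [:: (a, al)]; split=> [u|]; [rewrite inE => /eqP ->|rewrite big_seq1].
split=> [|c Y Z [q [hq ->]] [q' [hq' ->]]]; first by exists [::]; rewrite big_nil.
exists ([seq (c *: u.1, u.2) | u <- q] ++ q'); split=> [u|].
  by rewrite mem_cat => /orP[/mapP[v vq ->]|]; [exact: (hq _ vq)|exact: hq'].
rewrite big_cat big_map scaler_sumr /=; congr (_ + _); apply: eq_bigr => u _.
by rewrite linearZ/= scalerAl.
Qed.

Lemma hcomp_lmul_mul l (k : Gamma) a X : egr l X ->
  hcomp egr k (lmul a * X) = lmul (hcomp gr (k - l) a) * X.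
Proof.
move=> gX; pose P := [set a | hspan egr (lmul a * X) /\
  hcomp egr k (lmul a * X) = lmul (hcomp gr (k - l) a) * X].
suff : P a by case.
apply: (hom_ind (P := P)) => [|m {}a ga].
  split=> [|c u v [hu Eu] [hv Ev]]; split.
  - by rewrite linear0 mul0r; exact: subsp0 hs0.
  - rewrite linear0 mul0r (hcomp0 gE) (hcomp0 gA) linear0 mul0r; by [].
  - by rewrite linearP/= mulrDl -scalerAl; case: hs0 => _; apply.
  - rewrite linearP/= mulrDl -scalerAl (hcomp_linear gE)// Eu Ev.
    by rewrite (hcomp_linear gA) ?linearP/= ?mulrDl -?scalerAl//; exact: hspanA.
have gaX : egr (m + l) (lmul a * X) by exact: endo_grM (lmul_gr ga) gX.
split; first exact: egr_hspan gaX.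
rewrite (hcomp_hom gE _ gaX) (hcomp_hom gA _ ga) subr_eq.
by case: ifP => // _; rewrite linear0 mul0r.
Qed.

Lemma upd_inj al be j : (0 < al j)%N -> (0 < be j)%N ->
  upd al j (al j).-1 = upd be j (be j).-1 -> al = be.
Proof.
move=> aj bj E; apply/fsfunP => i; have := congr1 (fun f : multi_index I => f i) E.
rewrite !updE; case: eqVneq => [->|//] h.
by rewrite -(prednK aj) -(prednK bj) h.
Qed.

(** The bracket of a homogeneous relation of order n with x is a relation of
    order n - 1. By induction it is trivial: the coefficient of d^beta in it is
    an A-combination of the d_j x, so that [indep_over_A] applies. *)
Lemma indep_top n (t : seq (multi_index I)) (a : multi_index I -> A) (k : Gamma) :
  indep_lt n -> (0 < n)%N -> uniq t ->
  (forall al, al \in t -> J al /\ (msize al < n.+1)%N) ->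
  (forall al, gr (k - mdeg al) (a al)) ->
  \sum_(al <- t) lmul (a al) * mp al = 0 ->
  forall al, al \in t -> msize al = n -> a al = 0.
Proof.
move=> ind n0 ut ht ga E al0 al0t sal0.
pose r := undup (flatten [seq (finsupp al : seq I) | al <- t]).
have ur : uniq r by exact: undup_uniq.
have tr al : al \in t -> {subset finsupp al <= r}.
  move=> alt j ja; rewrite mem_undup; apply/flattenP.
  by exists (finsupp al : seq I) => //; apply/mapP; exists al.
have : forall al, exists c : I -> F, al \in t -> (forall j, c j != 0) /\
  forall m x, gr m x -> mpows (msize al).-1 (br (mp al) (lmul x) -
    \sum_(j <- r | (0 < al j)%N) ((al j)%:R * c j * eps (mdeg al - dg j) m) *:
       (lmul (d j x) * mp (upd al j (al j).-1))).
  move=> al; case: (boolP (al \in t)) => alt; last by exists (fun=> 0).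
  by have [c c0 h] := lead_mpow (ht _ alt).1 ur (tr _ alt); exists c.
move=> /choice[c cP].
have [j0 aj0] : exists j, (0 < al0 j)%N.
  apply: contrapT => h; move: n0; rewrite -sal0 /msize big1_seq// => j _.
  by apply/eqP; rewrite -leqn0 leqNgt; apply/negP => aj; apply: h; exists j.
pose be := upd al0 j0 (al0 j0).-1.
have sbe : (msize be).+1 = n by rewrite -sal0; exact: msize_pred.
pose cond (al : multi_index I) j := (0 < al j)%N && (upd al j (al j).-1 == be).
(* up to a scalar, the coefficient of d^be is the sum of the b j * d j x *)
pose b j := \sum_(al <- t | cond al j) ((al j)%:R * c al j) *: a al.
have j0r : j0 \in r by apply: (tr al0) => //; rewrite mem_finsupp -lt0n.
have b0 : b j0 = 0.
  apply: (indep_over_A basis_Der basis_commD ur (basis_indep ur) _ j0r) => m x gx.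
  pose g al j := (al j)%:R * c al j * eps (mdeg al - dg j) m.
  pose T al := \sum_(j <- r | (0 < al j)%N) g al j *: (lmul (d j x) * mp (upd al j (al j).-1)).
  have sum0 : \sum_(al <- t) lmul (a al) * br (mp al) (lmul x) = 0.
    have gT al : egr k (lmul (a al) * mp al).
      by rewrite -[k](subrK (mdeg al)); exact: endo_grM (lmul_gr (ga al)) (mpow_gr al).
    have := congr1 (fun Z => Z * lmul x - eps k m *: (lmul x * Z)) E.
    rewrite mul0r mulr0 scaler0 subr0 mulr_suml mulr_sumr scaler_sumr -sumrB => E2.
    rewrite -[RHS]E2; apply: eq_bigr => al _.
    by rewrite -(br_lmul_mul (ga al) (mpow_gr al) gx) (brE (gT al) (lmul_gr gx)).
  have lowS : mpows n.-1 (\sum_(al <- t) lmul (a al) * (br (mp al) (lmul x) - T al)).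
    apply: subsp_sum_seq => [|al alt]; first exact: mpows_sub.
    apply: mpows_lmul; have [_ s1] := ht _ alt; have [_ h] := cP _ alt.
    apply: (mpows_le _ (h _ _ gx)); by rewrite -!subn1; exact: leq_sub2r.
  have [q2 [hq2 E2]] := mpows_list lowS.
  pose allp : seq (multi_index I * I) := [seq (al, j) | al : multi_index I <- t, j : I <- r].
  pose pairs := [seq u : multi_index I * I <- allp | (0 < u.1 u.2)%N].
  pose q1 := [seq (g u.1 u.2 *: (a u.1 * d u.2 x), upd u.1 u.2 (u.1 u.2).-1) | u <- pairs].
  have bigpairs (V : nmodType) (G : multi_index I * I -> V) :
      \sum_(u <- pairs) G u = \sum_(al <- t) \sum_(j <- r | (0 < al j)%N) G (al, j).
    rewrite big_filter big_mkcond big_allpairs_dep/=; apply: eq_bigr => al _.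
    by rewrite [RHS]big_mkcond.
  have Eq1 : \sum_(u <- q1) lmul u.1 * mp u.2 = \sum_(al <- t) lmul (a al) * T al.
    rewrite big_map bigpairs; apply: eq_bigr => al _; rewrite mulr_sumr.
    apply: eq_bigr => j _ /=; rewrite linearZ/= lmulM -scalerAl -scalerAr mulrA.
    by [].
  have Etot : \sum_(u <- q1 ++ q2) lmul u.1 * mp u.2 = 0.
    rewrite big_cat/= Eq1 -E2 -big_split/= -[RHS]sum0; apply: eq_bigr => al _.
    by rewrite mulrBr addrC subrK.
  have hq u : u \in q1 ++ q2 -> J u.2 /\ (msize u.2 < n)%N.
    rewrite mem_cat => /orP[/mapP[v]|/hq2[Ju su]]; last first.
      by split=> //; apply: leq_trans su _; exact: leq_pred.
    rewrite mem_filter => /andP[v0 /allpairsP[[al j] /= [alt jr vE]]] ->.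
    rewrite vE /= in v0 *; have [Jal sal] := ht _ alt; split; first exact: calJ_pred.
    by rewrite -ltnS (msize_pred v0).
  have := indep_list ind hq Etot be; rewrite big_cat/= [X in _ + X]big1_seq ?addr0; last first.
    move=> u /andP[/eqP ub /hq2[_]]; rewrite ub -sbe /= ltnn; by [].
  rewrite big_map big_mkcond bigpairs => Eb.
  have eb0 : eps (mdeg be) m != 0 by exact: eps_neq0.
  apply: (scalerI eb0); rewrite scaler0 -[RHS]Eb scaler_sumr.
  rewrite [RHS](exchange_big_dep xpredT)//=; apply: eq_bigr => j _.
  rewrite mulr_suml scaler_sumr big_mkcondr/= [RHS]big_mkcond [LHS]big_mkcond/=.
  apply: eq_bigr => al _; rewrite /cond; case: ifP => //= aj; case: eqP => // ab.
  by rewrite -scalerAl scalerA /g -(mdeg_pred aj) ab mulrC.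
have c1 : cond al0 j0 by rewrite /cond aj0 eqxx.
move: b0; rewrite /b big_mkcond (bigD1_seq al0)//= c1 big1 ?addr0 => [/eqP|al ne]; last first.
  case: ifP => // /andP[aj /eqP ab].
  by move: ne; rewrite (upd_inj aj aj0 ab) eqxx.
have [Jal0 _] := ht _ al0t; have [c0 _] := cP _ al0t.
by rewrite scaler_eq0 mulf_eq0 (negbTE (exponent_neq0 Jal0 aj0)) (negbTE (c0 j0)) => /eqP.
Qed.

(** The components of a relation are relations, and [indep_top] removes the terms
    of a homogeneous one, from the highest order on. *)
Lemma mpow_indep n : indep_lt n.
Proof.
elim: n => [t a _ ht _ al /ht[]//|n IH t a ut ht E].
have hom (k : Gamma) (b : multi_index I -> A) : (forall al, gr (k - mdeg al) (b al)) ->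
    \sum_(al <- t) lmul (b al) * mp al = 0 -> forall al, al \in t -> b al = 0.
  move=> gb Eb.
  have top al : al \in t -> msize al = n -> b al = 0.
    have [n0 alt sal|n0] := posnP n; last exact: (indep_top IH n0 ut ht gb Eb).
    have al0 be : be \in t -> be = [fsfun].
      move=> bt; apply/fsfunP => i; rewrite fsfunE.
      by apply: msize_eq0; apply/eqP; have [_] := ht _ bt; rewrite n0 ltnS leqn0.
    move: Eb; rewrite (bigD1_seq al)//= big1_seq => [|be /andP[ne bt]]; last first.
      by move: ne; rewrite (al0 _ bt) (al0 _ alt) eqxx.
    rewrite addr0 {2}(al0 _ alt) mpow0 mulr1 => h.
    by apply: (@lmul_inj F A); rewrite h linear0.
  move=> al alt; have [/(top _ alt)//|sal] := eqVneq (msize al) n.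
  apply: (IH [seq be <- t | msize be != n] b); first exact: filter_uniq.
  - move=> be; rewrite mem_filter => /andP[bn bt]; have [Jb sb] := ht _ bt.
    by split=> //; rewrite ltn_neqAle bn -ltnS.
  - rewrite big_filter -[RHS]Eb [RHS](bigID (fun be => msize be != n))/= [X in _ = _ + X]big1_seq ?addr0//.
    by move=> be /andP[/negPn/eqP bn bt]; rewrite (top _ bt bn) linear0 mul0r.
  - by rewrite mem_filter sal.
move=> al alt.
have h l : hcomp gr l (a al) = 0.
  have := hom (l + mdeg al) (fun be => hcomp gr (l + mdeg al - mdeg be) (a be)) _ _ al alt.
  rewrite addrK; apply; first by move=> be; exact: hcompA_gr.
  have := congr1 (hcomp egr (l + mdeg al)) E; rewrite (hcomp0 gE) (hcomp_sum gE).
    move=> E'; rewrite -[RHS]E'; apply: eq_bigr => be _.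
    by rewrite (hcomp_lmul_mul _ _ (mpow_gr be)).
  move=> be _; apply: AD_hspan; apply: AD_M; [exact: AD_lmul|exact: mpow_AD].
by have [s [_ _ ->]] := hcompP gA (hspanA (a al)); rewrite big1// => l _.
Qed.

(** * W in terms of the monomials *)

(** If no alpha + e_i were in J, then alpha would bound all of J, which would
    be finite. *)
Lemma W_infinite : infinite_set J -> W = AD D.
Proof.
move=> infJ; apply/seteqP; split; first exact: W_AD.
have cover al : J al -> exists i, J (upd al i (al i).+1).
  move=> Jal; apply: contrapT => h; apply: infJ.
  have bound be : J be -> forall i, (be i <= al i)%N.
    move=> [bp bo] i; rewrite leqNgt; apply/negP => lt; apply: h; exists i.
    have [hp ho] := Jal.
    split=> [p pF j|j jo]; rewrite updE; case: (eqVneq j i) => [ji|_].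
    - exact: leq_trans lt (bp _ pF i).
    - exact: hp.
    - by apply: leq_trans lt (bo i _); rewrite -ji.
    - exact: ho.
  pose N := msize al.
  have alN i : (al i <= N)%N.
    have [ia|/fsfun_dflt -> //] := boolP (i \in finsupp al).
    by rewrite /N /msize (bigD1_seq i)//= ?leq_addr// fset_uniq.
  (* multi-indices bounded by al come from the finite type of functions g *)
  pose f (g : {ffun finsupp al -> 'I_N.+1}) : multi_index I :=
    [fsfun i : finsupp al => (g i : nat)].
  apply: (@sub_finite_set _ _ (f @` setT)); last by apply: finite_image; exact: finite_finset.
  move=> be /bound bb; exists [ffun i => inord (be (fsval i))] => //.
  apply/fsfunP => i; have [ia|ia] := boolP (i \in finsupp al).
    rewrite /f fsfun_ffun insubT /= ffunE inordK//= ltnS.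
    exact: leq_trans (bb i) (alN i).
  rewrite /f fsfun_ffun insubN//=; apply/esym/eqP; rewrite -leqn0.
  by have := bb i; rewrite (fsfun_dflt ia).
have := W_mpow (J' := J) (fun _ => id) cover (fun _ _ _ Jb _ => Jb) => WJ.
move=> X /mpows_AD[n]; apply: span_min => // Y [a [al [Jal _ ->]]].
exact: WJ.
Qed.

Lemma br_mpow_comm l X al : F1D D X -> egr l X -> br X (mp al) = 0.
Proof.
move=> hX gX; apply: (ccomm_br0 gX (mpow_gr al)).
by apply: F1D_comm => //; [exact: mpow_F1D|exact: mpow_gr].
Qed.

(** For u in F_1, [u d_i, b d^alpha] = u (d_i b) d^alpha, since u d_i and d^alpha
    both lie in F_1[D]. *)
Lemma calD_A_W a al : calD_A eps gr D a -> W (lmul a * mp al).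
Proof.
apply: (span_min (U := [set a | W (lmul a * mp al)])).
  by apply: subsp_preim Ws => c u v; rewrite linearP/= mulrDl scalerAl.
move=> _ [e he [b ->]]; have [_ gen _] := basis; have [s [u [hu ->]]] := gen _ he.
rewrite /= endo_sumE linear_sum mulr_suml; apply: subsp_sum_seq => // i _.
have F1h : hclosed gr (F1 D) by exact: F1_hclosed.
rewrite endo_mulE lmulE.
apply: (hom_sub (Q := [set v | W (lmul (v * d i b) * mp al)]) gA _ F1h _ _ (hu i)).
- by move=> *; exact: hspanA.
- by apply: subsp_preim Ws => c v w; rewrite mulrDl -scalerAl linearP/= mulrDl scalerAl.
move=> l v hv gv /=.
apply: (hom_ind (P := [set b | W (lmul (v * d i b) * mp al)])).
  apply: subsp_preim Ws => c x y.
  have -> : d i (c *: x + y) = c *: d i x + d i y by exact: linearP.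
  by rewrite mulrDr -scalerAr linearP/= mulrDl scalerAl.
move=> m {}b gb /=.
have gvd : egr (l + dg i) (lmul v * d i) by exact: endo_grM (lmul_gr gv) (basis_gr i).
have -> : lmul (v * d i b) * mp al = br (lmul v * d i) (lmul b * mp al).
  rewrite (br_mulr gvd (lmul_gr gb) (mpow_gr al)).
  rewrite (br_lmul_mul gv (basis_gr i) gb) (br_der (basis_Der i) gb) -lmulM.
  rewrite (br_mpow_comm _ _ gvd) ?mulr0 ?scaler0 ?addr0//.
  by apply: F1D_M; [exact: F1D_lmul|exact: basis_F1D].
apply: W_br.
  by apply: AD_M; [exact: AD_lmul|apply: F1D_AD; exact: basis_F1D].
by apply: AD_M; [exact: AD_lmul|exact: mpow_AD].
Qed.

(** Brackets with A have order less than that of d^gamma, and brackets with D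
    differentiate the coefficient of each d^alpha. Conversely, each alpha other
    than gamma satisfies alpha_i < gamma_i for some i, so that alpha + e_i is
    in J. *)
Lemma W_finite ga : J ga -> (forall al, J al -> (msize al <= msize ga)%N) ->
  direct_sum J (fun al => if al == ga
     then [set lmul a * mp ga | a in calD_A eps gr D]
     else [set lmul a * mp al | a in [set: A]]) W.
Proof.
move=> Jg maxg; set G := fun al => _.
have Gin al a : J al -> al != ga -> G al (lmul a * mp al).
  by move=> Jal ne; rewrite /G (negbTE ne); exists a.
have cDs : subsp (calD_A eps gr D) by exact: span_subsp.
split=> [al _||s v us vG E al als].
- apply/subspP; rewrite /G; have im (U : set A) be : subsp U -> subsp [set lmul a * mp be | a in U].
    move=> Us; split=> [|c _ _ [x Ux <-] [y Uy <-]].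
      by exists 0; [exact: subsp0|rewrite linear0 mul0r].
    exists (c *: x + y); first by case: Us => _; apply.
    by rewrite linearP/= mulrDl scalerAl.
  by case: eqP => _; apply: im.
- pose Z := span (\bigcup_(al in J) G al).
  have Zs : subsp Z by exact: span_subsp.
  have ZG al X : J al -> G al X -> Z X by move=> Jal GX; apply: sub_span; exists al.
  have lowZ X : mpows (msize ga) X -> Z X.
    apply: span_min => // Y [a [al [Jal sal ->]]]; apply: (ZG al) => //.
    by apply: Gin => //; apply: contraTneq sal => ->; rewrite ltnn.
  have redX l m X Y (Q : set (endo A)) : subsp Q -> AD D X -> egr m Y ->
      (forall (k : Gamma) b al, J al -> gr k b -> Q (br (lmul b * mp al) Y)) -> Q (br X Y).
    move=> Qs hX gY h; have [n hn] := mpows_AD hX.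
    have hY1 : span [set Y] Y by apply: sub_span.
    pose G1 := [set X | exists (k : Gamma) b al, [/\ J al, gr k b & X = lmul b * mp al]].
    have hX1 : span G1 X.
      apply: (span_min _ _ hn) => [|T [a [al [Jal _ ->]]]]; first exact: span_subsp.
      apply: (hom_ind (P := [set a | span G1 (lmul a * mp al)])).
        by apply: subsp_preim (span_subsp _) => c u w; rewrite linearP/= mulrDl scalerAl.
      by move=> k b gb; apply: sub_span; exists k, b, al.
    apply: (bracket_span (eps := eps) gE _ _ Qs _ hX1 hY1).
    + move=> T [k [b [al [Jal gb ->]]]]; exact: gr_hspan (endo_grM (lmul_gr gb) (mpow_gr al)).
    + by move=> _ ->; exact: gr_hspan gY.
    + by move=> T _ [k [b [al [Jal gb ->]]]] ->; exact: h gb.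
  apply/seteqP; split.
    apply: (W_min_gen Zs) => [l m X a hX _ gaa|l m X e hX _ he].
      apply: (redX l m X (lmul a) Z Zs hX (lmul_gr gaa)) => k b al Jal gb.
      rewrite (br_lmul_mul gb (mpow_gr al) gaa); apply: lowZ; apply: mpows_lmul.
      exact: (mpows_le (maxg _ Jal) (br_mpow Jal gaa)).
    apply: (redX l m X e Z Zs hX (hD_endo he)) => k b al Jal gb.
    rewrite (br_anti (endo_grM (lmul_gr gb) (mpow_gr al)) (hD_endo he)).
    rewrite (br_mulr (hD_endo he) (lmul_gr gb) (mpow_gr al)) (br_der (proj2 he) gb).
    rewrite (br_mpow_comm al (F1D_D (proj1 he)) (hD_endo he)) mulr0 scaler0 addr0.
    apply: (subspN Zs); apply: (subspZ _ Zs); apply: (ZG al) => //.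
    have [ag|ag] := eqVneq al ga; last exact: Gin.
    rewrite /G ag eqxx; exists (e b) => //; apply: sub_span.
    by exists e; [exact: D_calD he|exists b].
  apply: span_min => // X [al Jal]; rewrite /G.
  case: (eqVneq al ga) => [_|ag] [a ha <-]; first exact: calD_A_W.
  apply: (W_mpow (J' := J `\ ga)) => [? []//|be [Jb bg]|be be' [Jb _] Jb' sb|].
  + (* a multi-index other than the maximal one is covered by an element of J *)
    have [i lt] : exists i, (be i < ga i)%N.
      apply: contrapT => h; apply: bg.
      have le i : (ga i <= be i)%N by rewrite leqNgt; apply/negP => lt; apply: h; exists i.
      pose r := undup ((finsupp ga : seq I) ++ (finsupp be : seq I)).
      have ur : uniq r by exact: undup_uniq.
      have sg : {subset finsupp ga <= r} by move=> i ig; rewrite mem_undup mem_cat ig.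
      have sb : {subset finsupp be <= r} by move=> i ib; rewrite mem_undup mem_cat ib orbT.
      have := maxg _ Jb; rewrite (msizeE ur sg) (msizeE ur sb) => leS.
      apply/fsfunP => i; have [ir|ir] := boolP (i \in r); last first.
        rewrite !fsfun_dflt//; first by apply: contra ir; exact: sg.
        by apply: contra ir; exact: sb.
      apply/eqP; rewrite eqn_leq le andbT; move: leS.
      rewrite !(bigD1_seq i)//= => leS; rewrite leqNgt; apply/negP => lt.
      move: leS; apply/negP; rewrite -ltnNge -addSn; apply: leq_add => //.
      exact: leq_sum.
    exists i; have [hp ho] := Jb; have [gp go] := Jg.
    split=> [p pF j|j jo]; rewrite updE; case: (eqVneq j i) => [ji|_].
    * exact: leq_trans lt (gp _ pF i).
    * exact: hp.
    * by apply: leq_trans lt (go i _); rewrite -ji.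
    * exact: ho.
  + by split=> // E'; move: sb; rewrite E' ltnNge (maxg _ Jb).
  + by split=> //; apply/eqP.
have [a aP] : exists a : multi_index I -> A, forall al, al \in s -> v al = lmul (a al) * mp al.
  have : forall al, exists b, al \in s -> v al = lmul b * mp al.
    move=> be; case: (boolP (be \in s)) => bs; last by exists 0.
    have [_] := vG _ bs; rewrite /G; case: (eqVneq be ga) => [->|_] [b _ <-]; by exists b.
  by move=> /choice[a aP]; exists a.
rewrite (aP _ als) (_ : a al = 0) ?linear0 ?mul0r//.
apply: (@mpow_indep (msize ga).+1 s a us) => //.
  by move=> be bs; have [Jb _] := vG _ bs; split=> //; rewrite ltnS; exact: maxg.
by rewrite -[RHS]E big_seq [RHS]big_seq; apply: eq_bigr => be /aP ->.
Qed.

End Basis.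

Unset Implicit Arguments.

Theorem theorem3p9 (F : fieldType) (Gamma : zmodType)
    (eps : Gamma -> Gamma -> F) (A : algType F) (gr : Gamma -> set A)
    (D : set (endo A)) :
  2%N \notin [pchar F] ->
  skew_bicharacter eps ->
  graded_algebra gr ->
  color_commutative_algebra eps gr ->
  D `<=` Der eps gr ->
  graded_subspace (Der_gr eps gr) D ->
  (exists2 d, D d & d <> 0) ->
  color_commutative_subspace eps gr D ->
  graded_D_simple gr D ->
  (forall (disp : Order.disp_t) (I : orderType disp) (d : I -> endo A)
      (dg : I -> Gamma),
    homogeneous_F1_basis eps gr D d dg ->
    (infinite_set (calJ eps dg) -> W eps gr D = AD D)
    /\
    (finite_set (calJ eps dg) ->
     forall gamma : multi_index I, calJ eps dg gamma ->
     (forall alpha, calJ eps dg alpha -> (msize alpha <= msize gamma)%N) ->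
     direct_sum (calJ eps dg)
       (fun alpha => if alpha == gamma
          then [set lmul a * mpow d gamma | a in calD_A eps gr D]
          else [set lmul a * mpow d alpha | a in [set: A]])
       (W eps gr D)))
  /\
  [/\ forall x y, W eps gr D x -> W eps gr D y ->
        W_mod_F1_bracket eps gr D (lmod_pi (F1_endo D) x) (lmod_pi (F1_endo D) y)
        = lmod_pi (F1_endo D) (color_bracket eps (endo_gr gr) x y),
      lie_color_algebra eps (W_mod_F1 eps gr D) (W_mod_F1_gr eps gr D)
        (W_mod_F1_bracket eps gr D) &
      lie_color_simple (W_mod_F1 eps gr D) (W_mod_F1_gr eps gr D)
        (W_mod_F1_bracket eps gr D) <->
      ~ exceptional_case eps gr D].
Proof.
move=> *; have S : setting eps gr D by split.
split; last exact: W_mod_F1_simplicity.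
move=> disp I d dg basis; split=> [|_ gamma]; first exact: (W_infinite basis).
exact: (W_finite basis).
Qed.
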